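(* Let $T$ be a scalar Calder\'on--Zygmund operator with Dini-continuous kernel $K$ (as defined in the context), let $\rho\in(2,\infty)$, and suppose that $\mathcal{V}_{\rho}(\mathcal T_{\ast})$ is bounded on $L^q(\mathbb R^d)$ for some $q\in(1,\infty)$. Let $\varepsilon\in(0,1)$. Then there is a constant $C>0$ (independent of $f$ and $Q_0$) such that for every cube $Q_0\subset\mathbb R^d$ and every $f\in L^\infty(\mathbb R^d)$ with $\operatorname{supp}(f)\subset Q_0$, there exists a family $\mathcal F\subset\mathcal D(Q_0)$ of pairwise disjoint dyadic subcubes of $Q_0$ such that (i) $\sum_{Q\in\mathcal F}|Q|\le\varepsilon|Q_0|$; (ii) for a.e. $x\in Q_0$, $$\Big|\mathcal{V}_{\rho}(\mathcal T_{\ast}f)(x)-\sum_{Q\in\mathcal F}\mathcal{V}_{\rho}(\mathcal T_{\ast}(f\chi_{3Q}))(x)\chi_Q(x)\Big|\le C\,|f|_{3Q_0};$$ (iii) for every collection $\overline{\mathcal F}$ of pairwise disjoint dyadic subcubes of $Q_0$ that covers $\mathcal F$, for a.e. $x\in Q_0$, $$\Big|\mathcal{V}_{\rho}(\mathcal T_{\ast}f)(x)-\sum_{Q\in\overline{\mathcal F}}\mathcal{V}_{\rho}(\mathcal T_{\ast}(f\chi_{3Q}))(x)\chi_Q(x)\Big|\le C\,|f|_{3Q_0}.$$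
   Context: A scalar Calder\'on--Zygmund operator $T$ is a linear operator bounded on $L^2(\mathbb R^d)$ associated with a kernel $K(x,y)$ defined for $x\neq y$ in $\mathbb R^d$ satisfying: $|K(x,y)|\le C|x-y|^{-d}$ for $x\ne y$; and for all $x,x',y$ with $|x-x'|\le|x-y|/2$, $|K(x,y)-K(x',y)|+|K(y,x)-K(y,x')|\le C\,\omega(|x-x'|/|x-y|)\,|x-y|^{-d}$, where $\omega:[0,\infty)\to[0,\infty)$ is increasing, subadditive, $\omega(0)=0$, and satisfies the Dini condition $\int_0^1\omega(t)\,dt/t<\infty$. For $\epsilon>0$, $T_\epsilon f(x):=\int_{|x-y|>\epsilon}K(x,y)f(y)\,dy$. For $\rho\in(2,\infty)$ the variation operator is $\mathcal{V}_{\rho}(\mathcal T_{\ast}f)(x):=\sup_{\epsilon_i\searrow0}\big(\sum_{i=1}^\infty|T_{\epsilon_{i+1}}f(x)-T_{\epsilon_i}f(x)|^\rho\big)^{1/\rho}$, the supremum over all sequences $\{\epsilon_i\}$ decreasing to $0$. Cubes have sides parallel to the axes; for $t>0$, $tQ$ is the cube concentric with $Q$ of side length $t\,\ell(Q)$. $|f|_{Q}:=\frac1{|Q|}\int_Q|f|$. $\mathcal D(Q_0)$ is the set of dyadic subcubes of $Q_0$ (obtained by repeatedly subdividing $Q_0$ and its descendants into $2^d$ congruent subcubes). A collection $\overline{\mathcal F}$ of cubes covers $\mathcal F$ if every $Q\in\mathcal F$ is contained in some $R\in\overline{\mathcal F}$. *)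

(* Defs.v *)
(* R^d is modelled as d.-tuple R,
   which MathComp-Analysis equips with the product (Borel) sigma-algebra. *)
From HB Require Import structures.
From mathcomp Require Import all_boot all_order all_algebra.
From mathcomp Require Import all_classical all_reals all_analysis.
From mathcomp Require Import complex.

Set Implicit Arguments.
Unset Strict Implicit.
Unset Printing Implicit Defensive.

Import Order.TTheory GRing.Theory Num.Theory.
Local Open Scope classical_set_scope.
Local Open Scope ring_scope.

Section CZ_defs.
Context {R : realType}.

Fixpoint lebesgue_nd (n : nat) : set (n.-tuple R) -> \bar R :=
  match n return set (n.-tuple R) -> \bar R with
  | 0 => fun A => (\1_A [tuple] : R)%:E
  | n'.+1 => pushforward
      ((@lebesgue_measure R) \x (@lebesgue_nd n'))%E
      (fun p : R * n'.-tuple R => [tuple of p.1 :: p.2])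
  end.
Arguments lebesgue_nd : clear implicits.

Local Notation C := (complex.complex R).
Definition cmod (z : C) : R :=
  Num.sqrt (complex.Re z ^+ 2 + complex.Im z ^+ 2).

Variable d : nat.
Local Notation Rd := (d.-tuple R).
Local Notation leb := (lebesgue_nd d).

Definition dist (x y : Rd) : R :=
  Num.sqrt (\sum_(i < d) (tnth x i - tnth y i) ^+ 2).

Definition ae_in (A : set Rd) (P : Rd -> Prop) : Prop :=
  negligible leb [set x | A x /\ ~ P x].

Definition Lpnorm (p : R) (g : Rd -> \bar R) : \bar R :=
  ((\int[leb]_x (`|g x| `^ p)) `^ p^-1)%E.

Definition cmeasurable (f : Rd -> C) : Prop :=
  measurable_fun [set: Rd] (fun x => complex.Re (f x)) /\
  measurable_fun [set: Rd] (fun x => complex.Im (f x)).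

Definition Lp_fun (p : R) (f : Rd -> C) : Prop :=
  cmeasurable f /\ (\int[leb]_x ((cmod (f x) `^ p)%:E) < +oo)%E.

Definition Linfty_fun (f : Rd -> C) : Prop :=
  cmeasurable f /\ exists M : R, negligible leb [set x | M < cmod (f x)].

Definition dini_modulus (omega : R -> R) : Prop :=
  [/\ omega 0 = 0,
      (forall t, 0 <= t -> 0 <= omega t),
      (forall s t, 0 <= s -> s <= t -> omega s <= omega t),
      (forall s t, 0 <= s -> 0 <= t -> omega (s + t) <= omega s + omega t) &
      (\int[@lebesgue_measure R]_(t in [set t : R | (0 < t <= 1)%R])
          ((omega t / t)%:E) < +oo)%E].

Definition CZ_kernel (K : Rd -> Rd -> C) (omega : R -> R) : Prop :=
  exists c : R,
    (forall x y, x != y -> cmod (K x y) <= c * (dist x y ^+ d)^-1) /\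
    (forall x x' y, x != y -> dist x x' <= dist x y / 2 ->
       cmod (K x y - K x' y) + cmod (K y x - K y x')
         <= c * omega (dist x x' / dist x y) * (dist x y ^+ d)^-1).

Definition cint (A : set Rd) (g : Rd -> C) : C :=
  complex.Complex (fine (\int[leb]_(y in A) ((complex.Re (g y))%:E))%E)
                  (fine (\int[leb]_(y in A) ((complex.Im (g y))%:E))%E).

Definition kint (K : Rd -> Rd -> C) (f : Rd -> C) (A : set Rd) (x : Rd) : C :=
  cint A (fun y => K x y * f y).

(* T is a linear operator bounded on L^2 associated with the kernel K:
   Tf(x) = int K(x,y) f(y) dy for a.e. x outside the (essential) support of f *)
Definition CZ_operator (T : (Rd -> C) -> Rd -> C) (K : Rd -> Rd -> C) : Prop :=
  [/\ (forall f g (a b : C), Lp_fun 2 f -> Lp_fun 2 g ->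
         negligible leb [set x | T (fun y => a * f y + b * g y) x
                                   != a * T f x + b * T g x]),
      (exists c : R, forall f, Lp_fun 2 f ->
         Lp_fun 2 (T f) /\
         (Lpnorm 2 (fun x => (cmod (T f x))%:E)
            <= c%:E * Lpnorm 2 (fun x => (cmod (f x))%:E))%E) &
      (forall f, Lp_fun 2 f ->
         negligible leb [set x | (exists r : R, 0 < r /\
                                    negligible leb [set y | dist x y < r /\ f y != 0])
                                 /\ T f x != kint K f setT x])].

Definition trunc_op (K : Rd -> Rd -> C) (eps : R) (f : Rd -> C) (x : Rd) : C :=
  kint K f [set y | eps < dist x y] x.

Definition var_op (K : Rd -> Rd -> C) (rho : R) (f : Rd -> C) (x : Rd) : \bar R :=
  ereal_sup [set ((\sum_(i <oo)
                     ((cmod (trunc_op K (e i.+1) f x - trunc_op K (e i) f x) `^ rho)%:E))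
                   `^ rho^-1)%E
            | e in [set e : nat -> R | (forall i, e i.+1 < e i) /\ e @ \oo --> 0]].

Definition var_Lq_bounded (K : Rd -> Rd -> C) (rho q : R) : Prop :=
  exists c : R, forall f, Lp_fun q f ->
    (Lpnorm q (var_op K rho f) <= c%:E * Lpnorm q (fun x => (cmod (f x))%:E))%E.

Definition cube (a : Rd) (l : R) : set Rd :=
  [set x | forall i, tnth a i <= tnth x i < tnth a i + l].

Definition dil_corner (t : R) (a : Rd) (l : R) : Rd :=
  [tuple tnth a i + l / 2 - t * l / 2 | i < d].

Definition dil_cube (t : R) (a : Rd) (l : R) : set Rd :=
  cube (dil_corner t a l) (t * l).

(* dyadic subcubes of Q0 = cube a l are indexed by (k, j), k the generation,
   j in {0, .., 2^k - 1}^d the position *)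
Definition dyadic_index (p : nat * d.-tuple nat) : Prop :=
  forall i, (tnth p.2 i < 2 ^ p.1)%N.

Definition dyad_corner (a : Rd) (l : R) (p : nat * d.-tuple nat) : Rd :=
  [tuple tnth a i + l * (tnth p.2 i)%:R / 2 ^+ p.1 | i < d].

Definition dyad_side (l : R) (p : nat * d.-tuple nat) : R := l / 2 ^+ p.1.

Definition dyad (a : Rd) (l : R) (p : nat * d.-tuple nat) : set Rd :=
  cube (dyad_corner a l p) (dyad_side l p).

Definition disjoint_dyadic_family (a : Rd) (l : R)
    (F : set (nat * d.-tuple nat)) : Prop :=
  F `<=` dyadic_index /\
  (forall p p', F p -> F p' -> p <> p' -> dyad a l p `&` dyad a l p' = set0).

Definition covers (a : Rd) (l : R) (Fb F : set (nat * d.-tuple nat)) : Prop :=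
  forall p, F p -> exists2 p', Fb p' & dyad a l p `<=` dyad a l p'.

Definition cube_avg (f : Rd -> C) (a : Rd) (l : R) : \bar R :=
  ((\int[leb]_(y in cube a l) ((cmod (f y))%:E)) * ((l ^+ d)^-1)%:E)%E.

Definition localized_sum (K : Rd -> Rd -> C) (rho : R) (f : Rd -> C)
    (a : Rd) (l : R) (F : set (nat * d.-tuple nat)) (x : Rd) : \bar R :=
  (\esum_(p in F)
     (var_op K rho (fun y => ((\1_(dil_cube 3 (dyad_corner a l p) (dyad_side l p)) y : C) * f y)%R) x
      * (\1_(dyad a l p) x)%:E))%E.

End CZ_defs.

(* Main.v *)
Require Import Defs.
From HB Require Import structures.
From mathcomp Require Import all_boot all_order all_algebra.
From mathcomp Require Import all_classical all_reals all_analysis measurable_realfun.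
From mathcomp Require Import complex ring lra.

Set Implicit Arguments.
Unset Strict Implicit.
Unset Printing Implicit Defensive.

Import Order.TTheory GRing.Theory Num.Theory.
Import numFieldNormedType.Exports.
Local Open Scope classical_set_scope.
Local Open Scope ring_scope.

(** Let [V] be the variation operator. Decompose [f = g + b] on [Q0] by the maximal dyadic cubes [P]
    on which [|f|] has average above a large multiple of its average over [Q0]; [g] is bounded by a
    multiple [M] of that average and [b] has mean zero on each [P]. The exceptional set [E] contains
    the points too close to some [P], the points where [V g > A M] (a small set, by Chebyshev and the
    [L^q] bound) and the points where the tail sum
      [H(x) = sum_P |P| omega(c s_P / |x - c_P|) |x - c_P|^-d]
    exceeds 1 (a small set, by the Dini condition). [F] consists of the maximal dyadic cubes of which
    [E] fills more than the proportion [2^-(d+1)]. A dyadic cube [Q] contained in no larger cube of [F]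
    has a point [x0] outside [E] with [V (g 1_{3Q})(x0) <= A M], and comparing with [x0] bounds
    [V (f 1_{(3Q)^c})] by a multiple of [M] on all of [Q]. Off [F], almost every point is outside [E],
    where [V f <= V g + V b] is bounded by a multiple of [M].

    Both the bad part at a point and the oscillation of the good part between two points of [Q] are
    sums over disjoint cubes of differences of the kernel. A cube at distance [D] with side [s]
    contributes its term of [H] to the annulus that contains it, unless it is cut by a sphere bounding
    an annulus; the cubes of side at most [s] cut by one sphere lie in a shell of volume
    [O(s D^(d-1))]. So along any sequence of annuli the sum of the squares is [O(M^2 (H + H^2))], and
    since [rho > 2] the square sums control the variation. *)

(** * Lebesgue measure on [R^d] *)

(** The operator bound on [V] is only of [L^q] type, while [f] is controlled only in average. It is
    therefore applied just to [g] and [g 1_{3Q}], both at most [M]. Chebyshev then gives thresholds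
    proportional to [M], and this keeps every constant independent of [f] and of the cube. For [b]
    no weak-type bound is used: its variation is bounded pointwise off the exceptional set.

    The obstacle is a piece cut by a sphere, which loses its cancellation. Estimated by absolute
    values it leaves [|P| |x - c_P|^-d], without the factor that makes [H] integrable. Squaring
    supplies a substitute, [s_P / |x - c_P|], because two cut pieces are multiplied only when the
    same sphere cuts both.

    The point [x0] exists by counting: [E] fills at most half of [Q], and [V (g 1_{3Q}) > A M] holds
    on at most a quarter of it. Kernel estimates are made for finitely many cubes; infinite families
    are reached in the limit, since a bound on the variation involves finitely many jumps at a
    time. *)

Section lebesgue_nd_measure.
Context {R : realType}.
Local Notation mR := (measurableTypeR R).

Let consT n (p : mR * n.-tuple R) : n.+1.-tuple R := [tuple of p.1 :: p.2].
Let unconsT n (x : n.+1.-tuple R) : mR * n.-tuple R := (thead x, [tuple of behead x]).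

Let consTK n : cancel (@consT n) (@unconsT n).
Proof.
move=> [x y]; rewrite /unconsT /consT theadE /=; congr pair; exact/val_inj.
Qed.

Let measurable_consT n : measurable_fun [set: mR * n.-tuple R] (@consT n).
Proof. by apply: measurable_cons => //; exact: measurable_fst. Qed.

Let measurable_unconsT n : measurable_fun [set: n.+1.-tuple R] (@unconsT n).
Proof.
apply/measurable_fun_pair => /=.
  exact: measurable_tnth.
exact: measurable_behead.
Qed.

(** The recursion defines a bare set function. The induction carries a sigma-finite measure equal to
    it, because the product with the next factor requires one; rectangles of exhausting sets,
    transported by [unconsT], exhaust the space. *)
Lemma lebesgue_nd_sigma_finite n : exists m : {sigma_finite_measure set (n.-tuple R) -> \bar R},
  lebesgue_nd (R:=R) (n:=n) = m.
Proof.
elim: n => [|n [m mE]].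
  by exists (\d_ [tuple]); apply/funext.
pose l1 : {sigma_finite_measure set mR -> \bar R} := @lebesgue_measure R.
pose lm : {measure set (mR * n.-tuple R)%type -> \bar R} := (l1 \x m)%E.
pose mc : {mfun (mR * n.-tuple R)%type >-> _} := HB.pack (@consT n) (isMeasurableFun.Build _ _ _ _ _ (@measurable_consT n)).
pose mu := pushforward lm mc.
have musf : sigma_finite setT mu.
  have /sigma_finiteP[F [TF ndF Foo]] := sigma_finiteT l1.
  have /sigma_finiteP[G [TG ndG Goo]] := sigma_finiteT m.
  exists (fun k => @unconsT n @^-1` (F k `*` G k)).
    apply/esym/seteqP; split => // x _.
    have : setT (@unconsT n x).1 by [].
    rewrite TF => -[i _ Fi].
    have : setT (@unconsT n x).2 by [].
    rewrite TG => -[j _ Gj].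
    exists (maxn i j) => //; split.
      by move: Fi; exact/subsetPset/ndF/leq_maxl.
    by move: Gj; exact/subsetPset/ndG/leq_maxr.
  move=> k; have [mF Fk] := Foo k; have [mG Gk] := Goo k; split.
    by rewrite -[X in measurable X]setTI; apply: measurable_unconsT => //; exact: measurableX.
  rewrite /mu /pushforward -comp_preimage (_ : @unconsT n \o mc = id); last first.
    by apply/funext => x /=; rewrite consTK.
  by rewrite preimage_id /lm /= product_measure1E// lte_mul_pinfty// ge0_fin_numE.
pose mu1 : {measure set _ -> \bar R} := mu.
pose mu2 : {sigma_finite_measure set _ -> \bar R} := HB.pack mu (Measure_isSigmaFinite.Build _ _ _ mu musf).
have mc1 := @measurable_consT n.
by exists (mu2 mc1 mc1 mc1); rewrite /= mE.
Qed.

Lemma lebesgue_ndS n (A : set (n.+1.-tuple R)) :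
  lebesgue_nd A = (\int[lebesgue_measure]_(x in [set: mR])
     lebesgue_nd (fun y : n.-tuple R => A [tuple of x :: y]))%E.
Proof.
rewrite [LHS]/= /pushforward/product_measure1; apply: eq_integral => x _ /=.
by congr lebesgue_nd; apply/seteqP; split => y; rewrite /xsection /= ?inE.
Qed.

Let leb0 n : lebesgue_nd (n:=n) (@set0 (n.-tuple R)) = 0%E.
Proof. by have [m ->] := lebesgue_nd_sigma_finite n. Qed.
Let leb_ge0 n (A : set (n.-tuple R)) : (0 <= lebesgue_nd A)%E.
Proof. by have [m ->] := lebesgue_nd_sigma_finite n. Qed.
Let leb_sigma_additive n : semi_sigma_additive (@lebesgue_nd R n).
Proof.
have [m ->] := lebesgue_nd_sigma_finite n; exact: measure_semi_sigma_additive.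
Qed.
HB.instance Definition _ n :=
  isMeasure.Build _ _ _ (@lebesgue_nd R n) (@leb0 n) (@leb_ge0 n) (@leb_sigma_additive n).
Let leb_sigma_finite n : sigma_finite setT (@lebesgue_nd R n).
Proof. have [m ->] := lebesgue_nd_sigma_finite n; exact: sigma_finiteT. Qed.
HB.instance Definition _ n :=
  Measure_isSigmaFinite.Build _ _ _ (@lebesgue_nd R n) (@leb_sigma_finite n).

Lemma measurable_lebesgue_nd_section n (A : set (n.+1.-tuple R)) : measurable A ->
  measurable_fun [set: mR] (fun x => lebesgue_nd (fun y : n.-tuple R => A [tuple of x :: y])).
Proof.
move=> mA; have mB : measurable (@consT n @^-1` A).
  by rewrite -[X in measurable X]setTI; exact: measurable_consT.
have := measurable_fun_xsection (@lebesgue_nd R n) mB.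
congr (measurable_fun _ _); apply/funext => x /=.
by congr lebesgue_nd; apply/seteqP; split => y; rewrite /xsection /= ?inE.
Qed.

(** Uniqueness of Lebesgue measure: [t] times the image measure under the affine map gives every
    half-open interval its length. *)
Lemma lebesgue_measure_affine (t v : R) (A : set mR) : 0 < t -> measurable A ->
  lebesgue_measure ((fun x => t * x + v) @^-1` A) = (t^-1%:E * lebesgue_measure A)%E.
Proof.
move=> t0 mA.
have mphi : measurable_fun [set: mR] (fun x : mR => (t * x + v : mR)).
  by apply: measurable_funD => //; exact: measurable_funM.
pose phi : {mfun mR >-> mR} := HB.pack (fun x : mR => (t * x + v : mR))
  (isMeasurableFun.Build _ _ _ _ _ mphi).
have t0' : 0 <= t by exact: ltW.
pose nu mf : {measure set mR -> \bar R} := mscale (NngNum t0') (@measure_function_pushforward__canonical__measure_function_Measure _ _ mR mR R lebesgue_measure phi mf).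
have -> : lebesgue_measure A = nu mphi A.
  apply: lebesgue_measure_unique => // _ [[a b]] _ <-.
  rewrite /nu; transitivity (t%:E * lebesgue_measure (phi @^-1` `]a, b]%classic))%E; last by [].
  have -> : phi @^-1` `]a, b]%classic = `](a - v) / t, (b - v) / t]%classic.
    apply/seteqP; split => x /=; rewrite !in_itv /= ltr_pdivrMr // ler_pdivlMr // [x * t]mulrC ltrBlDr lerBrDr //.
  rewrite !lebesgue_measure_itv /= !lte_fin ltr_pM2r ?invr_gt0 // ltrD2r.
  case: ifPn => _; last by rewrite mule0.
  rewrite -!EFinD -EFinM; congr EFin; field; exact: lt0r_neq0.
transitivity (t^-1%:E * (t%:E * lebesgue_measure (phi @^-1` A)))%E; last by [].
rewrite muleA -EFinM mulVf ?mul1e //; exact: lt0r_neq0.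
Qed.

Lemma ge0_integral_affine (t v : R) (h : mR -> \bar R) : 0 < t ->
  measurable_fun [set: mR] h -> (forall x, 0 <= h x)%E ->
  (\int[lebesgue_measure]_(x in [set: mR]) h (t * x + v)%R = t^-1%:E * \int[lebesgue_measure]_(x in [set: mR]) h x)%E.
Proof.
move=> t0 mh h0.
have mphi : measurable_fun [set: mR] (fun x : mR => (t * x + v : mR)).
  by apply: measurable_funD => //; exact: measurable_funM.
have := @ge0_integral_pushforward _ _ mR mR R _ mphi lebesgue_measure setT h measurableT mh (fun x _ => h0 x).
rewrite preimage_setT => <-.
have t0' : 0 <= t^-1 by rewrite invr_ge0 ltW.
rewrite -(@ge0_integral_mscale _ mR R lebesgue_measure setT measurableT (NngNum t0') h) //.
apply: eq_measure_integral => A mA _.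
exact: lebesgue_measure_affine.
Qed.

Definition affine_nd n (t : R) (v y : n.-tuple R) : n.-tuple R :=
  [tuple t * tnth y i + tnth v i | i < n].

(** Induction on the dimension, slicing along the first coordinate. Its purpose is the exact scaling
    of balls, from which the volume of thin shells is derived. *)
Lemma lebesgue_nd_affine n (t : R) (v : n.-tuple R) (A : set (n.-tuple R)) :
  0 < t -> measurable A ->
  lebesgue_nd (affine_nd t v @^-1` A) = ((t ^+ n)^-1%:E * lebesgue_nd A)%E.
Proof.
move=> t0; elim: n v A => [|n IH] v A mA.
  rewrite /= expr0 invr1 mul1e !indicE; congr (_ _).
  congr (_ _); congr nat_of_bool; apply/asbool_equiv_eq.
  rewrite /preimage /mkset; suff -> : affine_nd t v [tuple] = [tuple] by [].
  exact/val_inj/size0nil/size_tuple.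
rewrite !lebesgue_ndS.
pose h (x : mR) := lebesgue_nd (fun y : n.-tuple R => A [tuple of x :: y]).
have mS x : measurable (fun y : n.-tuple R => A [tuple of x :: y]).
  rewrite -[X in measurable X]setTI.
  by apply: (@measurable_cons _ _ _ _ (fun=> x) n id) => //; exact: measurable_cst.
transitivity (\int[lebesgue_measure]_(x in [set: mR]) ((t ^+ n)^-1%:E * h (t * x + tnth v ord0)%R))%E.
  apply: eq_integral => x _.
  rewrite -(IH [tuple of behead v]) //; congr lebesgue_nd; apply/funext => y.
  rewrite /preimage /=; congr (A _); apply: eq_from_tnth => i.
  rewrite tnth_mktuple; case: (unliftP ord0 i) => [j ->|->].
    rewrite !tnthS tnth_mktuple tnth_behead (_ : inord j.+1 = lift ord0 j) //.
    by apply/val_inj; rewrite /= inordK // ltnS.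
  by rewrite !tnth0.
rewrite ge0_integralZl //; first last.
- by rewrite lee_fin invr_ge0 exprn_ge0 // ltW.
- apply: measurableT_comp => //; first exact: measurable_lebesgue_nd_section.
  by apply: measurable_funD => //; exact: measurable_funM.
rewrite ge0_integral_affine //; last exact: measurable_lebesgue_nd_section.
by rewrite muleA -EFinM -invfM exprS mulrC.
Qed.

Definition box n (a b : n.-tuple R) : set (n.-tuple R) :=
  [set x | forall i, tnth a i <= tnth x i < tnth b i].

Lemma measurable_box n (a b : n.-tuple R) : measurable (box a b).
Proof.
rewrite (_ : box a b = \bigcap_(i in [set: 'I_n]) ((@tnth n R ^~ i) @^-1` `[tnth a i, tnth b i[)); last first.
  by apply/seteqP; split => x /= H i; [move=> _|]; have := H i; rewrite /= in_itv; [|apply].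
apply: fin_bigcap_measurable => //.
move=> i _; rewrite -[X in measurable X]setTI; exact: measurable_tnth.
Qed.

Lemma tnth_behead_lift n (T : Type) (t : n.+1.-tuple T) i :
  tnth [tuple of behead t] i = tnth t (lift ord0 i).
Proof. by rewrite tnth_behead; congr tnth; apply/val_inj; rewrite /= inordK // ltnS. Qed.

Lemma lebesgue_nd_box n (a b : n.-tuple R) : (forall i, tnth a i <= tnth b i) ->
  lebesgue_nd (box a b) = (\prod_(i < n) (tnth b i - tnth a i))%:E.
Proof.
elim: n a b => [|n IH] a b ab.
  rewrite big_ord0 /= indicE mem_set //; by case.
rewrite lebesgue_ndS big_ord_recl.
pose c := \prod_(i < n) (tnth b (lift ord0 i) - tnth a (lift ord0 i)).
transitivity (\int[lebesgue_measure]_(x in [set: mR]) (c%:E * (\1_(`[tnth a ord0, tnth b ord0[%classic : set mR) x)%:E))%E.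
  apply: eq_integral => x _; rewrite indicE.
  case: (boolP (x \in _)) => /=.
    rewrite inE /= in_itv /= => xab; rewrite mule1.
    transitivity (lebesgue_nd (box [tuple of behead a] [tuple of behead b])); last first.
      rewrite IH; last by move=> i; rewrite !tnth_behead_lift.
      by congr EFin; apply: eq_bigr => i _; rewrite !tnth_behead_lift.
    congr lebesgue_nd; apply/seteqP; split => y Hy i.
      by have := Hy (lift ord0 i); rewrite !tnthS !tnth_behead_lift.
    by case: (unliftP ord0 i) => [j ->|->]; rewrite ?tnth0 // tnthS -!tnth_behead_lift; exact: Hy.
  rewrite notin_setE /= in_itv /= => xab; rewrite mule0 -[RHS](measure0 (@lebesgue_nd R n)).
  by congr lebesgue_nd; apply/seteqP; split => // y /(_ ord0).
rewrite ge0_integralZl //; last 2 first.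
- by apply/measurable_EFinP; exact: measurable_indic.
- by rewrite lee_fin prodr_ge0 // => i _; rewrite subr_ge0.
rewrite integral_indic //= setIT lebesgue_measure_itv /= lte_fin -EFinD.
case: ltP => [_|ba]; first by rewrite -EFinM mulrC.
have -> : tnth b ord0 = tnth a ord0 by apply/eqP; rewrite eq_le ba ab.
by rewrite mule0 subrr mul0r.
Qed.

Lemma cubeE n (a : n.-tuple R) l : cube a l = box a [tuple tnth a i + l | i < n].
Proof. by apply/seteqP; split => x /= H i; have := H i; rewrite tnth_mktuple. Qed.

Lemma measurable_cube n (a : n.-tuple R) l : measurable (cube a l).
Proof. by rewrite cubeE; exact: measurable_box. Qed.

Lemma lebesgue_nd_cube n (a : n.-tuple R) l : 0 <= l ->
  lebesgue_nd (cube a l) = (l ^+ n)%:E.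
Proof.
move=> l0; rewrite cubeE lebesgue_nd_box; last first.
  by move=> i; rewrite tnth_mktuple lerDl.
under eq_bigr do rewrite tnth_mktuple addrAC subrr add0r.
by rewrite prodr_const card_ord.
Qed.

End lebesgue_nd_measure.

(** * Modulus, finite [l^p] sums and distance *)

Section cmod_theory.
Context {R : realType}.
Local Notation C := (complex R).
Implicit Types z w : C.

Lemma cmodE z : cmod z = Normc.normc z.
Proof. by case: z. Qed.

Lemma cmod_ge0 z : 0 <= cmod z.
Proof. exact: sqrtr_ge0. Qed.

Lemma cmod0 : cmod (0 : C) = 0.
Proof. by rewrite cmodE Normc.normc0. Qed.

Lemma cmodM z w : cmod (z * w) = cmod z * cmod w.
Proof. by rewrite !cmodE Normc.normcM. Qed.

Lemma cmodD z w : cmod (z + w) <= cmod z + cmod w.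
Proof. by rewrite !cmodE; exact: le_normcD. Qed.

Lemma cmodN z : cmod (- z) = cmod z.
Proof. by rewrite !cmodE; exact: normcN. Qed.

Lemma cmod_distrC z w : cmod (z - w) = cmod (w - z).
Proof. by rewrite -cmodN opprB. Qed.

Lemma cmod_sum (I : Type) (s : seq I) (P : pred I) (F : I -> C) :
  cmod (\sum_(i <- s | P i) F i) <= \sum_(i <- s | P i) cmod (F i).
Proof.
elim/big_ind2: _ => [|x z y w xz yw|//]; first by rewrite cmod0.
by apply: le_trans (cmodD _ _) _; exact: lerD.
Qed.

Lemma cmod_Re z : `|complex.Re z| <= cmod z.
Proof.
by rewrite -sqrtr_sqr ler_wsqrtr// lerDl sqr_ge0.
Qed.

Lemma cmod_Im z : `|complex.Im z| <= cmod z.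
Proof.
by rewrite -sqrtr_sqr ler_wsqrtr// lerDr sqr_ge0.
Qed.

Lemma cmod_le z : cmod z <= `|complex.Re z| + `|complex.Im z|.
Proof.
rewrite -(@ger0_norm _ (_ + _)) ?addr_ge0// -sqrtr_sqr ler_wsqrtr//.
rewrite sqrrD !real_normK ?num_real// lerD2r lerDl.
by rewrite mulrn_wge0// mulr_ge0.
Qed.

Lemma cmod_real (a : R) : cmod (Complex a 0) = `|a|.
Proof. by rewrite /cmod /= expr0n addr0 sqrtr_sqr. Qed.

End cmod_theory.

Section minkowski_sum.
Context {R : realType} (I : Type).
Implicit Types (r : seq I) (a b : I -> R).

Definition lp_sum (p : R) r a : R := (\sum_(i <- r) a i `^ p) `^ p^-1.

Lemma lp_sum_ge0 (p : R) r a : 0 <= lp_sum p r a.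
Proof. exact: powR_ge0. Qed.

Lemma le_lp_sum (p : R) r a b : 0 < p -> (forall i, 0 <= a i <= b i) ->
  lp_sum p r a <= lp_sum p r b.
Proof.
move=> p0 ab; apply: ge0_ler_powR; rewrite ?invr_ge0 ?(ltW p0)//.
- by rewrite nnegrE sumr_ge0// => i _; exact: powR_ge0.
- by rewrite nnegrE sumr_ge0// => i _; exact: powR_ge0.
apply: ler_sum => i _; have /andP[a0 ab'] := ab i.
by apply: ge0_ler_powR => //; rewrite ?nnegrE ?(ltW p0)// (le_trans a0).
Qed.

Lemma lp_sum_powR (p : R) r a : 0 < p -> lp_sum p r a `^ p = \sum_(i <- r) a i `^ p.
Proof.
move=> p0; rewrite /lp_sum -powRrM mulVf ?gt_eqF// powRr1//.
by rewrite sumr_ge0// => i _; exact: powR_ge0.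
Qed.

Lemma lp_sum_le (p : R) r a (B : R) : 0 < p -> 0 <= B ->
  (lp_sum p r a <= B) = (\sum_(i <- r) a i `^ p <= B `^ p).
Proof.
move=> p0 B0; apply/idP/idP => [h|h].
  rewrite -lp_sum_powR//; apply: ge0_ler_powR => //; rewrite ?nnegrE ?(ltW p0)//.
  exact: lp_sum_ge0.
rewrite -[B]powRr1// -(divff (lt0r_neq0 p0)) powRrM.
apply: ge0_ler_powR => //; rewrite ?nnegrE ?invr_ge0 ?(ltW p0) ?powR_ge0//.
by rewrite sumr_ge0// => i _; exact: powR_ge0.
Qed.

(** Convexity of the power [p] at the normalised values [a i / A] and [b i / B], with weights
    [A / (A + B)] and [B / (A + B)], summed over [i]. *)
Lemma minkowski_sum (p : R) r a b : 1 <= p -> (forall i, 0 <= a i) -> (forall i, 0 <= b i) ->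
  lp_sum p r (fun i => a i + b i) <= lp_sum p r a + lp_sum p r b.
Proof.
move=> p1 a0 b0; have p0 : 0 < p by exact: lt_le_trans p1.
(* The normalisation divides by both norms, so a vanishing norm is settled first: all its terms are
   then zero. *)
have zero (c d : I -> R) : (forall i, 0 <= c i) -> lp_sum p r c = 0 ->
    lp_sum p r (fun i => c i + d i) <= lp_sum p r d.
  move=> c0 /eqP; rewrite powR_eq0 invr_eq0 (gt_eqF p0) andbT => /eqP c_eq0.
  rewrite le_eqVlt; apply/orP; left; apply/eqP.
  congr (_ `^ _); elim: r c_eq0 => [|i r IH]; first by rewrite !big_nil.
  rewrite !big_cons => /eqP; rewrite paddr_eq0 ?powR_ge0//; last first.
    by rewrite sumr_ge0// => j _; exact: powR_ge0.
  by move=> /andP[/eqP/powR_eq0_eq0 -> /eqP/IH ->]; rewrite add0r.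
have [A0|A0] := eqVneq (lp_sum p r a) 0; first by rewrite A0 add0r zero.
have [B0|B0] := eqVneq (lp_sum p r b) 0.
  rewrite B0 addr0; apply: le_trans (zero b a b0 B0).
  by apply: le_lp_sum => // i; rewrite addr_ge0//= addrC.
have [A EA] : {A | lp_sum p r a = A} by exists (lp_sum p r a).
have [B EB] : {B | lp_sum p r b = B} by exists (lp_sum p r b).
have {}A0 : 0 < A by rewrite -EA lt0r A0 lp_sum_ge0.
have {}B0 : 0 < B by rewrite -EB lt0r B0 lp_sum_ge0.
rewrite EA EB.
have AB0 : 0 < A + B by exact: addr_gt0.
rewrite lp_sum_le ?(ltW AB0)//.
have w01 : 0 <= A / (A + B) <= 1.
  by rewrite divr_ge0 ?(ltW A0) ?(ltW AB0)//= ler_pdivrMr// mul1r lerDl ltW.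
have key i : (a i + b i) `^ p <= (A + B) `^ p *
    (A / (A + B) * (a i `^ p / A `^ p) + B / (A + B) * (b i `^ p / B `^ p)).
  have h (x X : R) : 0 <= x -> 0 < X -> x `^ p / X `^ p = (x / X) `^ p.
    by move=> x0 X0; rewrite powRM ?invr_ge0 ?(ltW X0)// -[X^-1]powR_inv1 ?(ltW X0)// -powRrM mulN1r powRN.
  have -> : a i + b i = (A + B) * (A / (A + B) * (a i / A) + B / (A + B) * (b i / B)).
    by field; rewrite !lt0r_neq0.
  rewrite powRM ?(ltW AB0)//; last first.
    by rewrite addr_ge0// !mulr_ge0// ?invr_ge0 ?(ltW A0) ?(ltW B0) ?(ltW AB0).
  rewrite ler_wpM2l ?powR_ge0// !h//.
  pose t := Itv01 (proj1 (andP w01)) (proj2 (andP w01)).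
  have := @convex_powR R p p1 t (a i / A) (b i / B).
  rewrite !inE /= !in_itv /= !andbT !divr_ge0 ?(ltW A0) ?(ltW B0)// => /(_ isT isT).
  rewrite !convRE; move=> hc; rewrite (_ : B / (A + B) = unstable.onem t%:num)//.
  by rewrite /unstable.onem /t /=; field; rewrite lt0r_neq0.
apply: le_trans (ler_sum _ (fun i _ => key i)) _.
rewrite -mulr_sumr big_split/= -!mulr_sumr -!mulr_suml -!lp_sum_powR// EA EB.
rewrite !divff ?powR_eq0 ?gt_eqF// !mulr1 -mulrDl divff ?gt_eqF// mulr1.
by [].
Qed.

(** Each term is at most [B], so its power [p] is at most [B ^ (p - 2)] times its square. This is
    how square sums control the variation, with no loss in the constant. *)
Lemma lp_sum_le_l2 (p : R) r a (B : R) : 2 <= p -> 0 <= B -> (forall i, 0 <= a i) ->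
  \sum_(i <- r) a i ^+ 2 <= B ^+ 2 -> lp_sum p r a <= B.
Proof.
move=> p2 B0 a0 h; have p0 : 0 < p by exact: lt_le_trans p2.
rewrite lp_sum_le//.
have pE (x : R) : 0 <= x -> x `^ p = x `^ (p - 2) * x ^+ 2.
  move=> x0; rewrite -powR_mulrn// -powRD ?subrK// gt_eqF//.
have small : \sum_(i <- r) a i `^ p <= B `^ (p - 2) * \sum_(i <- r) a i ^+ 2.
  elim: r h => [|i r IH]; first by rewrite !big_nil mulr0.
  rewrite !big_cons => h.
  have s0 : 0 <= \sum_(j <- r) a j ^+ 2 by rewrite sumr_ge0// => j _; exact: sqr_ge0.
  have aiB : a i <= B.
    by rewrite -(@ler_pXn2r _ 2)// ?nnegrE//; apply: le_trans h; rewrite lerDl.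
  rewrite mulrDr lerD//; last by apply: IH; apply: le_trans h; rewrite lerDr sqr_ge0.
  rewrite pE// ler_wpM2r ?sqr_ge0// ge0_ler_powR// ?nnegrE// subr_ge0//.
by apply: le_trans small _; rewrite (pE B)// ler_wpM2l// powR_ge0.
Qed.

End minkowski_sum.

Section dist_theory.
Context {R : realType} {d : nat}.
Implicit Types x y z : d.-tuple R.

Lemma dist_ge0 x y : 0 <= dist x y.
Proof. exact: sqrtr_ge0. Qed.

Lemma distC x y : dist x y = dist y x.
Proof. by congr Num.sqrt; apply: eq_bigr => i _; rewrite -sqrrN opprB. Qed.

Lemma distxx x : dist x x = 0.
Proof. by rewrite /dist big1 ?sqrtr0// => i _; rewrite subrr expr0n. Qed.

Lemma dist_lp x y : dist x y = lp_sum 2 (index_enum 'I_d) (fun i => `|tnth x i - tnth y i|).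
Proof.
rewrite /lp_sum powR12_sqrt; last by rewrite sumr_ge0// => i _; exact: powR_ge0.
by congr Num.sqrt; apply: eq_bigr => i _; rewrite powR_mulrn// real_normK ?num_real.
Qed.

Lemma dist_triangle y x z : dist x z <= dist x y + dist y z.
Proof.
have ge0 (u v : d.-tuple R) i : 0 <= `|tnth u i - tnth v i| by exact: normr_ge0.
have le12 : 1 <= 2 :> R by rewrite ler1n.
rewrite !dist_lp.
apply: le_trans (minkowski_sum (index_enum 'I_d) le12 (ge0 x y) (ge0 y z)).
apply: le_lp_sum => [|i]; first by rewrite ltr0n.
 rewrite normr_ge0/=.
by rewrite -(subrKA (tnth y i)) ler_normD.
Qed.

Lemma coord_le_dist x y i : `|tnth x i - tnth y i| <= dist x y.
Proof.
rewrite -sqrtr_sqr ler_wsqrtr// (bigD1 i)//= lerDl sumr_ge0// => j _.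
exact: sqr_ge0.
Qed.

(** The crude factor [d], in place of its square root, is the source of the multiples of [d%:R] in
    the geometric constants below. *)
Lemma dist_le x y (s : R) : (forall i, `|tnth x i - tnth y i| <= s) -> dist x y <= d%:R * s.
Proof.
move=> h; case: (posnP d) => [d0|d0].
  rewrite /dist big1 ?sqrtr0 ?d0 ?mul0r// => i _.
  by exfalso; case: i => i; rewrite d0.
have s0 : 0 <= s by apply: le_trans (h (Ordinal d0)); exact: normr_ge0.
have ds0 : 0 <= d%:R * s by rewrite mulr_ge0.
rewrite -(ger0_norm ds0) -sqrtr_sqr ler_wsqrtr//.
apply: (@le_trans _ _ (\sum_(i < d) s ^+ 2)).
  apply: ler_sum => i _; rewrite -real_normK ?num_real//.
  by rewrite ler_pXn2r ?nnegrE.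
rewrite sumr_const card_ord -[_ *+ d]mulr_natl exprMn; apply: ler_wpM2r.
  exact: sqr_ge0.
by rewrite -natrX ler_nat leq_pmulr.
Qed.

Lemma dist_gt0 x y : x != y -> 0 < dist x y.
Proof.
move=> xy; rewrite lt0r dist_ge0 andbT; apply: contra xy => /eqP h.
apply/eqP/eq_from_tnth => i; apply/eqP; rewrite -subr_eq0 -normr_le0 -h.
exact: coord_le_dist.
Qed.

Lemma measurable_dist : measurable_fun [set: d.-tuple R * d.-tuple R]
  (fun p => dist p.1 p.2).
Proof.
apply: measurableT_comp; first exact: continuous_measurable_fun (@sqrt_continuous R).
apply: measurable_sum => i; apply: measurable_funX; apply: measurable_funB.
  by apply: (@measurableT_comp _ _ _ _ _ _ (fun x => tnth x i) _ fst) => //; exact: measurable_tnth.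
by apply: (@measurableT_comp _ _ _ _ _ _ (fun x => tnth x i) _ snd) => //; exact: measurable_tnth.
Qed.

Lemma measurable_distr x : measurable_fun [set: d.-tuple R] (dist x).
Proof.
by apply: (@measurableT_comp _ _ _ _ _ _ _ _ (pair x) measurable_dist).
Qed.

End dist_theory.

(** * Dyadic cubes and stopping times *)

Section dyadic_cubes.
Context {R : realType} {d : nat}.
Variables (a : d.-tuple R) (l : R).
Hypothesis l0 : 0 < l.
Implicit Types (x y : d.-tuple R) (p : nat * d.-tuple nat).

(** The position of the cube of generation [k] that contains [x], meaningful for [x] in the big
    cube. *)
Definition dyad_code (k : nat) x : d.-tuple nat :=
  [tuple Num.truncn (2 ^+ k * ((tnth x i - tnth a i) / l)) | i < d].

(** Integer division of the position by a power of two gives the cube of generation [m] that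
    contains [p]. It has this meaning for [m <= p.1] only, natural subtraction being truncated. *)
Definition dyad_anc (m : nat) p : nat * d.-tuple nat :=
  (m, [tuple (tnth p.2 i %/ 2 ^ (p.1 - m))%N | i < d]).

Lemma dyad_side_gt0 p : 0 < dyad_side l p.
Proof. by rewrite divr_gt0// exprn_gt0. Qed.

(** Dyadic cubes become fibres of [dyad_code], so that nesting and disjointness reduce to arithmetic
    of natural numbers. *)
Lemma dyad_codeP p x : cube a l x -> (dyad a l p x <-> dyad_code p.1 x = p.2).
Proof.
move=> Qx.
have E i : (tnth (dyad_corner a l p) i <= tnth x i < tnth (dyad_corner a l p) i + dyad_side l p)
    = ((tnth p.2 i)%:R <= 2 ^+ p.1 * ((tnth x i - tnth a i) / l) < (tnth p.2 i).+1%:R).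
  rewrite tnth_mktuple /dyad_side.
  have k0 : 0 < 2 ^+ p.1 :> R by rewrite exprn_gt0.
  set c := tnth p.2 i; set k : R := 2 ^+ p.1 in k0 *.
  rewrite -[RHS]/((c%:R <= k * ((tnth x i - tnth a i) / l)) && (k * ((tnth x i - tnth a i) / l) < c.+1%:R)).
  rewrite -ler_pdivrMl// ler_pdivlMr// -ltr_pdivlMl// ltr_pdivrMr// lerBrDl ltrBlDl.
  have -> : tnth a i + l * c%:R / k = tnth a i + k^-1 * c%:R * l by ring.
  by have -> : tnth a i + k^-1 * c%:R * l + l / k = tnth a i + k^-1 * c.+1%:R * l by ring.
have g0 i : 0 <= 2 ^+ p.1 * ((tnth x i - tnth a i) / l).
  rewrite mulr_ge0 ?exprn_ge0// divr_ge0 ?(ltW l0)// subr_ge0.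
  by have /andP[] := Qx i.
split=> [h|h i].
  apply: eq_from_tnth => i; rewrite tnth_mktuple; apply: truncn_def.
  by rewrite -E.
by rewrite E -h tnth_mktuple truncn_itv.
Qed.

Lemma dyadic_index_code k x : cube a l x -> dyadic_index (k, dyad_code k x).
Proof.
move=> Qx i; rewrite tnth_mktuple /=.
have /andP[h1 h2] := Qx i.
rewrite truncn_lt_nat; last first.
  by rewrite mulr_ge0 ?exprn_ge0// divr_ge0 ?(ltW l0)// subr_ge0.
rewrite natrX -[ltRHS]mulr1 ltr_pM2l ?exprn_gt0//.
by rewrite ltr_pdivrMr// mul1r ltrBlDl.
Qed.

Lemma dyad_sub_cube p : dyadic_index p -> dyad a l p `<=` cube a l.
Proof.
move=> dp x h i; have := h i; rewrite tnth_mktuple => /andP[h1 h2].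
have k0 : 0 < 2 ^+ p.1 :> R by rewrite exprn_gt0.
apply/andP; split.
  by apply: le_trans h1; rewrite lerDl divr_ge0 ?(ltW k0)// mulr_ge0 ?(ltW l0).
apply: lt_le_trans h2 _; rewrite -addrA lerD2l /dyad_side -mulrDl ler_pdivrMr//.
rewrite -[X in _ + X]mulr1 -mulrDr natr1 ler_pM2l// -natrX ler_nat.
exact: dp.
Qed.

(** Truncation commutes with division by a power of two; this is the nesting of dyadic cubes in
    terms of positions. *)
Lemma dyad_code_div k m x : (m <= k)%N -> cube a l x ->
  dyad_code m x = [tuple (tnth (dyad_code k x) i %/ 2 ^ (k - m))%N | i < d].
Proof.
move=> mk Qx; apply: eq_from_tnth => i; rewrite !tnth_mktuple.
set u := (tnth x i - tnth a i) / l.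
have u0 : 0 <= u.
  by rewrite divr_ge0 ?(ltW l0)// subr_ge0; have /andP[] := Qx i.
have ku0 j : 0 <= 2 ^+ j * u by rewrite mulr_ge0 ?exprn_ge0.
have p0 : (0 < 2 ^ (k - m))%N by rewrite expn_gt0.
have kE : 2 ^+ k * u = 2 ^+ m * u * (2 ^ (k - m))%:R :> R.
  by rewrite natrX mulrAC -exprD subnKC.
have /andP[h1 h2] := truncn_itv (ku0 k).
apply: truncn_def; rewrite kE in h1 h2 *; apply/andP; split.
  rewrite -(@ler_pM2r _ (2 ^ (k - m))%:R) ?ltr0n//; apply: le_trans h1.
  by rewrite -natrM ler_nat leq_divM.
rewrite -(@ltr_pM2r _ (2 ^ (k - m))%:R) ?ltr0n//; apply: lt_le_trans h2 _.
by rewrite -natrM ler_nat ltn_ceil.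
Qed.

Lemma dyad_corner_in p : dyad a l p (dyad_corner a l p).
Proof. by move=> i; rewrite lexx ltrDl dyad_side_gt0. Qed.

Lemma sub_dyad_anc m p : (m <= p.1)%N -> dyadic_index p ->
  dyad a l p `<=` dyad a l (dyad_anc m p).
Proof.
move=> mp dp x px; have Qx := dyad_sub_cube dp px.
apply/(dyad_codeP _ Qx) => /=; rewrite (dyad_code_div mp Qx).
by rewrite (proj1 (dyad_codeP _ Qx) px).
Qed.

Lemma dyadic_index_anc m p : (m <= p.1)%N -> dyadic_index p ->
  dyadic_index (dyad_anc m p).
Proof.
move=> mp dp i; rewrite tnth_mktuple /= ltn_divLR ?expn_gt0//.
by rewrite -expnD subnKC.
Qed.

Lemma dyad_index_inj p p' : dyadic_index p -> dyadic_index p' ->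
  p.1 = p'.1 -> dyad a l p `&` dyad a l p' !=set0 -> p = p'.
Proof.
move=> dp dp' pp' [x [px p'x]]; have Qx := dyad_sub_cube dp px.
apply/eqP; rewrite -pair_eqE /= pp' eqxx/=; apply/eqP.
rewrite -(proj1 (dyad_codeP _ Qx) px) -(proj1 (dyad_codeP _ Qx) p'x).
by rewrite pp'.
Qed.

Lemma measurable_dyad p : measurable (dyad a l p).
Proof. exact: measurable_cube. Qed.

Lemma lebesgue_nd_dyad p : lebesgue_nd (dyad a l p) = (dyad_side l p ^+ d)%:E.
Proof. by rewrite lebesgue_nd_cube// ltW// dyad_side_gt0. Qed.

Definition level_set (n : nat) (J : set (d.-tuple nat)) : set (d.-tuple R) :=
  cube a l `&` [set x | J (dyad_code n x)].

Definition level_index (n : nat) (J : set (d.-tuple nat)) : set (d.-tuple nat) :=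
  J `&` [set j | dyadic_index (n, j)].

Lemma finite_level_index n J : finite_set (level_index n J).
Proof.
pose f (t : d.-tuple 'I_(2 ^ n)) : d.-tuple nat := [tuple (tnth t i : nat) | i < d].
apply: (@sub_finite_set _ _ (f @` setT)); last exact: finite_image.
move=> j [_ dj]; exists [tuple Ordinal (dj i) | i < d] => //.
by apply: eq_from_tnth => i; rewrite !tnth_mktuple.
Qed.

Lemma level_setE n J :
  level_set n J = \bigcup_(j in level_index n J) dyad a l (n, j).
Proof.
apply/seteqP; split => [x [Qx Jx]|x [j [Jj dj] jx]].
  exists (dyad_code n x); last exact/dyad_codeP.
  by split => //; exact: dyadic_index_code.
have Qx := dyad_sub_cube dj jx; split => //=.
by have /= -> := proj1 (dyad_codeP (n, j) Qx) jx.
Qed.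

Lemma measurable_level_set n J : measurable (level_set n J).
Proof.
rewrite level_setE; apply: fin_bigcup_measurable; first exact: finite_level_index.
by move=> j _; exact: measurable_dyad.
Qed.

Lemma trivIset_level n J : trivIset (level_index n J) (fun j => dyad a l (n, j)).
Proof.
move=> j j' [_ dj] [_ dj'] h.
by have [] := @dyad_index_inj (n, j) (n, j') dj dj' erefl h.
Qed.

Lemma level_set_up n N J : (n <= N)%N -> exists J', level_set N J' = level_set n J.
Proof.
move=> nN; exists [set j | J [tuple (tnth j i %/ 2 ^ (N - n))%N | i < d]].
apply/seteqP; split => x [Qx /= Jx]; split => //=.
  by rewrite (dyad_code_div nN Qx).
by rewrite -(dyad_code_div nN Qx).
Qed.

Lemma cube_finite : (lebesgue_nd (cube a l) < +oo)%E.
Proof. by rewrite lebesgue_nd_cube ?ltW// ltry. Qed.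

(** The two errors are the part of [A] in the cube that the level set misses and the part that it
    adds. The measurable sets approximable in this sense form a sigma-algebra, which is how averages
    over dyadic cubes come to control a bounded function almost everywhere. *)
Definition level_approx (A : set (d.-tuple R)) := forall e : R, 0 < e ->
  exists n J, (lebesgue_nd ((cube a l `&` A) `\` level_set n J) <= e%:E)%E /\
              (lebesgue_nd (level_set n J `\` A) <= e%:E)%E.

Lemma level_approx0 : level_approx set0.
Proof.
move=> e e0; exists 0%N, set0.
by rewrite setI0 set0D /level_set /= setI0 set0D measure0 lee_fin ltW.
Qed.

(** Complementing [J] exchanges the two errors. *)
Lemma level_approxC A : measurable A -> level_approx A -> level_approx (~` A).
Proof.
move=> mA hA e e0; have [n [J [h1 h2]]] := hA e e0.
exists n, (~` J); split; [apply: le_trans h2|apply: le_trans h1].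
all: rewrite le_eqVlt; apply/orP; left; apply/eqP; congr lebesgue_nd.
- apply/seteqP; split => x /= [[k1 k2] k3]; split => //.
    by split => //; apply: contrapT => h; apply: k3; split.
  by case => _; apply.
- apply/seteqP; split => x /= [[k1 k2] k3]; split.
  + by split => //; exact: contrapT.
  + by case => _; exact: k2.
  + by split => // Jx; apply: k3.
  + by apply.
Qed.

Lemma level_approxU A B : measurable A -> measurable B ->
  level_approx A -> level_approx B -> level_approx (A `|` B).
Proof.
move=> mA mB hA hB e e0.
have e20 : 0 < e / 2 by rewrite divr_gt0.
have [n [J [A1 A2]]] := hA _ e20.
have [m [J' [B1 B2]]] := hB _ e20.
have [J1 J1E] := level_set_up J (leq_maxl n m).
have [J2 J2E] := level_set_up J' (leq_maxr n m).
have UE : level_set (maxn n m) (J1 `|` J2) = level_set n J `|` level_set m J'.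
  by rewrite -J1E -J2E /level_set -setIUr.
have mQ := @measurable_cube R d a l.
have mL := measurable_level_set.
exists (maxn n m), (J1 `|` J2); rewrite UE [e]splitr EFinD; split.
  apply: (@le_trans _ _ (lebesgue_nd (((cube a l `&` A) `\` level_set n J) `|` ((cube a l `&` B) `\` level_set m J')))).
    apply: le_measure; rewrite ?inE.
    - by apply: measurableD; [apply: measurableI => //; exact: measurableU|exact: measurableU].
    - by apply: measurableU; apply: measurableD => //; exact: measurableI.
    by move=> x [[Qx [Ax|Bx]] /not_orP[nJ nJ']]; [left|right].
  apply: le_trans; last exact: (leeD A1 B1).
  by apply: measureU2; apply: measurableD => //; exact: measurableI.
apply: (@le_trans _ _ (lebesgue_nd ((level_set n J `\` A) `|` (level_set m J' `\` B)))).
  apply: le_measure; rewrite ?inE.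
  - by apply: measurableD; exact: measurableU.
  - by apply: measurableU; exact: measurableD.
  by move=> x [[Jx|Jx] /not_orP[nA nB]]; [left|right].
apply: le_trans; last exact: (leeD A2 B2).
by apply: measureU2; exact: measurableD.
Qed.

(** A finite union exhausts the countable one up to small measure because the cube has finite
    measure; the finite union is then approximated. *)
Lemma level_approx_bigcup (F : (set (d.-tuple R))^nat) :
  (forall k, measurable (F k)) -> (forall k, level_approx (F k)) ->
  level_approx (\bigcup_k F k).
Proof.
move=> mF hF e e0; have e20 : 0 < e / 2 by rewrite divr_gt0.
pose G n := \big[setU/set0]_(k < n) F k.
have mG n : measurable (G n) by exact: bigsetU_measurable.
have hG n : level_approx (G n).
  elim: n => [|n IH]; first by rewrite /G big_ord0; exact: level_approx0.
  by rewrite /G big_ord_recr /=; apply: level_approxU => //; exact: mG.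
have GE : \bigcup_n G n = \bigcup_k F k.
  apply/seteqP; split => x [n _].
    by rewrite /G -bigcup_mkord => -[k /= kn Fk]; exists k.
  by move=> Fx; exists n.+1 => //; rewrite /G -bigcup_mkord; exists n => /=.
pose T n := (cube a l `&` \bigcup_k F k) `\` G n.
have mQ := @measurable_cube R d a l.
have mT n : measurable (T n).
  by apply: measurableD => //; apply: measurableI => //; exact: bigcupT_measurable.
have T0 : \bigcap_n T n = set0.
  apply/seteqP; split => // x h.
  have [[_ ]] := h 0%N I; rewrite -GE => -[n _ Gx] _.
  by have [_] := h n I.
have := @nonincreasing_cvg_mu _ _ _ (@lebesgue_nd R d) T.
rewrite T0 measure0.
have : (lebesgue_nd (T 0%N) < +oo)%E.
  apply: le_lt_trans cube_finite; apply: le_measure; rewrite ?inE//.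
  by move=> x [[]].
move=> /[swap] /[apply] /(_ mT measurable0).
have : {homo T : n m / (n <= m)%N >-> (m <= n)%O}.
  move=> n m nm; apply/subsetPset; apply: setDS.
  exact: subset_bigsetU.
move=> /[swap] /[apply] /fine_cvgP[fT].
move=> /cvgrPdist_lt /(_ _ e20) [N _ HN].
have [M _ HM] := fT.
pose n := maxn N M.
have Tn : (lebesgue_nd (T n) <= (e / 2)%:E)%E.
  have /= <- := fineK (HM n (leq_maxr _ _)); rewrite lee_fin.
  have := HN n (leq_maxl _ _); rewrite /= sub0r normrN ger0_norm; first by move/ltW.
  exact: fine_ge0.
have [m [J [h1 h2]]] := hG n _ e20.
have mL := measurable_level_set.
exists m, J; split.
  apply: (@le_trans _ _ (lebesgue_nd (((cube a l `&` G n) `\` level_set m J) `|` T n))).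
    apply: le_measure; rewrite ?inE.
    - by apply: measurableD => //; apply: measurableI => //; exact: bigcupT_measurable.
    - by apply: measurableU => //; apply: measurableD => //; exact: measurableI.
    move=> x [[Qx Fx] nJ]; case: (pselect (G n x)) => Gx; [by left|by right].
  rewrite [e]splitr EFinD; apply: le_trans; last exact: (leeD h1 Tn).
  by apply: measureU2 => //; apply: measurableD => //; exact: measurableI.
apply: (@le_trans _ _ (lebesgue_nd (level_set m J `\` G n))).
  apply: le_measure; rewrite ?inE.
  - by apply: measurableD => //; exact: bigcupT_measurable.
  - exact: measurableD.
  by apply: setDS; rewrite -GE; exact: bigcup_sup.
by apply: le_trans h2 _; rewrite lee_fin ler_pdivrMr// ler_pMr// ler1n.
Qed.

(** Cells are kept when their lower corner is at or above [c]. Nothing is added, and what is missed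
    lies in the one layer of cells straddling [c], of thickness [l / 2 ^+ n]. *)
Lemma level_approx_ray (i : 'I_d) (c : R) :
  level_approx [set x | c <= tnth x i].
Proof.
move=> e e0.
have [n /ltW hn] : exists n, l ^+ d / e < 2 ^+ n.
  have [n hn] : exists n : nat, l ^+ d / e < n%:R.
    by exists (Num.truncn (l ^+ d / e)).+1; exact: truncnS_gt.
  exists n; apply: lt_le_trans hn _; rewrite -natrX ler_nat.
  exact/ltnW/ltn_expl.
exists n, [set j | c <= tnth a i + l * (tnth j i)%:R / 2 ^+ n].
have mL := measurable_level_set.
have corner x : cube a l x -> tnth a i + l * (tnth (dyad_code n x) i)%:R / 2 ^+ n <= tnth x i
     < tnth a i + l * (tnth (dyad_code n x) i)%:R / 2 ^+ n + l / 2 ^+ n.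
  move=> Qx; have := proj2 (dyad_codeP (n, dyad_code n x) Qx) erefl i.
  by rewrite /dyad_corner tnth_mktuple.
split; last first.
  rewrite (_ : _ `\` _ = set0) ?measure0 ?lee_fin ?ltW//.
  apply/seteqP; split => // x /= [[Qx /= h]]; apply.
  by have /andP[h1 _] := corner x Qx; exact: le_trans h1.
pose lo := [tuple if j == i then c else tnth a j | j < d].
pose hi := [tuple if j == i then c + l / 2 ^+ n else tnth a j + l | j < d].
apply: (@le_trans _ _ (lebesgue_nd (box lo hi))).
  apply: le_measure; rewrite ?inE.
  - apply: measurableD => //; apply: measurableI; first exact: measurable_cube.
    rewrite (_ : mkset _ = (fun x => tnth x i) @^-1` `[c, +oo[%classic); last first.
      by apply/seteqP; split => x /=; rewrite in_itv/= andbT.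
    by rewrite -[X in measurable X]setTI; apply: measurable_tnth.
  - exact: measurable_box.
  move=> x [[Qx /= cx] h] j; rewrite !tnth_mktuple; case: eqP => [->|_]; last exact: Qx.
  rewrite cx/=; have /andP[_ h2] := corner x Qx.
  apply: lt_le_trans h2 _; rewrite lerD2r leNgt; apply/negP => h3.
  by apply: h; split => //=; exact: ltW.
have n0 : 0 < 2 ^+ n :> R by rewrite exprn_gt0.
rewrite lebesgue_nd_box; last first.
  by move=> j; rewrite !tnth_mktuple; case: eqP => _; rewrite lerDl; [apply: divr_ge0|]; exact: ltW.
rewrite lee_fin (bigD1 i)//= !tnth_mktuple eqxx.
rewrite (eq_bigr (fun=> l)); last first.
  by move=> j /negbTE ji; rewrite !tnth_mktuple ji addrAC subrr add0r.
rewrite prodr_const cardC1 card_ord addrAC subrr add0r mulrAC -exprS.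
rewrite prednK; last exact: leq_ltn_trans (ltn_ord i).
by rewrite ler_pdivrMr// mulrC -ler_pdivrMr.
Qed.

(** Good-sets argument: the rays in the coordinates generate the product sigma-algebra. *)
Lemma measurable_level_approx A : measurable A -> level_approx A.
Proof.
pose C := [set B : set (d.-tuple R) | measurable B /\ level_approx B].
have sC : sigma_algebra setT C.
  split.
  - by split; [exact: measurable0|exact: level_approx0].
  - move=> B [mB hB]; rewrite setTD; split; first exact: measurableC.
    exact: level_approxC.
  - move=> F hF; split; first by apply: bigcupT_measurable => k; have [] := hF k.
    by apply: level_approx_bigcup => k; have [] := hF k.
suff : measurable `<=` C by move=> h /h [].
apply: smallest_sub => //.
have key (i : 'I_d) : preimage_set_system setT (fun x : d.-tuple R => tnth x i) measurable `<=` C.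
  move=> _ [B mB <-].
  pose C' := image_set_system setT (fun x : d.-tuple R => tnth x i) C.
  have sC' : sigma_algebra setT C' by exact: sigma_algebra_image.
  suff : measurable `<=` C' by move=> /(_ _ mB); rewrite /C' /image_set_system/=.
  rewrite [X in X `<=` _](_ : _ = (RGenCInfty.G (R:=R)).-sigma.-measurable); last first.
    exact: RGenCInfty.measurableE.
  apply: smallest_sub => // _ [c ->]; rewrite /C' /image_set_system/= setTI.
  rewrite (_ : _ @^-1` _ = [set x | c <= tnth x i]); last first.
    by apply/seteqP; split => x /=; rewrite in_itv/= andbT.
  split; last exact: level_approx_ray.
  rewrite (_ : mkset _ = (fun x => tnth x i) @^-1` `[c, +oo[%classic); last first.
    by apply/seteqP; split => x /=; rewrite in_itv/= andbT.
  by rewrite -[X in measurable X]setTI; apply: measurable_tnth.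
elim/big_ind: _ => //.
  by move=> X Y hX hY B [/hX|/hY].
Qed.

(** The bound holds on level sets by additivity and passes to [A] by approximation; boundedness of
    [h] controls the part of [A] that is missed. *)
Lemma integral_dyadic_le (h : d.-tuple R -> R) (th M : R) : 0 <= th ->
  measurable_fun setT h -> (forall x, 0 <= h x <= M) ->
  (forall p, dyadic_index p ->
     \int[@lebesgue_nd R d]_(x in dyad a l p) (h x)%:E <= th%:E * lebesgue_nd (dyad a l p))%E ->
  forall A, measurable A -> A `<=` cube a l ->
  (\int[@lebesgue_nd R d]_(x in A) (h x)%:E <= th%:E * lebesgue_nd A)%E.
Proof.
move=> th0 mh hM hdy A mA AQ.
have M0 : 0 <= M by have /andP[/le_trans h1 /h1] := hM a.
have mEh D : measurable_fun D (EFin \o h).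
  by apply/measurable_EFinP; exact: measurable_funTS.
have h0 x : (0 <= (h x)%:E)%E by rewrite lee_fin; have /andP[] := hM x.
have mD := measurable_dyad.
have level n J : (\int[@lebesgue_nd R d]_(x in level_set n J) (h x)%:E <= th%:E * lebesgue_nd (level_set n J))%E.
  have fin := finite_level_index n J.
  have setE : level_set n J = \big[setU/set0]_(j <- finmap.enum_fset (fset_set (level_index n J))) dyad a l (n, j).
    by rewrite level_setE bigcup_fset_set.
  have tJ : trivIset [set` finmap.enum_fset (fset_set (level_index n J))] (fun j => dyad a l (n, j)).
    have tl := @trivIset_level n J; move=> j j' /= hj hj'; apply: tl.
      by move: hj; rewrite in_fset_set// inE.
    by move: hj'; rewrite in_fset_set// inE.
  rewrite setE (ge0_integral_bigsetU (@lebesgue_nd R d) (fun j => measurable_dyad (n, j)) (finmap.fset_uniq _) tJ (f := EFin \o h))//; last by move=> x _; exact: h0.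
  rewrite -setE level_setE measure_fin_bigcup//; last exact: trivIset_level.
  rewrite fsbig_finite//= ge0_sume_distrr; last by move=> j _; exact: measure_ge0.
  rewrite big_seq [leRHS]big_seq; apply: lee_sum => j.
  rewrite in_fset_set// inE => -[_ dj]; exact: hdy.
have fA : lebesgue_nd A \is a fin_num.
  rewrite ge0_fin_numE//; apply: le_lt_trans cube_finite.
  by apply: le_measure; rewrite ?inE//; exact: measurable_cube.
apply/lee_addgt0Pr => e e0.
(* The excess of the level set over [A] costs [th * e'], the missed part [M * e']. *)
pose e' := e / (th + M + 1).
have thM : 0 < th + M + 1 by rewrite ltr_wpDl// addr_ge0.
have e'0 : 0 < e' by rewrite divr_gt0.
have [n [J [h1 h2]]] := measurable_level_approx mA e'0.
have mJ := measurable_level_set n J.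
apply: (@le_trans _ _ (\int[@lebesgue_nd R d]_(x in level_set n J `|` (A `\` level_set n J)) (h x)%:E)%E).
  apply: ge0_subset_integral => //.
  - by apply: measurableU => //; exact: measurableD.
  by move=> x Ax; case: (pselect (level_set n J x)); [left|right].
rewrite (@ge0_integral_setU _ _ _ _ _ _ mJ) //; last 2 first.
- exact: measurableD.
- by rewrite disj_set2E setDIK.
apply: (@le_trans _ _ (th%:E * (lebesgue_nd A + e'%:E) + (M * e')%:E)%E).
  apply: leeD.
    apply: le_trans (level n J) _; rewrite lee_wpmul2l ?lee_fin//.
    apply: (@le_trans _ _ (lebesgue_nd (A `|` (level_set n J `\` A)))).
      apply: le_measure; rewrite ?inE//.
      - by apply: measurableU => //; exact: measurableD.
      by move=> x Jx; case: (pselect (A x)); [left|right].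
    apply: le_trans; last exact: (leeD (lexx _) h2).
    by apply: measureU2 => //; exact: measurableD.
  apply: (@le_trans _ _ (\int[@lebesgue_nd R d]_(x in (A `\` level_set n J)) M%:E)%E).
    apply: ge0_le_integral => //.
    - exact: measurableD.
    - by move=> x _; rewrite lee_fin; have /andP[] := hM x.
  rewrite integral_cst; last exact: measurableD.
  rewrite EFinM lee_wpmul2l ?lee_fin//.
  by move: h1; rewrite (_ : cube a l `&` A = A)//; apply/setIidPr.
move: fA; case: (lebesgue_nd A) => // r _.
rewrite -EFinD -!EFinM -!EFinD lee_fin mulrDr -addrA lerD2l -mulrDl /e'.
by rewrite mulrCA ger_pMr// ler_pdivrMr// mul1r lerDl.
Qed.

(** This takes the place of Lebesgue differentiation: on the set where [h] is at least
    [th + n.+1%:R^-1] the average of [h] would exceed [th], unless that set is null. *)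
Lemma dyadic_average_le_ae (h : d.-tuple R -> R) (th M : R) : 0 <= th ->
  measurable_fun setT h -> (forall x, 0 <= h x <= M) ->
  (forall p, dyadic_index p ->
     \int[@lebesgue_nd R d]_(x in dyad a l p) (h x)%:E <= th%:E * lebesgue_nd (dyad a l p))%E ->
  negligible (@lebesgue_nd R d) [set x | cube a l x /\ th < h x].
Proof.
move=> th0 mh hM hdy.
have mQ := @measurable_cube R d a l.
pose A n := cube a l `&` [set x | th + n.+1%:R^-1 <= h x].
have mA n : measurable (A n).
  apply: measurableI => //.
  rewrite (_ : mkset _ = h @^-1` `[th + n.+1%:R^-1, +oo[%classic); last first.
    by apply/seteqP; split => x /=; rewrite in_itv/= andbT.
  by rewrite -[X in measurable X]setTI; exact: mh.
apply: (@negligibleS _ _ _ _ (\bigcup_n A n)).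
  move=> x [Qx hx]; have d0 : 0 < h x - th by rewrite subr_gt0.
  exists (Num.truncn (h x - th)^-1) => //; split => //=.
  rewrite -lerBrDl -[leRHS]invrK lef_pV2 ?posrE ?invr_gt0//.
  exact/ltW/truncnS_gt.
apply: negligible_bigcup => n; apply/negligibleP => //.
have fA : lebesgue_nd (A n) \is a fin_num.
  rewrite ge0_fin_numE//; apply: le_lt_trans cube_finite.
  by apply: le_measure; rewrite ?inE// => x [].
have := @integral_dyadic_le h th M th0 mh hM hdy (A n) (mA n) (@subIsetl _ _ _).
have : ((th + n.+1%:R^-1)%:E * lebesgue_nd (A n) <= \int[@lebesgue_nd R d]_(x in A n) (h x)%:E)%E.
  rewrite -integral_cst//; apply: ge0_le_integral => //.
  - by move=> x _; rewrite lee_fin addr_ge0.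
  - by apply/measurable_EFinP; exact: measurable_funTS.
  - by move=> x [_ hx]; rewrite lee_fin.
move=> /le_trans /[apply]; rewrite -(fineK fA) -!EFinM lee_fin mulrDl gerDl.
rewrite pmulr_rle0 ?invr_gt0// => h0; apply/eqP; rewrite eq_le measure_ge0 andbT.
by rewrite -[leLHS](fineK fA) lee_fin.
Qed.

Definition stopping (S : set (nat * d.-tuple nat)) : set (nat * d.-tuple nat) :=
  [set p | [/\ dyadic_index p, S p & forall m, (m < p.1)%N -> ~ S (dyad_anc m p)]].

Lemma dyad_anc_id p : dyad_anc p.1 p = p.
Proof.
case: p => k j; rewrite /dyad_anc /=; congr pair.
by apply: eq_from_tnth => i; rewrite tnth_mktuple subnn expn0 divn1.
Qed.

Lemma dyad_anc_anc m n p : (m <= n)%N -> (n <= p.1)%N ->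
  dyad_anc m (dyad_anc n p) = dyad_anc m p.
Proof.
move=> mn np; rewrite /dyad_anc /=; congr pair.
apply: eq_from_tnth => i; rewrite !tnth_mktuple -divnMA -expnD.
by rewrite addnBA// subnK.
Qed.

(** The least generation at which an ancestor has the property [S] gives the stopped cube. *)
Lemma stopping_anc S m p : dyadic_index p -> (m <= p.1)%N -> S (dyad_anc m p) ->
  exists2 n, (n <= m)%N & stopping S (dyad_anc n p).
Proof.
move=> dp mp Sm.
have : exists n, (n <= m)%N && `[< S (dyad_anc n p) >].
  by exists m; rewrite leqnn; apply/asboolP.
move=> hex; case: (ex_minnP hex) => n /andP[nm /asboolP Sn] hmin.
exists n => //; split => //; first by apply: dyadic_index_anc => //; exact: leq_trans mp.
move=> k /= kn; rewrite dyad_anc_anc ?(ltnW kn)//; last exact: leq_trans mp.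
move=> Sk; have := hmin k; rewrite (leq_trans (ltnW kn) nm) (asboolT Sk) => /(_ isT).
by rewrite leqNgt kn.
Qed.

(** Comparison of volumes. In dimension 0 all dyadic cubes coincide, hence the condition on [d]. *)
Lemma dyad_subset_index p p' : dyadic_index p -> dyadic_index p' -> (0 < d)%N ->
  dyad a l p `<=` dyad a l p' -> (p'.1 <= p.1)%N.
Proof.
move=> dp dp' d0 pp'.
have : (lebesgue_nd (dyad a l p) <= lebesgue_nd (dyad a l p'))%E.
  by apply: le_measure; rewrite ?inE//; exact: measurable_dyad.
rewrite !lebesgue_nd_dyad lee_fin ler_pXn2r// ?nnegrE ?(ltW (dyad_side_gt0 _))//.
rewrite /dyad_side ler_pM2l// lef_pV2 ?posrE ?exprn_gt0//.
by rewrite ler_eXn2l// ltr1n.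
Qed.

(** Of two overlapping stopped cubes one is an ancestor of the other, and a stopped cube has no
    proper ancestor with the property [S]. *)
Lemma stopping_disjoint S : disjoint_dyadic_family a l (stopping S).
Proof.
split; first by move=> p [].
suff key p p' : stopping S p -> stopping S p' -> (p.1 <= p'.1)%N ->
    dyad a l p `&` dyad a l p' !=set0 -> p = p'.
  move=> p p' Sp Sp' pp'; apply: contrapT => /eqP/set0P h.
  case/orP: (leq_total p.1 p'.1) => h1; first exact/pp'/key.
  by apply/pp'/esym/key => //; rewrite setIC.
move=> [dp Sp _] [dp' Sp' hp'] kk' [x [px p'x]].
have anc : p = dyad_anc p.1 p'.
  apply: dyad_index_inj => //; first exact: dyadic_index_anc.
  by exists x; split => //; exact: (sub_dyad_anc kk' dp' p'x).
move: kk'; rewrite leq_eqVlt => /orP[/eqP kk'|lt]; last first.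
  by have := hp' _ lt; rewrite -anc.
by rewrite anc kk' dyad_anc_id.
Qed.

Lemma dyad_parent_side k p : p.1 = k.+1 ->
  dyad_side l (dyad_anc k p) ^+ d = 2 ^+ d * dyad_side l p ^+ d.
Proof.
move=> pk; rewrite -exprMn; congr (_ ^+ d).
rewrite /dyad_side /= pk exprS; field.
by rewrite expf_eq0 pnatr_eq0 andbF.
Qed.

Lemma measurable_dyad_bigcup (F : set (nat * d.-tuple nat)) :
  measurable (\bigcup_(p in F) dyad a l p).
Proof.
rewrite bigcup_mkcond; apply: countable_bigcupT_measurable => // p.
by case: ifP => _; [exact: measurable_dyad|exact: measurable0].
Qed.

(** Used twice: for [|f|], where it gives the Calderon-Zygmund cubes, and for the indicator of the
    exceptional set, where it gives the family of the theorem. The third clause is stated for every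
    dyadic cube lying in no other selected cube, so that it serves both the selected cubes and the
    cubes of a covering family; the parent of such a cube fails the stopping condition, which costs
    [2 ^+ d]. *)
Lemma stopping_time (h : d.-tuple R -> R) (th M : R) : (0 < d)%N -> 0 < th ->
  measurable_fun setT h -> (forall x, 0 <= h x <= M) ->
  (\int[@lebesgue_nd R d]_(x in cube a l) (h x)%:E <= (th * l ^+ d)%:E)%E ->
  exists F, [/\ disjoint_dyadic_family a l F,
    ((\esum_(p in F) (dyad_side l p ^+ d)%:E) <=
       th^-1%:E * \int[@lebesgue_nd R d]_(x in cube a l) (h x)%:E)%E,
    (forall p, dyadic_index p ->
       (forall p', F p' -> dyad a l p `<=` dyad a l p' -> p' = p) ->
       (\int[@lebesgue_nd R d]_(x in dyad a l p) (h x)%:E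
          <= (2 ^+ d * th * dyad_side l p ^+ d)%:E)%E) &
    negligible (@lebesgue_nd R d)
      [set x | cube a l x /\ (forall p, F p -> ~ dyad a l p x) /\ th < h x]].
Proof.
move=> d0 th0 mh hM hQ.
have mQ := @measurable_cube R d a l.
have mEh D : measurable_fun D (EFin \o h).
  by apply/measurable_EFinP; exact: measurable_funTS.
have h0 x : (0 <= (h x)%:E)%E by rewrite lee_fin; have /andP[] := hM x.
have mD := measurable_dyad.
pose S : set (nat * d.-tuple nat) := [set p | ((th * dyad_side l p ^+ d)%:E <
  \int[@lebesgue_nd R d]_(x in dyad a l p) (h x)%:E)%E].
have [dF tF] := stopping_disjoint S.
have tFd : trivIset (stopping S) (dyad a l).
  by apply/trivIsetP => p p' Fp Fp' /eqP; exact: tF.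
exists (stopping S); split.
- split => //.
- apply: ge_ereal_sup => _ [X [fX XF] <-].
  rewrite -lee_pdivrMl ?invr_gt0// invrK.
  rewrite fsbig_finite//= sumEFin -EFinM mulr_sumr -sumEFin.
  have tX : trivIset [set` finmap.enum_fset (fset_set X)] (dyad a l).
    apply: sub_trivIset tFd => p /=.
    by rewrite in_fset_set// inE; exact: XF.
  apply: (@le_trans _ _ (\int[@lebesgue_nd R d]_(x in \big[setU/set0]_(p <- finmap.enum_fset (fset_set X)) dyad a l p) (h x)%:E)%E).
    rewrite (ge0_integral_bigsetU (@lebesgue_nd R d) measurable_dyad (finmap.fset_uniq _) tX (f := EFin \o h))//; last by move=> x _; exact: h0.
    rewrite big_seq [leRHS]big_seq; apply: lee_sum => p.
    by rewrite in_fset_set// inE => /XF [_ /ltW].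
  rewrite -bigcup_fset_set//; apply: ge0_subset_integral => //.
  - by apply: fin_bigcup_measurable => // p _; exact: measurable_dyad.
  by move=> x [p /XF/dF/dyad_sub_cube]; apply.
- move=> p dp hp.
  have hS m : (m < p.1)%N -> ~ S (dyad_anc m p).
    move=> mp Sm; have [n nm Fn] := stopping_anc dp (ltnW mp) Sm.
    have np : (n <= p.1)%N by exact: leq_trans (ltnW mp).
    have /= := hp _ Fn (sub_dyad_anc np dp).
    by move=> /(congr1 fst) /= nE; move: mp; rewrite -nE ltnNge nm.
  have dd : 0 <= dyad_side l p ^+ d by rewrite exprn_ge0// ltW// dyad_side_gt0.
  (* The cube of generation 0 has no parent; the hypothesis on the whole cube serves instead. *)
  case: (p.1) {-2}p (erefl p.1) dp hS dd => [|k] => {hp}{}p pE dp hS dd.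
    have pQ := dyad_sub_cube dp.
    apply: (@le_trans _ _ (\int[@lebesgue_nd R d]_(x in cube a l) (h x)%:E)%E).
      by apply: ge0_subset_integral.
    apply: le_trans hQ _; rewrite lee_fin /dyad_side pE expr0 divr1 ler_wpM2r//.
      by rewrite exprn_ge0// ltW.
    by rewrite ler_peMl ?(ltW th0)// exprn_ege1// ler1n.
  have kp : (k <= p.1)%N by rewrite pE.
  apply: (@le_trans _ _ (\int[@lebesgue_nd R d]_(x in dyad a l (dyad_anc k p)) (h x)%:E)%E).
    by apply: ge0_subset_integral => //; exact: sub_dyad_anc.
  rewrite leNgt; apply/negP => hk; apply: (hS k); first by rewrite pE.
  by rewrite /S /= (dyad_parent_side pE) mulrA [th * _]mulrC.
- pose U := \bigcup_(p in stopping S) dyad a l p.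
  have mU : measurable U by exact: measurable_dyad_bigcup.
  have mC : measurable (~` U) by exact: measurableC.
  (* Once [h] is cut to the complement of the selected cubes, all its dyadic averages are at most
     [th]: on a cube inside a selected one it vanishes, and any other cube fails the stopping
     condition itself. *)
  pose g x := h x * \1_(~` U) x.
  have mg : measurable_fun setT g by apply: measurable_funM => //; exact: measurable_indic.
  have gM x : 0 <= g x <= M.
    have /andP[h1 h2] := hM x; rewrite /g indicE.
    by case: (x \in _); rewrite ?mulr1 ?mulr0 ?h1 ?lexx ?(le_trans h1).
  have gh x : (0 <= (g x)%:E <= (h x)%:E)%E.
    rewrite !lee_fin; have /andP[-> _] := gM x; rewrite /g indicE.
    by have /andP[h1 h2] := hM x; case: (x \in _); rewrite ?mulr1 ?mulr0/= ?lexx.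
  apply: negligibleS (dyadic_average_le_ae (ltW th0) mg gM _) => [x [Qx [Ux hx]]|p dp].
    split => //; rewrite /g indicE mem_set ?mulr1// => -[p Fp]; exact: Ux.
  have [[m mp Sm]|noS] := pselect (exists2 m, (m <= p.1)%N & S (dyad_anc m p)).
    have [n nm Fn] := stopping_anc dp mp Sm.
    have np : (n <= p.1)%N by exact: leq_trans mp.
    rewrite integral0_eq.
      by rewrite mule_ge0// lee_fin ltW.
    move=> x px; rewrite /g indicE memNset ?mulr0//; apply; exists (dyad_anc n p) => //.
    exact: (sub_dyad_anc np dp).
  rewrite lebesgue_nd_dyad.
  apply: (@le_trans _ _ (\int[@lebesgue_nd R d]_(x in dyad a l p) (h x)%:E)%E).
    apply: ge0_le_integral => //.
    - by move=> x _; have /andP[] := gh x.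
    - by apply/measurable_EFinP; exact: measurable_funTS.
    - by move=> x _; have /andP[] := gh x.
  rewrite leNgt; apply/negP => hp; apply: noS; exists p.1 => //.
  by rewrite dyad_anc_id.
Qed.

End dyadic_cubes.

(** * Dini moduli and volumes of shells *)

Section integral_tools.
Context {d : measure_display} {T : measurableType d} {R : realType}.
Variable mu : {measure set T -> \bar R}.
Implicit Types (A B : set T) (f g : T -> R).

Lemma ge0_le_integral_real A f g : measurable A ->
  measurable_fun setT f -> measurable_fun setT g ->
  (forall x, A x -> 0 <= f x <= g x) ->
  (\int[mu]_(x in A) (f x)%:E <= \int[mu]_(x in A) (g x)%:E)%E.
Proof.
move=> mA mf mg fg; apply: ge0_le_integral => //.
- by move=> x Ax; rewrite lee_fin; have /andP[] := fg x Ax.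
- by apply/measurable_EFinP; exact: measurable_funTS.
- by apply/measurable_EFinP; exact: measurable_funTS.
- by move=> x Ax; rewrite lee_fin; have /andP[] := fg x Ax.
Qed.

Lemma ge0_subset_integral_real A B f : measurable A -> measurable B ->
  measurable_fun setT f -> (forall x, B x -> 0 <= f x) -> A `<=` B ->
  (\int[mu]_(x in A) (f x)%:E <= \int[mu]_(x in B) (f x)%:E)%E.
Proof.
move=> mA mB mf f0 AB; apply: ge0_subset_integral => //.
by apply/measurable_EFinP; exact: measurable_funTS.
Qed.

Lemma ge0_integral_le_cst A f c : measurable A -> measurable_fun setT f ->
  (forall x, A x -> 0 <= f x <= c) ->
  (\int[mu]_(x in A) (f x)%:E <= c%:E * mu A)%E.
Proof.
move=> mA mf fc; rewrite -integral_cst//.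
by apply: ge0_le_integral_real => //; exact: measurable_cst.
Qed.

Lemma ge0_cst_le_integral A f c : measurable A -> measurable_fun setT f ->
  0 <= c -> (forall x, A x -> c <= f x) ->
  (c%:E * mu A <= \int[mu]_(x in A) (f x)%:E)%E.
Proof.
move=> mA mf c0 fc; rewrite -integral_cst//.
apply: (@ge0_le_integral_real A (fun=> c)) => //.
by move=> x Ax; rewrite c0 fc.
Qed.

End integral_tools.

Lemma nneseries_le_bound {R : realType} (u : nat -> \bar R) (B : \bar R) :
  (forall k, 0 <= u k)%E -> (forall n, \sum_(k < n) u k <= B)%E ->
  (\sum_(0 <= k <oo) u k <= B)%E.
Proof.
move=> u0 uB; apply: lime_le; first exact: is_cvg_nneseries.
by apply: nearW => n; rewrite big_mkord.
Qed.

Section modulus.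
Context {R : realType}.

(* [om] is a majorant of the modulus; the requirement [t <= om t] (obtained by adding [t]) lets [om]
   also dominate the proportion [s / D] of cubes that a sphere of radius [D] cuts. *)
Definition dini_bound (om : R -> R) (W : R) :=
  [/\ {homo om : s t / s <= t},
      (forall t, 0 <= om t),
      (forall t, t <= om t),
      (forall n t, 0 <= t -> om (n%:R * t) <= n%:R * om t) &
      forall n, \sum_(k < n) om (2 ^+ k)^-1 <= W].

(** Integral test on the intervals from [2 ^ -(k + 1)] to [2 ^ -k]: there [omega t / t] is at least
    [omega (2 ^ -(k + 1)) 2 ^ k], on a length of [2 ^ -(k + 1)]. *)
Lemma dini_modulus_sum (omega : R -> R) : dini_modulus omega ->
  exists W : R, forall n, \sum_(k < n) omega (2 ^+ k)^-1 <= W.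
Proof.
move=> [om0 omge0 ominc _ omI].
pose I := (\int[@lebesgue_measure R]_(t in [set t : R | (0 < t <= 1)%R]) ((omega t / t)%:E))%E.
(* Monotone on the whole line, hence measurable, whereas nothing is known of [omega] at negative
   arguments. *)
pose om1 t := omega (Num.max t 0).
have om1h : {homo om1 : s t / s <= t}.
  move=> s t st; apply: ominc; first by rewrite le_max lexx orbT.
  by rewrite ge_max !le_max st/= lexx orbT.
have mom1 : measurable_fun [set: measurableTypeR R] (om1 : measurableTypeR R -> R).
  exact: nondecreasing_measurable.
pose g (t : measurableTypeR R) : R := om1 t * t `^ (-1).
have mg : measurable_fun setT g.
  by apply: measurable_funM => //; exact: measurable_powR.
have gE t : 0 < t -> g t = omega t / t.
  by move=> t0; rewrite /g /om1 powR_inv1 ?ltW// max_l// ltW.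
pose A (k : nat) : set (measurableTypeR R) := `](2 ^+ k.+1)^-1, (2 ^+ k)^-1]%classic.
have mA k : measurable (A k) by exact: measurable_itv.
have two0 k : 0 < (2 ^+ k)^-1 :> R by rewrite invr_gt0 exprn_gt0.
have Apos k t : A k t -> 0 < t.
  by rewrite /A /= in_itv/= => /andP[h _]; exact: lt_trans h.
have tA : trivIset setT A.
  suff key k k' t : (k < k')%N -> A k t -> A k' t -> False.
    move=> k k' _ _ [t [kt k't]]; case: (ltngtP k k') => // h; exfalso.
      exact: key h kt k't.
    exact: key h k't kt.
  rewrite /A /= !in_itv/= => kk' /andP[h1 _] /andP[_ h2].
  have := lt_le_trans h1 h2; rewrite ltf_pV2 ?posrE ?exprn_gt0//.
  by rewrite ltr_eXn2l ?ltr1n// ltnNge kk'.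
have m01 : measurable ([set t : R | 0 < t <= 1] : set (measurableTypeR R)).
  rewrite (_ : mkset _ = `]0, 1]%classic); first exact: measurable_itv.
  by apply/seteqP; split => x /=; rewrite in_itv.
have IE : I = (\int[@lebesgue_measure R]_(t in [set t : R | (0 < t <= 1)%R]) ((g t)%:E))%E.
  by apply: eq_integral => t; rewrite inE /= => /andP[t0 _]; rewrite gE.
have g0 t : 0 <= g t by rewrite mulr_ge0// ?powR_ge0// omge0// le_max lexx orbT.
have int_n n : (\sum_(k < n) \int[@lebesgue_measure R]_(t in A k) (g t)%:E <= I)%E.
  rewrite IE.
  have := @ge0_integral_bigsetU _ (measurableTypeR R) R lebesgue_measure 'I_n (fun k => A k) (EFin \o g) (index_enum 'I_n).
  move=> /(_ (fun k => mA k) (index_enum_uniq _)) <-.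
  - apply: ge0_subset_integral_real => //; first exact: bigsetU_measurable.
    rewrite -bigcup_seq => t [k _ kt] /=; rewrite (Apos _ _ kt)/=.
    move: kt; rewrite /A /= in_itv/= => /andP[_ /le_trans]; apply.
    by rewrite invf_le1 ?exprn_gt0// exprn_ege1// ler1n.
  - by move=> k k' _ _ kk'; apply/val_inj; exact: tA kk'.
  - by apply/measurable_EFinP; exact: measurable_funTS.
  - by move=> t _; rewrite lee_fin.
have fI : I \is a fin_num.
  rewrite ge0_fin_numE//; apply: integral_ge0 => t /= /andP[t0 _].
  by rewrite lee_fin divr_ge0 ?omge0 ?ltW.
have step k : ((omega (2 ^+ k.+1)^-1 / 2)%:E <= \int[@lebesgue_measure R]_(t in A k) (g t)%:E)%E.
  pose c := omega (2 ^+ k.+1)^-1 * 2 ^+ k.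
  have -> : omega (2 ^+ k.+1)^-1 / 2 = c * ((2 ^+ k)^-1 - (2 ^+ k.+1)^-1).
    by rewrite /c exprS; field; rewrite expf_neq0.
  have lA : lebesgue_measure (A k) = ((2 ^+ k)^-1 - (2 ^+ k.+1)^-1)%:E.
    rewrite /A lebesgue_measure_itv/= lte_fin ltf_pV2 ?posrE ?exprn_gt0//.
    by rewrite ltr_eXn2l ?ltr1n// leqnn.
  rewrite EFinM -lA; apply: ge0_cst_le_integral => //.
    by rewrite mulr_ge0 ?exprn_ge0// omge0// ltW.
  move=> t At; have t0 := Apos _ _ At; rewrite gE//.
  move: At; rewrite /A /= in_itv/= => /andP[h1 h2].
  apply: ler_pM; [by rewrite omge0// ltW|by rewrite exprn_ge0| |].
    by apply: ominc; rewrite ltW.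
  by rewrite -[leLHS]invrK lef_pV2 ?posrE.
(* The term of index 0 is [omega 1]; the term of index [k + 1] is at most twice the integral over
   the interval of index [k]. *)
exists (omega 1 + 2 * fine I) => -[|n].
  by rewrite big_ord0 addr_ge0 ?omge0// mulr_ge0// fine_ge0// IE integral_ge0// => t _; rewrite lee_fin.
rewrite big_ord_recl expr0 invr1 lerD2l -ler_pdivrMl//.
rewrite -lee_fin (fineK fI); apply: le_trans (int_n n).
rewrite mulr_sumr -sumEFin; apply: lee_sum => k _.
by apply: le_trans (step k); rewrite mulrC.
Qed.

(** The 2 in [W0 + 2] bounds the sum of the added terms [(2 ^+ k)^-1]; subadditivity of [omega]
    gives the clause on integer multiples. *)
Lemma dini_boundP (omega : R -> R) : dini_modulus omega ->
  exists om W, dini_bound om W /\ forall t, 0 <= t -> omega t <= om t.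
Proof.
move=> dom; have [W0 HW0] := dini_modulus_sum dom.
move: dom => [om0 omge0 ominc omadd _].
pose om t := omega (Num.max t 0) + Num.max t 0.
have mx0 (t : R) : 0 <= Num.max t 0 by rewrite le_max lexx orbT.
exists om, (W0 + 2); split; last first.
  by move=> t t0; rewrite /om max_l// lerDl.
split.
- move=> s t st; have h : Num.max s 0 <= Num.max t 0 by rewrite ge_max !le_max st/= lexx orbT.
  by apply: lerD => //; exact: ominc.
- by move=> t; rewrite addr_ge0// omge0.
- by move=> t; rewrite /om ler_wpDl ?omge0// le_max lexx.
- move=> n t t0; rewrite /om !max_l// ?mulr_ge0// mulrDr lerD2r.
  elim: n => [|n IH]; first by rewrite !mul0r om0.
  rewrite -natr1 !mulrDl !mul1r; apply: le_trans (omadd _ _ _ _) _ => //.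
    by rewrite mulr_ge0.
  by rewrite lerD2r.
- move=> n; rewrite big_split/=; apply: lerD.
    apply: le_trans (HW0 n); apply: ler_sum => k _.
    by rewrite max_l// invr_ge0 exprn_ge0.
  apply: (@le_trans _ _ (\sum_(k < n) (2 ^+ k)^-1)).
    by apply: ler_sum => k _; rewrite max_l// invr_ge0 exprn_ge0.
  suff -> : \sum_(k < n) (2 ^+ k)^-1 = 2 - 2 * (2 ^+ n)^-1 :> R.
    by rewrite lerBlDr lerDl mulr_ge0// invr_ge0 exprn_ge0.
  elim: n => [|n IH]; first by rewrite big_ord0 expr0 invr1 mulr1 subrr.
  by rewrite big_ord_recr/= IH exprS; field; rewrite expf_neq0.
Qed.

End modulus.

Section balls.
Context {R : realType} {d : nat}.
Implicit Types (x y c : d.-tuple R).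
Local Notation leb := (@lebesgue_nd R d).

Definition eball c r : set (d.-tuple R) := [set y | dist c y < r].

Lemma measurable_eball c r : measurable (eball c r).
Proof.
rewrite (_ : eball c r = dist c @^-1` `]-oo, r[%classic); last first.
  by apply/seteqP; split => y /=; rewrite in_itv.
rewrite -[X in measurable X]setTI; exact: measurable_distr.
Qed.

Lemma eball_sub_cube c r : eball c r `<=` cube [tuple tnth c i - r | i < d] (2 * r).
Proof.
move=> y cy i; rewrite tnth_mktuple.
have := le_lt_trans (coord_le_dist c y i) cy; rewrite ltr_norml => /andP[h1 h2].
by apply/andP; split; lra.
Qed.

Lemma lebesgue_eball_le c (r : R) : 0 <= r -> (leb (eball c r) <= ((2 * r) ^+ d)%:E)%E.
Proof.
move=> r0; rewrite -(lebesgue_nd_cube [tuple tnth c i - r | i < d]) ?mulr_ge0//.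
apply: le_measure; rewrite ?inE; [exact: measurable_eball|exact: measurable_cube|].
exact: eball_sub_cube.
Qed.

Let o : d.-tuple R := [tuple 0 | i < d].

Lemma dist_affine (t : R) (v y : d.-tuple R) : 0 < t ->
  dist o (affine_nd t v y) = t * dist [tuple - tnth v i / t | i < d] y.
Proof.
move=> t0; rewrite -[X in X * _](ger0_norm (ltW t0)) -sqrtr_sqr /dist -sqrtrM ?sqr_ge0//.
congr Num.sqrt; rewrite mulr_sumr; apply: eq_bigr => i _.
rewrite !tnth_mktuple -exprMn; have -> : t * (- tnth v i / t - tnth y i) = - (t * tnth y i + tnth v i).
  by field; rewrite gt_eqF.
by rewrite sub0r.
Qed.

Lemma lebesgue_eball c (r : R) : 0 < r ->
  leb (eball c r) = ((r ^+ d)%:E * leb (eball o 1%R))%E.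
Proof.
move=> r0; have ri0 : 0 < r^-1 by rewrite invr_gt0.
have := lebesgue_nd_affine [tuple - tnth c i / r | i < d] ri0 (measurable_eball o 1).
rewrite -exprVn invrK => <-; congr lebesgue_nd; apply/seteqP.
have E : [tuple - tnth [tuple - tnth c j / r | j < d] i / r^-1 | i < d] = c.
  apply: eq_from_tnth => i; rewrite !tnth_mktuple; field; rewrite gt_eqF//.
by split => y; rewrite /eball /= dist_affine// E mulrC ltr_pdivrMr// mul1r.
Qed.

Definition eshell c r1 r2 : set (d.-tuple R) := [set y | r1 <= dist c y < r2].

Lemma measurable_eshell c r1 r2 : measurable (eshell c r1 r2).
Proof.
rewrite (_ : eshell c r1 r2 = dist c @^-1` `[r1, r2[%classic); last first.
  by apply/seteqP; split => y /=; rewrite in_itv.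
rewrite -[X in measurable X]setTI; exact: measurable_distr.
Qed.

(** The volume is [V ((r + t) ^ d - (r - t) ^ d)], where [V <= 2 ^ d] is the volume of the unit
    ball. Factoring the difference of powers leaves [2 t] times [d] terms of size at most
    [(2 r) ^ (d - 1)]. *)
Lemma lebesgue_eshell_le c (r t : R) : 0 < t -> t <= r / 2 ->
  (leb (eshell c (r - t)%R (r + t)%R) <= (4 ^+ d * d%:R * t * r ^+ d / r)%:E)%E.
Proof.
move=> t0 tr; have r0 : 0 < r by lra.
have rt0 : 0 < r - t by lra.
have rt0' : 0 < r + t by lra.
have -> : eshell c (r - t) (r + t) = eball c (r + t) `\` eball c (r - t).
  apply/seteqP; split => y; rewrite /eshell /eball /=.
    by move=> /andP[h1 h2]; split => //; apply/negP; rewrite -leNgt.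
  by move=> [h2 /negP]; rewrite -leNgt => h1; rewrite h1 h2.
have fb s : leb (eball c s) \is a fin_num.
  rewrite ge0_fin_numE// (le_lt_trans _ (ltry ((2 * Num.max s 0) ^+ d)))//.
  apply: le_trans (lebesgue_eball_le c _); last by rewrite le_max lexx orbT.
  apply: le_measure; rewrite ?inE; try exact: measurable_eball.
  by move=> y; rewrite /eball /= => /lt_le_trans; apply; rewrite le_max lexx.
have -> : leb (eball c (r + t) `\` eball c (r - t)) = (leb (eball c (r + t)%R) - leb (eball c (r - t)%R))%E.
  rewrite measureD; [|exact: measurable_eball|exact: measurable_eball|by have := fb (r + t)%R; rewrite ge0_fin_numE].
  by rewrite setIidr// => y; rewrite /eball /= => h; lra.
have V2 : (leb (eball o 1%R) <= (2 ^+ d)%:E)%E.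
  by have := lebesgue_eball_le o (ler01); rewrite mulr1.
have [V V0 VE] : exists2 V, 0 <= V & leb (eball o 1%R) = V%:E.
  exists (fine (leb (eball o 1%R))); first by rewrite fine_ge0// measure_ge0.
  rewrite fineK// ge0_fin_numE ?measure_ge0//.
  by apply: le_lt_trans V2 _; rewrite ltry.
rewrite (lebesgue_eball c rt0') (lebesgue_eball c rt0); move: V2.
rewrite VE lee_fin => V2; rewrite -!EFinM -EFinB lee_fin -mulrBl.
apply: (@le_trans _ _ ((2 * t * (d%:R * (2 * r) ^+ d / (2 * r))) * 2 ^+ d)).
  apply: ler_pM => //.
    by rewrite subr_ge0; apply: lerXn2r; rewrite ?nnegrE; lra.
  rewrite subrXX (_ : r + t - (r - t) = 2 * t); last by ring.
  apply: ler_wpM2l; first by lra.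
  apply: (@le_trans _ _ (\sum_(i < d) (2 * r) ^+ d.-1)).
    apply: ler_sum => i _; have id : (i <= d.-1)%N by rewrite -ltnS prednK// (leq_ltn_trans (leq0n i)).
    rewrite -[in leRHS](subnK id) exprD; apply: ler_pM; rewrite ?exprn_ge0 ?(ltW rt0)//; try lra.
      by apply: lerXn2r; rewrite ?nnegrE; lra.
    by apply: lerXn2r; rewrite ?nnegrE; lra.
  rewrite sumr_const card_ord -[_ *+ d]mulr_natl -mulrA.
  have [d0|d0] := posnP d.
    by have -> : d%:R = 0 :> R; [rewrite d0|rewrite !mul0r].
  rewrite ler_wpM2l// -[in leRHS](prednK d0) exprS mulrAC divff ?mul1r//.
  by rewrite mulf_neq0// gt_eqF.
rewrite le_eqVlt; apply/orP; left; apply/eqP.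
have -> : 4 = 2 * 2 :> R by ring.
by rewrite !exprMn; field; rewrite gt_eqF.
Qed.

Lemma dyadic_scale (r D : R) : 0 < r -> r <= D ->
  exists k : nat, 2 ^+ k * r <= D < 2 ^+ k.+1 * r.
Proof.
move=> r0 rD; pose n := Num.truncn (D / r).
have Dr1 : 1 <= D / r by rewrite ler_pdivlMr// mul1r.
have Dr0 : 0 <= D / r by exact: le_trans Dr1.
have n0 : (0 < n)%N by rewrite truncn_gt0.
have /andP[h1 h2] := truncn_itv Dr0.
have /andP[h3 h4] := trunc_log_bounds (isT : (1 < 2)%N) n0.
exists (trunc_log 2 n); rewrite -ler_pdivlMr// -ltr_pdivrMr//; apply/andP; split.
  by apply: le_trans h1; rewrite -natrX ler_nat.
by apply: lt_le_trans h2 _; rewrite -natrX ler_nat.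
Qed.

Section tail.
Variables (om : R -> R) (W : R).
Hypothesis omW : dini_bound om W.

Lemma dini_bound_ge0 : 0 <= W.
Proof. by have [_ _ _ _ /(_ 0%N)] := omW; rewrite big_ord0. Qed.

Lemma measurable_tail c (r : R) :
  measurable_fun setT (fun y => om (r / dist c y) * (dist c y ^+ d)^-1).
Proof.
have [om_h _ _ _ _] := omW.
have E1 y : r / dist c y = r * dist c y `^ (-1) by rewrite powR_inv1// dist_ge0.
have E2 y : (dist c y ^+ d)^-1 = dist c y `^ (- d%:R) by rewrite powR_invn// dist_ge0.
under eq_fun do rewrite E1 E2.
have mp p : measurable_fun setT (fun y => dist c y `^ p).
  by apply: (measurableT_comp (measurable_powR _)); exact: measurable_distr.
apply: measurable_funM => //.
apply: (@measurableT_comp _ _ _ _ _ _ om); first exact: nondecreasing_measurable.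
exact: measurable_funM.
Qed.

(** Sum over the shells [2 ^ k r <= |y - c| < 2 ^ (k + 1) r]: the integrand is at most
    [om (2 ^ -k) (2 ^ k r) ^ -d], and the shell lies in a ball of volume at most
    [4 ^ d (2 ^ k r) ^ d]. The powers of [r] cancel, so the bound is uniform in [r]. *)
Lemma tail_integral_le c (r : R) : 0 < r ->
  (\int[leb]_(y in [set y | (r <= dist c y)%R])
      (om (r / dist c y) * (dist c y ^+ d)^-1)%:E <= (4 ^+ d * W)%:E)%E.
Proof.
move=> r0; have [om_h om0 _ _ omS] := omW.
pose A k := eshell c (2 ^+ k * r) (2 ^+ k.+1 * r).
have p2 k : 0 < 2 ^+ k * r by rewrite mulr_gt0// exprn_gt0.
have AE : [set y | r <= dist c y] = \bigcup_k A k.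
  apply/seteqP; split => y /=.
    by move=> /(dyadic_scale r0)[k h]; exists k.
  move=> [k _ /andP[h _]]; apply: le_trans h; rewrite ler_peMl ?(ltW r0)//.
  by rewrite exprn_ege1// ler1n.
have tA : trivIset setT A.
  suff key k k' y : (k < k')%N -> A k y -> A k' y -> False.
    move=> k k' _ _ [y [ky k'y]]; case: (ltngtP k k') => // h; exfalso.
      exact: key h ky k'y.
    exact: key h k'y ky.
  move=> kk' /andP[_ h1] /andP[h2 _]; have := le_lt_trans h2 h1.
  by rewrite ltr_pM2r// ltr_eXn2l ?ltr1n// ltnS leqNgt kk'.
have mA k : measurable (A k) by exact: measurable_eshell.
have mt := measurable_tail c r.
have t0 y : 0 <= om (r / dist c y) * (dist c y ^+ d)^-1.
  by rewrite mulr_ge0// invr_ge0 exprn_ge0// dist_ge0.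
rewrite AE ge0_integral_bigcup//; last 2 first.
- by apply/measurable_EFinP; exact: measurable_funTS.
- by move=> y _; rewrite lee_fin.
have step k : (\int[leb]_(y in A k) (om (r / dist c y) * (dist c y ^+ d)^-1)%:E
    <= (4 ^+ d * om (2 ^+ k)^-1)%:E)%E.
  apply: (@le_trans _ _ ((om (2 ^+ k)^-1 * ((2 ^+ k * r) ^+ d)^-1)%:E * leb (A k))%E).
    apply: ge0_integral_le_cst => // y /andP[h1 h2]; rewrite t0/=.
    have D0 : 0 < dist c y by exact: lt_le_trans h1.
    apply: ler_pM => //; first by rewrite invr_ge0 exprn_ge0// dist_ge0.
      apply: om_h; rewrite ler_pdivrMr// mulrC ler_pdivlMr ?exprn_gt0//.
      by rewrite mulrC.
    by rewrite lef_pV2 ?posrE ?exprn_gt0//; apply: lerXn2r; rewrite // nnegrE ltW.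
  apply: (@le_trans _ _ ((om (2 ^+ k)^-1 * ((2 ^+ k * r) ^+ d)^-1)%:E * ((2 * (2 ^+ k.+1 * r)) ^+ d)%:E)%E).
    rewrite lee_wpmul2l//; first by rewrite lee_fin mulr_ge0// invr_ge0 exprn_ge0// ltW.
    apply: le_trans (lebesgue_eball_le c (ltW (p2 k.+1))).
    apply: le_measure; rewrite ?inE//; first exact: measurable_eball.
    by move=> y /andP[].
  rewrite -EFinM lee_fin (_ : 2 * (2 ^+ k.+1 * r) = 4 * (2 ^+ k * r)); last by rewrite exprS; ring.
  rewrite [X in _ * X <= _]exprMn mulrCA -!mulrA mulVf ?mulr1//.
  by rewrite expf_neq0// gt_eqF.
apply: nneseries_le_bound => [k|n].
  by apply: integral_ge0 => y _; rewrite lee_fin.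
apply: (@le_trans _ _ (\sum_(k < n) (4 ^+ d * om (2 ^+ k)^-1)%:E)%E).
  by apply: lee_sum => k _.
rewrite sumEFin lee_fin -mulr_sumr ler_wpM2l// exprn_ge0//.
Qed.

End tail.

End balls.

(** * The square sum over annuli *)

Section core.
Context {R : realType} {d : nat}.
Hypothesis d0 : (0 < d)%N.
Local Notation leb := (@lebesgue_nd R d).
Local Notation C := (complex R).

(** Points of a cube of side [s] are within [d s] of its corner, and the two points [x], [x']
    compared later are within [d s] of each other. So a sphere about either of them that meets the
    cube has a radius within [2 d s] of the distance from [x] to the corner. *)
Definition cut_ratio : R := 2 * d%:R.
(** For a cube this far away, the shell of half-width [6 d s] in [sum_near_shell] is thin enough for
    [lebesgue_eshell_le]. *)
Definition far_ratio : R := 12 * d%:R.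

Let d1 : 1 <= d%:R :> R.
Proof. by rewrite ler1n. Qed.

Lemma cube_dist_le (c : d.-tuple R) (s : R) y : cube c s y -> dist c y <= d%:R * s.
Proof.
move=> cy; apply: dist_le => i; have /andP[h1 h2] := cy i.
by rewrite ler_norml; apply/andP; split; lra.
Qed.

Variables (I : finType) (P : pred I) (c : I -> d.-tuple R) (s : I -> R).
Hypothesis s0 : forall j, P j -> 0 < s j.
Hypothesis disj : forall j j', P j -> P j' -> j != j' ->
  cube (c j) (s j) `&` cube (c j') (s j') = set0.
Variable x : d.-tuple R.
Let D j := dist x (c j).
Hypothesis D0 : forall j, P j -> 0 < D j.

Let C0 : R := 2 ^+ d * (4 ^+ d * d%:R * (6 * d%:R)).

Let C0_ge0 : 0 <= C0.
Proof. by rewrite /C0 !mulr_ge0// exprn_ge0. Qed.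

(** Seen from [x], the corners are within [4 d s] of the distance [D j], with [s] the side of [j],
    and the cubes reach [d s] further. These disjoint cubes lie in a shell of half-width [6 d s],
    and their corners are at distances from [x] at least half of [D j]. *)
Lemma sum_near_shell (Q : pred I) (j : I) : P j -> far_ratio * s j <= D j ->
  (forall j', Q j' -> [/\ P j', s j' <= s j & `|D j' - D j| <= 2 * cut_ratio * s j]) ->
  \sum_(j' | Q j') s j' ^+ d * (D j' ^+ d)^-1 <= C0 * (s j / D j).
Proof.
move=> Pj farj hQ; have sj := s0 Pj; have Dj := D0 Pj.
pose t := 6 * d%:R * s j.
have t0 : 0 < t by rewrite !mulr_gt0// (lt_le_trans ltr01).
have tD : t <= D j / 2 by move: farj; rewrite /far_ratio /t; lra.
have ds0 : s j <= d%:R * s j by rewrite ler_peMl// ltW.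
have vol : \sum_(j' | Q j') s j' ^+ d <= 4 ^+ d * d%:R * t * D j ^+ d / D j.
  rewrite -lee_fin -sumEFin; apply: le_trans (lebesgue_eshell_le x t0 tD).
  pose U := \bigcup_(j' in [set` Q]) cube (c j') (s j').
  have fQ : finite_set [set` Q] by exact: finite_finset.
  have tQ : trivIset [set` Q] (fun j' => cube (c j') (s j')).
    by apply/trivIsetP => i i' /= /hQ[Pi _ _] /hQ[Pi' _ _]; exact: disj.
  have mU : measurable U by apply: fin_bigcup_measurable => // j' _; exact: measurable_cube.
  have -> : (\sum_(j' | Q j') (s j' ^+ d)%:E)%R = leb U.
    rewrite measure_fin_bigcup//; last by move=> j' _; exact: measurable_cube.
    rewrite -(@bigfs _ _ _ _ (index_enum I) Q) ?index_enum_uniq//; last first.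
      by move=> i _; rewrite mem_index_enum.
    by apply: eq_bigr => j' /hQ[Pj' _ _]; rewrite -(lebesgue_nd_cube (c j'))// ltW// s0.
  apply: le_measure; rewrite ?inE//; first exact: measurable_eshell.
  move=> y [j' /= /hQ[Pj' sjj Djj] /cube_dist_le yj'].
  have ds1 : d%:R * s j' <= d%:R * s j by rewrite ler_wpM2l.
  have tr1 := dist_triangle (c j') x y; have tr2 := dist_triangle y x (c j').
  rewrite (distC y) in tr2.
  have dd0 : 0 < d%:R * s j by rewrite mulr_gt0// ltr0n.
  move: Djj; rewrite ler_norml /cut_ratio /D /t => /andP[h1 h2].
  by apply/andP; split; rewrite /D; nra.
have Dhalf j' : Q j' -> (D j' ^+ d)^-1 <= 2 ^+ d / D j ^+ d.
  move=> /hQ[Pj' _]; rewrite ler_norml => /andP[h1 h2].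
  rewrite -[leRHS]invrK invf_div -expr_div_n lef_pV2 ?posrE ?exprn_gt0 ?divr_gt0 ?D0//.
  apply: lerXn2r; rewrite ?nnegrE ?divr_ge0 ?(ltW Dj) ?(ltW (D0 Pj'))//.
  move: h1 h2 farj; rewrite /cut_ratio /far_ratio; lra.
apply: (@le_trans _ _ (\sum_(j' | Q j') s j' ^+ d * (2 ^+ d / D j ^+ d))).
  apply: ler_sum => j' Qj'; apply: ler_wpM2l; last exact: Dhalf.
  by have [Pj' _ _] := hQ j' Qj'; rewrite exprn_ge0// ltW// s0.
rewrite -mulr_suml; apply: (@le_trans _ _ (4 ^+ d * d%:R * t * D j ^+ d / D j * (2 ^+ d / D j ^+ d))).
  by apply: ler_wpM2r => //; rewrite divr_ge0// exprn_ge0// ltW.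
rewrite le_eqVlt; apply/orP; left; apply/eqP; rewrite /t /C0.
by field; rewrite expf_neq0 ?gt_eqF.
Qed.

Variables (M : R) (N : nat).
Hypothesis M0 : 0 <= M.

(* Expanding the square and ordering each pair by side length, the cubes no larger than [j] that
   meet the same sphere fill a shell of width [O(s j)] (lemma [sum_near_shell]). *)
Lemma shell_square (rr : nat -> R) (al : nat -> I -> R) :
  (forall i j, 0 <= al i j) ->
  (forall i j, P j -> al i j != 0 ->
     far_ratio * s j <= D j /\ `|rr i - D j| <= cut_ratio * s j) ->
  (forall j, P j -> \sum_(i < N) al i j <= M * (s j ^+ d * (D j ^+ d)^-1)) ->
  \sum_(i < N) (\sum_(j | P j) al i j) ^+ 2 <=
    2 * C0 * M ^+ 2 * \sum_(j | P j) s j ^+ d * (D j ^+ d)^-1 * (s j / D j).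
Proof.
move=> al0 alS alM.
have sq i : (\sum_(j | P j) al i j) ^+ 2 <=
    2 * \sum_(j | P j) al i j * \sum_(j' | P j' && (s j' <= s j)) al i j'.
  rewrite expr2 mulr_suml.
  under eq_bigr do rewrite mulr_sumr.
  (* Every pair has at least one of the two orders, and the two halves agree by symmetry, whence the
     factor 2. *)
  pose m : R := \sum_(j | P j) \sum_(j' | P j')
     ((s j' <= s j)%R%:R * (al i j * al i j') + (s j <= s j')%R%:R * (al i j * al i j')).
  apply: (@le_trans _ _ m); rewrite /m.
    apply: ler_sum => j _; apply: ler_sum => j' _; rewrite -mulrDl ler_peMl ?mulr_ge0//.
    by case: (leP (s j') (s j)) => [_|/ltW ->]; rewrite ?lerDl// add0r.
  rewrite mulr_natl mulr2n.
  have E : \sum_(j | P j) al i j * \sum_(j' | P j' && (s j' <= s j)) al i j' =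
     \sum_(j | P j) \sum_(j' | P j') (s j' <= s j)%R%:R * (al i j * al i j').
    apply: eq_bigr => j _; rewrite big_mkcondr/= mulr_sumr; apply: eq_bigr => j' _.
    by case: ifP => _; rewrite ?mul1r ?mul0r ?mulr0.
  under eq_bigr do rewrite big_split/=.
  rewrite big_split/= E lerD2l exchange_big/=.
  by apply: ler_sum => j _; apply: ler_sum => j' _; rewrite [al i j * _]mulrC.
have near (i : 'I_N) j : P j -> al i j * (\sum_(j' | P j' && (s j' <= s j)) al i j') <=
    al i j * (M * (C0 * (s j / D j))).
  move=> Pj; have [->|anz] := eqVneq (al i j) 0; first by rewrite !mul0r.
  apply: ler_wpM2l => //; have [farj rj] := alS _ _ Pj anz.
  apply: (@le_trans _ _ (\sum_(j' | [&& P j', s j' <= s j & al i j' != 0])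
       M * (s j' ^+ d * (D j' ^+ d)^-1))).
    rewrite (bigID (fun j' => al i j' != 0))/= [X in _ + X]big1 ?addr0; last first.
      by move=> j' /andP[_ /negPn/eqP].
    rewrite (eq_bigl (fun j' => [&& P j', s j' <= s j & al i j' != 0])); last first.
      by move=> j' /=; rewrite andbA.
    apply: ler_sum => j' /and3P[Pj' _ _]; apply: le_trans (alM _ Pj').
    by rewrite (bigD1 i)//= lerDl sumr_ge0.
  rewrite -mulr_sumr; apply: ler_wpM2l => //.
  apply: sum_near_shell => // j' /and3P[Pj' sjj anz'].
  have [farj' rj'] := alS _ _ Pj' anz'; split => //.
  have -> : D j' - D j = (D j' - rr i) + (rr i - D j) by ring.
  apply: le_trans (ler_normD _ _) _; rewrite distrC.
  have : cut_ratio * s j' <= cut_ratio * s j by rewrite ler_wpM2l// /cut_ratio mulr_ge0.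
  by lra.
apply: (@le_trans _ _ (\sum_(i < N) 2 * \sum_(j | P j) al i j * (M * (C0 * (s j / D j))))).
  apply: ler_sum => i _; apply: le_trans (sq i) _; apply: ler_wpM2l => //.
  by apply: ler_sum => j Pj; exact: near.
rewrite -mulr_sumr exchange_big/= -(mulrA 2 C0 (M ^+ 2)) -(mulrA 2 (C0 * M ^+ 2)); apply: ler_wpM2l => //.
rewrite mulr_sumr; apply: ler_sum => j Pj; rewrite -mulr_suml.
have sD0 : 0 <= s j / D j by rewrite divr_ge0// ltW ?s0 ?D0.
apply: (@le_trans _ _ (M * (s j ^+ d * (D j ^+ d)^-1) * (M * (C0 * (s j / D j))))).
  by apply: ler_wpM2r; [rewrite mulr_ge0// mulr_ge0|exact: alM].
by rewrite le_eqVlt; apply/orP; left; apply/eqP; ring.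
Qed.

Variables (om : R -> R) (W : R).
Hypothesis omW : dini_bound om W.

(** The sum [H] for a finite family, with [c] equal to [far_ratio]. For a cube closer than
    [far_ratio * s] the factor [om] is at least 1, so that the trivial bound for near cubes is also
    absorbed. *)
Definition tail_sum : R :=
  \sum_(j | P j) s j ^+ d * (om (far_ratio * s j / D j) * (D j ^+ d)^-1).

(** The intervals are disjoint; the induction proceeds through the sharper bound by the indicator of
    [e N < r]. *)
Lemma cut_indicator_sum (e : nat -> R) (r : R) : (forall i, e i.+1 <= e i) ->
  \sum_(i < N) ((e i.+1 < r <= e i)%R%:R : R) <= 1.
Proof.
move=> edec; apply: (@le_trans _ _ ((e N < r)%R%:R : R)); last first.
  by case: (e N < r).
elim: N => [|n IH]; first by rewrite big_ord0.
rewrite big_ord_recr/=; case: (leP r (e n)) => rn.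
  rewrite andbT; apply: ler_wnDl => //; apply: le_trans IH _.
  by rewrite ltNge rn.
by rewrite andbF addr0; apply: le_trans IH _; rewrite rn (le_lt_trans _ rn).
Qed.

Lemma sumr_sqr_le (n : nat) (a : nat -> R) : (forall i, 0 <= a i) ->
  \sum_(i < n) a i ^+ 2 <= (\sum_(i < n) a i) ^+ 2.
Proof.
move=> a0; rewrite expr2 mulr_suml; apply: ler_sum => i _.
by rewrite expr2 ler_wpM2l// (bigD1 i)//= lerDl sumr_ge0.
Qed.

Let h j : R := s j ^+ d * (om (far_ratio * s j / D j) * (D j ^+ d)^-1).

Let h0 j : P j -> 0 <= h j.
Proof.
have [_ om0 _ _ _] := omW => Pj.
by rewrite !mulr_ge0 ?exprn_ge0 ?(ltW (s0 Pj))// invr_ge0 exprn_ge0// ltW// D0.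
Qed.

(* [t i j] is the contribution of the cube [j] to the annulus [i]. A cube near [x], or cut by one of
   the two spheres bounding the annulus, contributes at most its share [u i j] of the trivial bound;
   any other cube contributes to one annulus only, and by cancellation no more than [M * h j]. *)
Lemma core_estimate (e : nat -> R) (t : nat -> I -> C) (u : nat -> I -> R) :
  (forall i, e i.+1 <= e i) ->
  (forall i j, P j -> cmod (t i j) <= u i j) ->
  (forall j, P j -> \sum_(i < N) u i j <= M * (s j ^+ d * (D j ^+ d)^-1)) ->
  (forall i j, P j -> far_ratio * s j <= D j ->
     cut_ratio * s j < `|e i - D j| -> cut_ratio * s j < `|e i.+1 - D j| ->
     cmod (t i j) <= (e i.+1 < D j <= e i)%R%:R * (M * h j)) ->
  \sum_(i < N) cmod (\sum_(j | P j) t i j) ^+ 2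
    <= 12 * M ^+ 2 * (C0 * tail_sum + tail_sum ^+ 2).
Proof.
have [om_h om0 om_id _ _] := omW => edec tu uM tk.
have u0 i j : P j -> 0 <= u i j by move=> Pj; apply: le_trans (tu i j Pj); exact: cmod_ge0.
pose al (r : R) i j : R := if [&& P j, far_ratio * s j <= D j & `|r - D j| <= cut_ratio * s j] then u i j else 0.
(* The part of the contributions that needs no shell argument: summed over [i], the near cubes and
   the uncut ones each give at most [M * h j]. *)
pose kk i j : R := (if P j && (D j < far_ratio * s j) then u i j else 0)
   + (e i.+1 < D j <= e i)%R%:R * (M * h j).
have al0 r i j : 0 <= al r i j.
  by rewrite /al; case: ifP => // /and3P[/u0].
have alu r i j : P j -> al r i j <= u i j.
  by move=> Pj; rewrite /al; case: ifP => // _; exact: u0.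
have kk0 i j : P j -> 0 <= kk i j.
  move=> Pj; rewrite addr_ge0//; first by case: ifP => // _; exact: u0.
  by rewrite mulr_ge0// mulr_ge0// h0.
have tle i j : P j -> cmod (t i j) <= kk i j + al (e i) i j + al (e i.+1) i j.
  move=> Pj; rewrite /kk /al Pj/=.
  have Mh0 : 0 <= (e i.+1 < D j <= e i)%R%:R * (M * h j) by rewrite mulr_ge0// mulr_ge0// h0.
  have [nr|fr] := ltP (D j) (far_ratio * s j).
    by rewrite /= !addr0; apply: le_trans (tu i j Pj) _; rewrite lerDl.
  rewrite add0r /=; have [c1|c1] := leP `|e i - D j| (cut_ratio * s j).
    apply: le_trans (tu i j Pj) _; rewrite -addrA addrCA lerDl addr_ge0//.
    by case: ifP => // _; exact: u0.
  have [c2|c2] := leP `|e i.+1 - D j| (cut_ratio * s j).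
    by apply: le_trans (tu i j Pj) _; rewrite addr0 lerDr.
  by rewrite !addr0; exact: tk.
have sumkk j : P j -> \sum_(i < N) kk i j <= 2 * M * h j.
  move=> Pj; rewrite big_split/= -mulr_suml.
  have -> : 2 * M * h j = M * h j + 1 * (M * h j) by ring.
  apply: lerD; last by apply: ler_wpM2r; [rewrite mulr_ge0// h0|exact: cut_indicator_sum].
  rewrite Pj/=; case: (ltP (D j) (far_ratio * s j)) => nr; last by rewrite big1// mulr_ge0// h0.
  apply: le_trans (uM j Pj) _; apply: ler_wpM2l => //; apply: ler_wpM2l.
    by rewrite exprn_ge0// ltW// s0.
  rewrite -[leLHS]mul1r; apply: ler_wpM2r; first by rewrite invr_ge0 exprn_ge0// ltW// D0.
  by apply: le_trans (om_id _); rewrite ler_pdivlMr ?D0// mul1r ltW.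
have H0 : 0 <= tail_sum by apply: sumr_ge0 => j /h0.
(* Since [t <= om t] and [far_ratio >= 1], the ratio [s / D] delivered by [shell_square] is at most
   the factor [om] of the tail sum. *)
have sh (f : nat -> R) : \sum_(i < N) (\sum_(j | P j) al (f i) i j) ^+ 2 <= 2 * C0 * M ^+ 2 * tail_sum.
  apply: (le_trans (@shell_square f (fun i j => al (f i) i j) _ _ _)) => //.
  - by move=> i j Pj; rewrite /al; case: ifP => [/and3P[]|]; rewrite ?eqxx.
  - by move=> j Pj; apply: le_trans (uM j Pj); apply: ler_sum => i _; exact: alu.
  apply: ler_wpM2l; first by rewrite !mulr_ge0// exprn_ge0.
  apply: ler_sum => j Pj; rewrite -mulrA; apply: ler_wpM2l.
    by rewrite exprn_ge0// ltW// s0.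
  rewrite mulrC; apply: ler_wpM2r; first by rewrite invr_ge0 exprn_ge0// ltW// D0.
  apply: le_trans (om_id _); apply: ler_wpM2r; first by rewrite invr_ge0 ltW// D0.
  rewrite /far_ratio; apply: ler_peMl; first exact: ltW (s0 Pj).
  by have := d1; lra.
pose A i := \sum_(j | P j) kk i j.
have A0 i : 0 <= A i by apply: sumr_ge0 => j; exact: kk0.
have sA : \sum_(i < N) A i ^+ 2 <= 4 * M ^+ 2 * tail_sum ^+ 2.
  apply: le_trans (sumr_sqr_le N A0) _.
  have -> : 4 * M ^+ 2 * tail_sum ^+ 2 = (2 * M * tail_sum) ^+ 2 by ring.
  apply: lerXn2r; rewrite ?nnegrE ?sumr_ge0 ?mulr_ge0//.
  rewrite exchange_big/= mulr_sumr; apply: ler_sum => j Pj; exact: sumkk.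
pose B (f : nat -> R) i := \sum_(j | P j) al (f i) i j.
(* The factor 3 is that of [(a + b + c) ^ 2 <= 3 (a ^ 2 + b ^ 2 + c ^ 2)]; the two terms [B] belong
   to the outer and to the inner sphere. *)
have step i : cmod (\sum_(j | P j) t i j) ^+ 2 <=
    3 * (A i ^+ 2 + B e i ^+ 2 + B (fun i => e i.+1) i ^+ 2).
  apply: (@le_trans _ _ ((A i + B e i + B (fun i => e i.+1) i) ^+ 2)).
    apply: lerXn2r; rewrite ?nnegrE ?cmod_ge0// ?addr_ge0//; try exact: sumr_ge0.
    apply: le_trans (cmod_sum _ _ _) _; rewrite /A /B -!big_split/=.
    by apply: ler_sum => j Pj; exact: tle.
  have := sqr_ge0 (A i - B e i); have := sqr_ge0 (A i - B (fun i => e i.+1) i).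
  have := sqr_ge0 (B e i - B (fun i => e i.+1) i); nra.
have shB f : \sum_(i < N) B f i ^+ 2 <= 2 * C0 * M ^+ 2 * tail_sum by exact: sh.
apply: (@le_trans _ _ (\sum_(i < N) 3 * (A i ^+ 2 + B e i ^+ 2 + B (fun i => e i.+1) i ^+ 2))).
  by apply: ler_sum => i _; exact: step.
rewrite -mulr_sumr !big_split/=.
have -> : 12 * M ^+ 2 * (C0 * tail_sum + tail_sum ^+ 2) = 3 * (4 * M ^+ 2 * tail_sum ^+ 2 +
  2 * C0 * M ^+ 2 * tail_sum + 2 * C0 * M ^+ 2 * tail_sum) by ring.
by rewrite ler_wpM2l// !lerD.
Qed.

End core.
Arguments cut_ratio {R} d.
Arguments far_ratio {R} d.

(** * Complex integrals *)

Section complex_integral.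
Context {R : realType} {d : nat}.
Local Notation leb := (@lebesgue_nd R d).
Local Notation C := (complex R).
Implicit Types (A B : set (d.-tuple R)) (f g phi : d.-tuple R -> C).

Lemma cmeasurable_cst (z : C) : @cmeasurable R d (fun=> z).
Proof. by split; exact: measurable_cst. Qed.

Lemma cmeasurableD f g : cmeasurable f -> cmeasurable g -> cmeasurable (fun x => f x + g x).
Proof.
move=> [fr fi] [gr gi]; split.
  rewrite (_ : (fun x => _) = (fun x => complex.Re (f x) + complex.Re (g x))); last first.
    by apply/funext => x; case: (f x); case: (g x).
  exact: measurable_funD.
rewrite (_ : (fun x => _) = (fun x => complex.Im (f x) + complex.Im (g x))); last first.
  by apply/funext => x; case: (f x); case: (g x).
exact: measurable_funD.
Qed.

Lemma cmeasurableM f g : cmeasurable f -> cmeasurable g -> cmeasurable (fun x => f x * g x).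
Proof.
move=> [fr fi] [gr gi]; split.
  rewrite (_ : (fun x => _) = (fun x => complex.Re (f x) * complex.Re (g x) - complex.Im (f x) * complex.Im (g x))); last first.
    by apply/funext => x; case: (f x); case: (g x).
  by apply: measurable_funB; exact: measurable_funM.
rewrite (_ : (fun x => _) = (fun x => complex.Re (f x) * complex.Im (g x) + complex.Im (f x) * complex.Re (g x))); last first.
  by apply/funext => x; case: (f x); case: (g x).
by apply: measurable_funD; exact: measurable_funM.
Qed.

Lemma cmeasurable_indic A : measurable A -> cmeasurable (fun x => \1_A x : C).
Proof.
move=> mA; split.
  rewrite (_ : (fun x => _) = (\1_A : _ -> R)); first exact: measurable_indic.
  by apply/funext => x; rewrite !indicE; case: (x \in A).
rewrite (_ : (fun x => _) = cst 0); first exact: measurable_cst.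
by apply/funext => x; rewrite !indicE; case: (x \in A).
Qed.

Lemma cmeasurable_cmod f : cmeasurable f -> measurable_fun setT (fun x => cmod (f x)).
Proof.
move=> [fr fi]; apply: (measurableT_comp (continuous_measurable_fun (@sqrt_continuous R))).
by apply: measurable_funD; exact: measurable_funX.
Qed.

(** The components of [cint] pass through [fine], so linearity and additivity are proved under
    integrability of both. *)
Definition cintegrable A phi :=
  leb.-integrable A (EFin \o (fun y => complex.Re (phi y))) /\
  leb.-integrable A (EFin \o (fun y => complex.Im (phi y))).

Lemma cintegrable_lty A phi : measurable A -> cmeasurable phi ->
  (\int[leb]_(y in A) (cmod (phi y))%:E < +oo)%E -> cintegrable A phi.
Proof.
move=> mA mphi fin; have mc := cmeasurable_cmod mphi; have [mr mi] := mphi.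
by split; apply/integrableP; split;
  try (by apply/measurable_EFinP; exact: measurable_funTS);
  apply: le_lt_trans fin; apply: ge0_le_integral_real => //;
  try (by apply: measurableT_comp => //; exact: measurable_normr);
  move=> y _; rewrite normr_ge0 ?cmod_Re ?cmod_Im.
Qed.

Lemma cintegrableS A B phi : measurable A -> measurable B -> A `<=` B ->
  cintegrable B phi -> cintegrable A phi.
Proof. by move=> mA mB AB [h1 h2]; split; exact: integrableS AB _. Qed.

Lemma cintegrable_bounded A phi (M : R) : measurable A -> cmeasurable phi ->
  (leb A < +oo)%E -> (forall y, A y -> cmod (phi y) <= M) -> cintegrable A phi.
Proof.
move=> mA mphi fA bd; apply: cintegrable_lty => //.
apply: (@le_lt_trans _ _ (M%:E * leb A)%E).
  apply: ge0_integral_le_cst => //; first exact: cmeasurable_cmod.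
  by move=> y Ay; rewrite cmod_ge0 bd.
have : leb A \is a fin_num by rewrite ge0_fin_numE.
by move=> /fineK <-; rewrite -EFinM ltry.
Qed.

Lemma ReD (z w : C) : complex.Re (z + w) = complex.Re z + complex.Re w.
Proof. by case: z; case: w. Qed.
Lemma ImD (z w : C) : complex.Im (z + w) = complex.Im z + complex.Im w.
Proof. by case: z; case: w. Qed.

Lemma cint_eq A f g : (forall y, A y -> f y = g y) -> cint A f = cint A g.
Proof.
move=> fg; rewrite /cint; congr Complex; congr fine;
  by apply: eq_integral => y; rewrite inE => /fg ->.
Qed.

Lemma cint0 A : cint A (fun=> 0) = 0.
Proof. by rewrite /cint /= !integral0_eq. Qed.

Lemma cint_set0 phi : cint set0 phi = 0.
Proof. by rewrite /cint !integral_set0. Qed.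

Lemma cintD A f g : measurable A -> cintegrable A f -> cintegrable A g ->
  cint A (fun y => f y + g y) = cint A f + cint A g.
Proof.
move=> mA [fr fi] [gr gi]; rewrite /cint.
transitivity (Complex (fine (\int[leb]_(y in A) (complex.Re (f y))%:E) + fine (\int[leb]_(y in A) (complex.Re (g y))%:E))
  (fine (\int[leb]_(y in A) (complex.Im (f y))%:E) + fine (\int[leb]_(y in A) (complex.Im (g y))%:E))); last by [].
congr Complex.
  by rewrite -[RHS](RintegralD mA fr gr); congr fine; apply: eq_integral => y _; rewrite ReD.
by rewrite -[RHS](RintegralD mA fi gi); congr fine; apply: eq_integral => y _; rewrite ImD.
Qed.

Lemma cintegrableZ A (z : C) f : measurable A -> cintegrable A f ->
  cintegrable A (fun y => z * f y).
Proof.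
move=> mA [fr fi]; split.
  rewrite (_ : _ \o _ = (fun x => (complex.Re z)%:E * (complex.Re (f x))%:E - (complex.Im z)%:E * (complex.Im (f x))%:E)%E); last first.
    by apply/funext => x /=; case: z; case: (f x).
  by apply: integrableB => //; exact: integrableZl.
rewrite (_ : _ \o _ = (fun x => (complex.Re z)%:E * (complex.Im (f x))%:E + (complex.Im z)%:E * (complex.Re (f x))%:E)%E); last first.
  by apply/funext => x /=; case: z; case: (f x).
by apply: integrableD => //; exact: integrableZl.
Qed.

Lemma cintZ A (z : C) f : measurable A -> cintegrable A f ->
  cint A (fun y => z * f y) = z * cint A f.
Proof.
move=> mA [fr fi]; case: z => a b; rewrite /cint.
pose Fr : R := fine (\int[leb]_(y in A) (complex.Re (f y))%:E).
pose Fi : R := fine (\int[leb]_(y in A) (complex.Im (f y))%:E).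
transitivity (Complex (a * Fr - b * Fi) (a * Fi + b * Fr)); last by [].
have ir (t : R) : leb.-integrable A (EFin \o (fun y => t * complex.Re (f y))).
  exact: (integrableZl mA t fr).
have ii (t : R) : leb.-integrable A (EFin \o (fun y => t * complex.Im (f y))).
  exact: (integrableZl mA t fi).
congr Complex.
  rewrite -[X in X - _](RintegralZl a mA fr) -[X in _ - X](RintegralZl b mA fi).
  rewrite -[RHS](RintegralB mA (ir a) (ii b)); congr fine; apply: eq_integral => y _ /=.
  by case: (f y).
rewrite -[X in X + _](RintegralZl a mA fi) -[X in _ + X](RintegralZl b mA fr).
rewrite -[RHS](RintegralD mA (ii a) (ir b)); congr fine; apply: eq_integral => y _ /=.
by case: (f y).
Qed.

Lemma cintegrableD A f g : measurable A -> cintegrable A f -> cintegrable A g ->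
  cintegrable A (fun y => f y + g y).
Proof.
move=> mA [fr fi] [gr gi]; split.
  rewrite (_ : _ \o _ = (fun x => (complex.Re (f x))%:E + (complex.Re (g x))%:E)%E); last first.
    by apply/funext => x /=; rewrite ReD.
  exact: integrableD.
rewrite (_ : _ \o _ = (fun x => (complex.Im (f x))%:E + (complex.Im (g x))%:E)%E); last first.
  by apply/funext => x /=; rewrite ImD.
exact: integrableD.
Qed.

Lemma cintB A f g : measurable A -> cintegrable A f -> cintegrable A g ->
  cint A (fun y => f y - g y) = cint A f - cint A g.
Proof.
move=> mA hf hg.
rewrite -[X in _ - X]mul1r -mulNr -(cintZ (-1) mA hg) -cintD//; last exact: cintegrableZ.
by apply: cint_eq => y _; rewrite mulN1r.
Qed.

Lemma cint_setU A B phi : measurable A -> measurable B -> A `&` B = set0 ->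
  cintegrable (A `|` B) phi -> cint (A `|` B) phi = cint A phi + cint B phi.
Proof.
move=> mA mB AB [hr hi].
have dAB : [disjoint A & B]%classic by rewrite disj_set2E AB.
transitivity (Complex (fine (\int[leb]_(y in A) (complex.Re (phi y))%:E) + fine (\int[leb]_(y in B) (complex.Re (phi y))%:E))
  (fine (\int[leb]_(y in A) (complex.Im (phi y))%:E) + fine (\int[leb]_(y in B) (complex.Im (phi y))%:E))); last by [].
congr Complex.
  exact: (Rintegral_setU mA mB hr dAB).
exact: (Rintegral_setU mA mB hi dAB).
Qed.

Lemma indicM_patch (B : set (d.-tuple R)) phi (F : C -> R) y : F 0 = 0 ->
  F ((\1_B y : C) * phi y) = ((F \o phi) \_ B) y.
Proof.
by move=> F0; rewrite patchE indicE /=; case: (y \in B); rewrite ?mul1r ?mul0r.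
Qed.

Lemma cint_indic A B phi : cint A (fun y => (\1_B y : C) * phi y) = cint (A `&` B) phi.
Proof.
rewrite /cint; congr Complex; congr fine; rewrite [RHS]integral_mkcondr; apply: eq_integral => y _.
  by rewrite (@indicM_patch B phi (@complex.Re R))// !patchE; case: ifP.
by rewrite (@indicM_patch B phi (@complex.Im R))// !patchE; case: ifP.
Qed.

Lemma cmod_indicM_le B phi y : cmod ((\1_B y : C) * phi y) <= cmod (phi y).
Proof.
by rewrite indicE; case: (y \in B); rewrite ?mul1r// mul0r cmod0 cmod_ge0.
Qed.

Lemma cintegrable_le A phi psi : measurable A -> cmeasurable phi -> cintegrable A psi ->
  cmeasurable psi -> (forall y, cmod (phi y) <= cmod (psi y)) -> cintegrable A phi.
Proof.
move=> mA mphi [ir ii] mpsi le; apply: cintegrable_lty => //.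
have [mpr mpi] := mpsi.
have mnr : measurable_fun setT (fun y => `|complex.Re (psi y)|) by exact: measurableT_comp.
have mni : measurable_fun setT (fun y => `|complex.Im (psi y)|) by exact: measurableT_comp.
apply: (@le_lt_trans _ _ (\int[leb]_(y in A) (`|complex.Re (psi y)|%:E + `|complex.Im (psi y)|%:E))%E).
  apply: (@ge0_le_integral_real _ _ _ leb A (fun y => cmod (phi y)) (fun y => `|complex.Re (psi y)| + `|complex.Im (psi y)|)) => //.
  - exact: cmeasurable_cmod.
  - exact: measurable_funD.
  - by move=> y _; rewrite cmod_ge0 (le_trans (le y))// cmod_le.
rewrite ge0_integralD//; last 2 first.
- by apply/measurable_EFinP; exact: measurable_funTS.
- by apply/measurable_EFinP; exact: measurable_funTS.
by move: ir ii => /integrableP[_ ir] /integrableP[_ ii]; exact: lte_add_pinfty.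
Qed.

Lemma cintegrable_indic A B phi : measurable A -> measurable B -> cmeasurable phi ->
  cintegrable A phi -> cintegrable A (fun y => (\1_B y : C) * phi y).
Proof.
move=> mA mB mphi iphi; apply: (cintegrable_le mA _ iphi mphi).
  by apply: cmeasurableM => //; exact: cmeasurable_indic.
exact: cmod_indicM_le.
Qed.

Lemma cint_sum A (I : Type) (r : seq I) (P : pred I) (F : I -> d.-tuple R -> C) :
  measurable A -> (forall i, P i -> cintegrable A (F i)) ->
  cintegrable A (fun y => \sum_(i <- r | P i) F i y) /\
  cint A (fun y => \sum_(i <- r | P i) F i y) = \sum_(i <- r | P i) cint A (F i).
Proof.
move=> mA iF; elim: r => [|i r [IH1 IH2]].
  split; last by rewrite big_nil -[RHS](cint0 A); apply: cint_eq => y _; rewrite big_nil.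
  rewrite (_ : (fun y => _) = fun=> 0); last by apply/funext => y; rewrite big_nil.
  by split; exact: integrable0.
rewrite (_ : (fun y => _) = fun y => (if P i then F i y else 0) + \sum_(i <- r | P i) F i y); last first.
  by apply/funext => y; rewrite big_cons; case: ifP; rewrite ?add0r.
rewrite big_cons; case: ifP => Pi; last first.
  rewrite (_ : (fun y => _) = fun y => \sum_(i <- r | P i) F i y)//.
  by apply/funext => y; rewrite add0r.
split; first by apply: cintegrableD => //; exact: iF.
by rewrite cintD ?IH2//; exact: iF.
Qed.

(** On [A], [phi] is the sum of its products with the indicators of the pieces, at most one of which
    is nonzero at each point. *)
Lemma cint_pieces A (I : finType) (P : pred I) (Q : I -> set (d.-tuple R)) phi :
  measurable A -> (forall j, P j -> measurable (Q j)) ->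
  (forall j j', P j -> P j' -> j != j' -> Q j `&` Q j' = set0) ->
  cmeasurable phi -> cintegrable A phi ->
  (forall y, A y -> (forall j, P j -> ~ Q j y) -> phi y = 0) ->
  cint A phi = \sum_(j | P j) cint (A `&` Q j) phi.
Proof.
move=> mA mQ dQ mphi iphi phi0.
have iF j : P j -> cintegrable A (fun y => (\1_(Q j) y : C) * phi y).
  by move=> Pj; apply: cintegrable_indic => //; exact: mQ.
have [_ E] := @cint_sum A I (index_enum I) P (fun j y => (\1_(Q j) y : C) * phi y) mA iF.
rewrite (eq_bigr (fun j => cint A (fun y => (\1_(Q j) y : C) * phi y))); last first.
  by move=> j _; rewrite cint_indic.
rewrite -E; apply: cint_eq => y Ay.
have [[j Pj Qjy]|none] := pselect (exists2 j, P j & Q j y).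
  rewrite (bigD1 j)//= big1 ?addr0; last first.
    move=> j' /andP[Pj' jj']; rewrite indicE memNset ?mul0r// => Qj'y.
    by have := dQ _ _ Pj' Pj jj'; move/seteqP => [/(_ y) + _]; apply.
  by rewrite indicE mem_set ?mul1r.
rewrite phi0// ?big1// => [j _|j Pj Qjy]; first by rewrite mulr0.
by apply: none; exists j.
Qed.

Lemma cint_ae_eq A f g : measurable A -> cmeasurable f -> cmeasurable g ->
  negligible leb [set y | f y != g y] -> cint A f = cint A g.
Proof.
move=> mA [fr fi] [gr gi] fg; rewrite /cint; congr Complex; congr fine.
  apply: ae_eq_integral => //.
  - by apply/measurable_EFinP; exact: measurable_funTS.
  - by apply/measurable_EFinP; exact: measurable_funTS.
  by apply: negligibleS fg => y /= h; apply/eqP => fgy; apply: h => _; rewrite fgy.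
apply: ae_eq_integral => //.
- by apply/measurable_EFinP; exact: measurable_funTS.
- by apply/measurable_EFinP; exact: measurable_funTS.
by apply: negligibleS fg => y /= h; apply/eqP => fgy; apply: h => _; rewrite fgy.
Qed.

(** The 2 comes from bounding the real and the imaginary part separately; it recurs in the constants
    below. *)
Lemma cmod_cint_le A phi (B : R) : measurable A -> cmeasurable phi ->
  (\int[leb]_(y in A) (cmod (phi y))%:E <= B%:E)%E -> cmod (cint A phi) <= 2 * B.
Proof.
move=> mA mphi hB; have mc := cmeasurable_cmod mphi.
have [hr hi] : cintegrable A phi by apply: cintegrable_lty => //; apply: le_lt_trans hB _; exact: ltry.
have part (F : d.-tuple R -> R) : leb.-integrable A (EFin \o F) -> (forall y, `|F y| <= cmod (phi y)) ->
    `|fine (\int[leb]_(y in A) (F y)%:E)| <= B.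
  move=> iF FC; apply: le_trans (le_normr_Rintegral mA iF) _.
  rewrite -lee_fin /Rintegral fineK; last first.
    by apply: integrable_fin_num => //; exact: integrable_norm.
  apply: le_trans hB; apply: ge0_le_integral => //.
  - by have := integrable_norm iF => /integrableP[].
  - by apply/measurable_EFinP; exact: measurable_funTS.
  - by move=> y _; rewrite lee_fin.
apply: le_trans (cmod_le _) _; rewrite mulr_natl mulr2n /cint /=.
by apply: lerD; apply: part => // y; [exact: cmod_Re|exact: cmod_Im].
Qed.

End complex_integral.

(** * Annular integrals over families of disjoint cubes *)

Section annuli.
Context {R : realType} {d : nat}.
Local Notation leb := (@lebesgue_nd R d).
Local Notation C := (complex R).
Implicit Types (x y : d.-tuple R).

Definition annulus x (r1 r2 : R) : set (d.-tuple R) := [set y | r1 < dist x y <= r2].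

Lemma measurable_annulus x r1 r2 : measurable (annulus x r1 r2).
Proof.
rewrite (_ : annulus x r1 r2 = dist x @^-1` `]r1, r2]%classic); last first.
  by apply/seteqP; split => y /=; rewrite in_itv.
rewrite -[X in measurable X]setTI; exact: measurable_distr.
Qed.

Lemma annulus_disjoint x (e : nat -> R) i j : (forall i, e i.+1 <= e i) -> i != j ->
  annulus x (e i.+1) (e i) `&` annulus x (e j.+1) (e j) = set0.
Proof.
move=> edec; have eh : {homo e : m n / (m <= n)%N >-> n <= m} by exact/nonincreasing_seqP.
wlog ij : i j / (i < j)%N => [hw|_].
  move=> hij; case/orP: (leq_total i j) => h.
    by apply: hw => //; rewrite ltn_neqAle hij h.
  by rewrite setIC; apply: hw; rewrite ?ltn_neqAle eq_sym ?hij ?h.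
apply/seteqP; split => // y [/= /andP[h1 _] /andP[_ h2]].
by have := lt_le_trans h1 (le_trans h2 (eh _ _ ij)); rewrite ltxx.
Qed.

(** Disjointness of the annuli gives it. It provides the shares of the trivial bound that
    [core_estimate] asks for. *)
Lemma sum_annulus_integral_le x (e : nat -> R) N (psi : d.-tuple R -> R) (Q : set (d.-tuple R)) (B : R) :
  (forall i, e i.+1 <= e i) -> measurable_fun setT psi -> (forall y, 0 <= psi y) -> measurable Q ->
  (\int[leb]_(y in Q) (psi y)%:E <= B%:E)%E ->
  \sum_(i < N) fine (\int[leb]_(y in annulus x (e i.+1) (e i) `&` Q) (psi y)%:E) <= B.
Proof.
move=> edec mpsi psi0 mQ hB.
pose A (i : 'I_N) := annulus x (e i.+1) (e i) `&` Q.
have mA i : measurable (A i) by apply: measurableI => //; exact: measurable_annulus.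
have sub (X : set (d.-tuple R)) : measurable X -> X `<=` Q -> (\int[leb]_(y in X) (psi y)%:E <= B%:E)%E.
  by move=> mX XQ; apply: le_trans hB; exact: ge0_subset_integral_real.
have fin i : (\int[leb]_(y in A i) (psi y)%:E)%E \is a fin_num.
  rewrite ge0_fin_numE; last by apply: integral_ge0 => y _; rewrite lee_fin.
  by apply: le_lt_trans (sub _ (mA i) (@subIsetr _ _ _)) _; exact: ltry.
rewrite -lee_fin -sumEFin (eq_bigr (fun i => \int[leb]_(y in A i) (psi y)%:E)%E); last first.
  by move=> i _; exact: (fineK (fin i)).
have tA : trivIset [set` index_enum 'I_N] A.
  apply/trivIsetP => i j _ _ ij; rewrite /A setIACA annulus_disjoint ?set0I//.
have := @ge0_integral_bigsetU _ _ _ leb 'I_N A (EFin \o psi) (index_enum 'I_N) mA (index_enum_uniq _) tA.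
move=> <-; last 2 first.
- by apply/measurable_EFinP; exact: measurable_funTS.
- by move=> y _; rewrite lee_fin.
apply: sub; first exact: bigsetU_measurable.
by rewrite -bigcup_seq => y [i _ [_ Qy]].
Qed.

Section annulus_estimate.
Hypothesis d0 : (0 < d)%N.
Variables (I : finType) (P : pred I) (c : I -> d.-tuple R) (s : I -> R).
Hypothesis s0 : forall j, P j -> 0 < s j.
Hypothesis disj : forall j j', P j -> P j' -> j != j' ->
  cube (c j) (s j) `&` cube (c j') (s j') = set0.
Variables (x x' : d.-tuple R).
Let D j := dist x (c j).
Hypothesis D0 : forall j, P j -> 0 < D j.
Hypothesis xx' : forall j, P j -> dist x x' <= d%:R * s j.
Variables (om : R -> R) (W : R).
Hypothesis omW : dini_bound om W.
Variables (phi phi' : d.-tuple R -> C) (M : R).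
Hypothesis M0 : 0 <= M.
Hypotheses (mphi : cmeasurable phi) (mphi' : cmeasurable phi').
Hypothesis bphi : forall j, P j ->
  (\int[leb]_(y in cube (c j) (s j)) (cmod (phi y))%:E <= (M * (s j ^+ d * (D j ^+ d)^-1))%:E)%E.
Hypothesis bphi' : forall j, P j ->
  (\int[leb]_(y in cube (c j) (s j)) (cmod (phi' y))%:E <= (M * (s j ^+ d * (D j ^+ d)^-1))%:E)%E.
Hypothesis kphi : forall j, P j -> far_ratio d * s j <= D j ->
  cmod (cint (cube (c j) (s j)) phi - cint (cube (c j) (s j)) phi') <=
  M * (s j ^+ d * (om (far_ratio d * s j / D j) * (D j ^+ d)^-1)).

(** Serves two comparisons: [x' = x] with [phi' = 0] for the bad part, and, for the good part, one
    function multiplied by the kernel at two nearby points. The constant becomes [4 * M] because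
    [cmod_cint_le] doubles each of the two integrals. *)
Lemma annulus_estimate (e : nat -> R) (N : nat) : (forall i, e i.+1 <= e i) ->
  \sum_(i < N) cmod (\sum_(j | P j)
     (cint (annulus x (e i.+1) (e i) `&` cube (c j) (s j)) phi -
      cint (annulus x' (e i.+1) (e i) `&` cube (c j) (s j)) phi')) ^+ 2
  <= 12 * (4 * M) ^+ 2 *
     (2 ^+ d * (4 ^+ d * d%:R * (6 * d%:R)) * tail_sum P c s x om + tail_sum P c s x om ^+ 2).
Proof.
move=> edec.
have mc j := @measurable_cube R d (c j) (s j).
have ma z i := measurable_annulus z (e i.+1) (e i).
have m1 := cmeasurable_cmod mphi; have m2 := cmeasurable_cmod mphi'.
pose v z f i j := fine (\int[leb]_(y in annulus z (e i.+1) (e i) `&` cube (c j) (s j)) (cmod (f y : C))%:E).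
have cintv z f i j B : cmeasurable f ->
    (\int[leb]_(y in cube (c j) (s j)) (cmod (f y))%:E <= B%:E)%E ->
    cmod (cint (annulus z (e i.+1) (e i) `&` cube (c j) (s j)) f) <= 2 * v z f i j.
  move=> mf fB; have mcf := cmeasurable_cmod mf.
  have mX : measurable (annulus z (e i.+1) (e i) `&` cube (c j) (s j)) by exact: measurableI.
  apply: cmod_cint_le => //; rewrite /v fineK//.
  rewrite ge0_fin_numE; last by apply: integral_ge0 => y _; rewrite lee_fin cmod_ge0.
  apply: le_lt_trans (ltry B); apply: le_trans fB; apply: ge0_subset_integral_real => //.
  by move=> y _; exact: cmod_ge0.
have cinth z f j B : cmeasurable f -> P j ->
    (\int[leb]_(y in cube (c j) (s j)) (cmod (f y))%:E <= B%:E)%E ->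
    \sum_(i < N) v z f i j <= B.
  move=> mf Pj fB; apply: sum_annulus_integral_le => //; first exact: cmeasurable_cmod.
  by move=> y; exact: cmod_ge0.
pose u i j : R := 2 * v x phi i j + 2 * v x' phi' i j.
have M40 : 0 <= 4 * M by rewrite mulr_ge0.
pose t i j := cint (annulus x (e i.+1) (e i) `&` cube (c j) (s j)) phi -
  cint (annulus x' (e i.+1) (e i) `&` cube (c j) (s j)) phi'.
apply: (@core_estimate R d d0 I P c s s0 disj x D0 (4 * M) N M40 om W omW e t u edec).
- move=> i j Pj; apply: le_trans (cmodD _ _) _; rewrite cmodN; apply: lerD.
    exact: cintv mphi (bphi Pj).
  exact: cintv mphi' (bphi' Pj).
- move=> j Pj; rewrite big_split/= -!mulr_sumr.
  have h1 := cinth x phi j _ mphi Pj (bphi Pj).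
  have h2 := cinth x' phi' j _ mphi' Pj (bphi' Pj).
  have -> : 4 * M * (s j ^+ d * (D j ^+ d)^-1) =
    2 * (M * (s j ^+ d * (D j ^+ d)^-1)) + 2 * (M * (s j ^+ d * (D j ^+ d)^-1)) by ring.
  by apply: lerD; rewrite ler_wpM2l.
- move=> i j Pj farj; rewrite -/(D j) => c1 c2.
  have near y : cube (c j) (s j) y ->
      `|dist x y - D j| <= cut_ratio d * s j /\ `|dist x' y - D j| <= cut_ratio d * s j.
    move=> /cube_dist_le yj; have xx := xx' Pj.
    have := dist_triangle (c j) x y; have := dist_triangle y x (c j).
    have := dist_triangle (c j) x' y; have := dist_triangle y x' (c j).
    have := dist_triangle x' x (c j); have := dist_triangle x x' (c j).
    rewrite (distC y (c j)) (distC x' x) /cut_ratio /D.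
    have := s0 Pj => sj ? ? ? ? ? ?.
    have ds0 : 0 <= d%:R * s j by rewrite mulr_ge0// ltW.
    by rewrite !ler_norml; split; apply/andP; split; lra.
  have hh : 0 <= 4 * M * (s j ^+ d * (om (far_ratio d * s j / D j) * (D j ^+ d)^-1)).
    have [_ om0 _ _ _] := omW.
    by rewrite mulr_ge0// mulr_ge0 ?exprn_ge0 ?(ltW (s0 Pj))// mulr_ge0// invr_ge0 exprn_ge0// ltW// D0.
  have empt z : (forall y, cube (c j) (s j) y -> ~ annulus z (e i.+1) (e i) y) ->
      annulus z (e i.+1) (e i) `&` cube (c j) (s j) = set0.
    by move=> h; apply/seteqP; split => // y [hy /h].
  have zero : (forall z y, z = x \/ z = x' -> cube (c j) (s j) y -> ~ annulus z (e i.+1) (e i) y) ->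
      cmod (cint (annulus x (e i.+1) (e i) `&` cube (c j) (s j)) phi -
      cint (annulus x' (e i.+1) (e i) `&` cube (c j) (s j)) phi') <=
      (e i.+1 < D j <= e i)%R%:R * (4 * M * (s j ^+ d * (om (far_ratio d * s j / D j) * (D j ^+ d)^-1))).
    move=> h; rewrite (empt x (fun y => h x y (or_introl erefl))).
    rewrite (empt x' (fun y => h x' y (or_intror erefl))) !cint_set0 subrr cmod0.
    by apply: mulr_ge0.
  have nearz z y : z = x \/ z = x' -> cube (c j) (s j) y -> `|dist z y - D j| <= cut_ratio d * s j.
    by move=> zz /near[h1 h2]; case: zz => ->.
  (* A cube cut by neither sphere is beyond the outer one, inside the inner one, or contained in
     both annuli. Only the last case contributes, and there the integrals over the whole cube are
     compared. *)
  move: c1; rewrite lter_normr => /orP[c1|c1]; last first.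
    apply: zero => z y zz cy /andP[_ h]; have := nearz z y zz cy.
    by rewrite ler_norml => /andP[h1 h2]; lra.
  move: c2; rewrite lter_normr => /orP[c2|c2].
    apply: zero => z y zz cy /andP[h _]; have := nearz z y zz cy.
    by rewrite ler_norml => /andP[h1 h2]; lra.
  have full z : z = x \/ z = x' -> annulus z (e i.+1) (e i) `&` cube (c j) (s j) = cube (c j) (s j).
    move=> zz; apply/setIidr => y cy; have := nearz z y zz cy.
    by rewrite ler_norml => /andP[h1 h2]; apply/andP; split; lra.
  have cs0 : 0 <= cut_ratio d * s j by rewrite /cut_ratio !mulr_ge0// ltW// s0.
  have -> : (e i.+1 < D j <= e i) by apply/andP; split; lra.
  rewrite mul1r /t (full x (or_introl erefl)) (full x' (or_intror erefl)).
  apply: le_trans (kphi Pj farj) _; apply: ler_wpM2r; last first.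
    by rewrite ler_peMl// ler1n.
  have [_ om0 _ _ _] := omW.
  by rewrite mulr_ge0 ?exprn_ge0 ?(ltW (s0 Pj))// mulr_ge0// invr_ge0 exprn_ge0// ltW// D0.
Qed.

End annulus_estimate.
End annuli.

(** * Standard kernels *)

Section kernel.
Context {R : realType} {d : nat}.
Local Notation leb := (@lebesgue_nd R d).
Local Notation C := (complex R).
Local Notation Rd := (d.-tuple R).
Implicit Types (x y : Rd).

(* Truncations never see the diagonal; [K x x = 0] there makes [K] jointly measurable. *)
Definition std_kernel (K : Rd -> Rd -> C) (om : R -> R) (cK : R) :=
  [/\ 0 <= cK, (forall x, K x x = 0),
    (forall x y, x != y -> cmod (K x y) <= cK * (dist x y ^+ d)^-1) &
    (forall x x' y, x != y -> dist x x' <= dist x y / 2 ->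
       cmod (K x y - K x' y) + cmod (K y x - K y x') <=
       cK * (om (dist x x' / dist x y) * (dist x y ^+ d)^-1))].

(** By monotonicity [n om (2 ^ -n)] is at most the sum of the first [n] terms, hence at most [W]. *)
Lemma dini_bound_small (om : R -> R) (W : R) : dini_bound om W ->
  forall e, 0 < e -> exists2 del, 0 < del & forall t, t <= del -> om t <= e.
Proof.
move=> [omh om0 _ _ omS] e e0.
pose n := (Num.truncn (W / e)).+1.
have n0 : (0 < n)%N by [].
have Wn : W / e < n%:R by exact: truncnS_gt.
exists (2 ^+ n)^-1 => [|t tn]; first by rewrite invr_gt0 exprn_gt0.
apply: le_trans (omh _ _ tn) _.
have h : n%:R * om (2 ^+ n)^-1 <= W.
  apply: le_trans (omS n); rewrite mulr_natl -[X in _ *+ X]card_ord -sumr_const.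
  apply: ler_sum => k _; apply: omh; rewrite lef_pV2 ?posrE ?exprn_gt0//.
  by rewrite ler_eXn2l ?ltr1n// ltnW.
rewrite -(@ler_pM2l _ n%:R) ?ltr0n//; apply: le_trans h _.
by rewrite -ler_pdivrMr// ltW.
Qed.

Definition grid_index (n : nat) x : d.-tuple int := [tuple Num.floor (2 ^+ n * tnth x i) | i < d].

Definition grid_point (n : nat) (z : d.-tuple int) : Rd := [tuple (tnth z i)%:~R / 2 ^+ n | i < d].

Lemma dist_grid n x : dist x (grid_point n (grid_index n x)) <= d%:R / 2 ^+ n.
Proof.
apply: dist_le => i; rewrite !tnth_mktuple.
have n0 : 0 < 2 ^+ n :> R by rewrite exprn_gt0.
have /andP[h1 h2] := floor_itv (2 ^+ n * tnth x i).
set f := Num.floor _ in h1 h2 *.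
have -> : tnth x i - f%:~R / 2 ^+ n = (2 ^+ n * tnth x i - f%:~R) / 2 ^+ n.
  by field; rewrite gt_eqF.
rewrite normrM normfV (gtr0_norm n0) ler_pdivrMr// mulVf ?gt_eqF//.
by move: h2; rewrite intrD ger0_norm ?subr_ge0// => h2; lra.
Qed.

Lemma measurable_grid_index n (z : d.-tuple int) : measurable (grid_index n @^-1` [set z]).
Proof.
rewrite (_ : _ @^-1` _ = \bigcap_(i in [set: 'I_d]) ((fun x => tnth x i) @^-1` `[(tnth z i)%:~R / 2 ^+ n, (tnth z i + 1)%:~R / 2 ^+ n[%classic)).
  apply: fin_bigcap_measurable => // i _.
  by rewrite -[X in measurable X]setTI; exact: measurable_tnth.
have n0 : 0 < 2 ^+ n :> R by rewrite exprn_gt0.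
have E (x : Rd) i : (tnth x i \in `[(tnth z i)%:~R / 2 ^+ n, (tnth z i + 1)%:~R / 2 ^+ n[) =
    (Num.floor (2 ^+ n * tnth x i) == tnth z i).
  rewrite in_itv /= ler_pdivrMr// ltr_pdivlMr// ![tnth x i * _]mulrC.
  by rewrite -floor_eq// num_real.
apply/seteqP; split => x /=.
  by move=> xz i _ /=; rewrite E -xz tnth_mktuple.
move=> h; apply: eq_from_tnth => i; rewrite tnth_mktuple; apply/eqP.
by rewrite -E; exact: h.
Qed.

(** The preimage of any set is a countable union of cells. *)
Lemma measurable_fun_countable_partition (dT dU : measure_display)
  (T : measurableType dT) (U : measurableType dU) (J : countType) (idx : T -> J) (phi : J -> U) :
  (forall j, measurable (idx @^-1` [set j])) -> measurable_fun setT (phi \o idx).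
Proof.
move=> midx _ B mB; rewrite setTI.
rewrite (_ : _ @^-1` _ = \bigcup_j (if `[< B (phi j) >] then idx @^-1` [set j] else set0)).
  by apply: countable_bigcupT_measurable => // j; case: ifP.
apply/seteqP; split => t /=.
  by move=> Bt; exists (idx t) => //; rewrite asboolT.
by move=> [j _]; case: asboolP => // Bj /= ->.
Qed.

Variables (K : Rd -> Rd -> C) (om : R -> R) (W cK : R).
Hypothesis omW : dini_bound om W.
Hypothesis stdK : std_kernel K om cK.

Let gp n x := grid_point n (grid_index n x).

(* Joint measurability is obtained by rounding both variables to a dyadic grid. *)
Lemma kernel_grid_cvg x y : x != y -> forall e, 0 < e ->
  exists n0, forall n, (n0 <= n)%N -> cmod (K x y - K (gp n x) (gp n y)) <= e.
Proof.
move=> xy e e0; have [cK0 _ _ Kd] := stdK; have [omh om0 _ _ _] := omW.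
have D0 := dist_gt0 xy; set D := dist x y in D0 *.
(* Moving [x] and then [y] to the grid makes two errors proportional to [e / A], the second with an
   extra [2 ^ d]. Together they are at most [e], and the added 1 keeps [A] positive. *)
pose A := cK * (1 + 2 ^+ d) / D ^+ d + 1.
have A0 : 0 < A.
  by rewrite ltr_wpDl// !mulr_ge0// ?addr_ge0// ?invr_ge0 ?exprn_ge0// ltW.
have [del del0 hdel] := dini_bound_small omW (divr_gt0 e0 A0).
(* The mesh: at most a quarter of [D], so that the rounded [x] stays at distance [D / 2] or more
   from [y], and small enough for [om] to be at most [e / A]. *)
pose m := Num.min (del / 2) 4^-1 * D.
have m0 : 0 < m by rewrite mulr_gt0// lt_min divr_gt0//= invr_gt0.
pose n0 := (Num.truncn (d%:R / m)).+1.
exists n0 => n n0n.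
have dn : d%:R / 2 ^+ n <= m.
  rewrite ler_pdivrMr ?exprn_gt0// mulrC -ler_pdivrMr//.
  apply: (@le_trans _ _ n0%:R); first exact/ltW/truncnS_gt.
  by rewrite -natrX ler_nat; apply: leq_trans n0n _; exact/ltnW/ltn_expl.
have gx : dist x (gp n x) <= m := le_trans (dist_grid n x) dn.
have gy : dist y (gp n y) <= m := le_trans (dist_grid n y) dn.
have mD4 : m <= D / 4.
  by rewrite /m mulrC; apply: ler_wpM2l; [exact: ltW|rewrite ge_min lexx orbT].
have mdel : m <= del / 2 * D.
  by rewrite /m ler_wpM2r ?(ltW D0)// ge_min lexx.
have tr := dist_triangle (gp n x) x y; rewrite -/D in tr.
have Dg : D / 2 <= dist y (gp n x) by rewrite distC; lra.
have Dg0 : 0 < dist y (gp n x) by apply: lt_le_trans Dg; rewrite divr_gt0.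
have ygx : y != gp n x by apply: contraTN Dg0 => /eqP <-; rewrite distxx ltxx.
have h1 : cmod (K x y - K (gp n x) y) <= cK * (e / A * (D ^+ d)^-1).
  have := Kd x (gp n x) y xy; rewrite -/D => /(_ _)/(le_trans _) h.
  apply: le_trans (_ : _ <= cK * (om (dist x (gp n x) / D) / D ^+ d)) _.
    apply: le_trans; last apply: (Kd x (gp n x) y xy); rewrite -/D; first by rewrite lerDl cmod_ge0.
    by lra.
  apply: ler_wpM2l => //; apply: ler_wpM2r; first by rewrite invr_ge0 exprn_ge0// ltW.
  apply: hdel; rewrite ler_pdivrMr//; apply: le_trans gx _; apply: le_trans mdel _.
  by apply: ler_wpM2r; [exact: ltW|lra].
have h2 : cmod (K (gp n x) y - K (gp n x) (gp n y)) <= cK * (e / A * (2 ^+ d / D ^+ d)).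
  apply: le_trans (_ : _ <= cK * (om (dist y (gp n y) / dist y (gp n x)) / dist y (gp n x) ^+ d)) _.
    apply: le_trans; last apply: (Kd y (gp n y) (gp n x) ygx); first by rewrite lerDr cmod_ge0.
    by lra.
  apply: ler_wpM2l => //; apply: ler_pM => //; first by rewrite invr_ge0 exprn_ge0// ltW.
    apply: hdel; rewrite ler_pdivrMr//; apply: le_trans gy _; apply: le_trans mdel _.
    by rewrite -mulrA; apply: ler_wpM2l; [exact: ltW|lra].
  rewrite -[leRHS]invrK invf_div -expr_div_n lef_pV2 ?posrE ?exprn_gt0 ?divr_gt0//.
  by apply: lerXn2r => //; rewrite nnegrE ltW// divr_gt0.
have -> : K x y - K (gp n x) (gp n y) = (K x y - K (gp n x) y) + (K (gp n x) y - K (gp n x) (gp n y)).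
  by rewrite addrA subrK.
apply: le_trans (cmodD _ _) _; apply: le_trans (lerD h1 h2) _.
have -> : cK * (e / A * (D ^+ d)^-1) + cK * (e / A * (2 ^+ d / D ^+ d)) = e * ((cK * (1 + 2 ^+ d) / D ^+ d) / A).
  by ring.
rewrite ler_piMr ?(ltW e0)// ler_pdivrMr// mul1r /A lerDl//.
Qed.

Let offdiag : set (Rd * Rd) := [set p | p.1 != p.2].

Lemma measurable_offdiag : measurable offdiag.
Proof.
rewrite (_ : offdiag = (fun p : Rd * Rd => dist p.1 p.2) @^-1` `]0, +oo[%classic).
  by rewrite -[X in measurable X]setTI; exact: measurable_dist.
apply/seteqP; split => p; rewrite /offdiag /= in_itv/= andbT.
  exact: dist_gt0.
by apply: contraTneq => ->; rewrite distxx ltxx.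
Qed.

(** A pointwise limit of functions of the rounded pair, which are measurable whatever the kernel; on
    the diagonal both sides are 0. [F] stands for the real or the imaginary part. *)
Lemma measurable_kernel_part (F : C -> R) : F 0 = 0 -> (forall z w, `|F z - F w| <= cmod (z - w)) ->
  measurable_fun setT (fun p : Rd * Rd => F (K p.1 p.2)).
Proof.
move=> F0 FL; have [_ Kdiag _ _] := stdK.
pose idx n (p : Rd * Rd) := (grid_index n p.1, grid_index n p.2).
pose h n (p : Rd * Rd) : R := \1_offdiag p * F (K (gp n p.1) (gp n p.2)).
apply: (@measurable_fun_cvg _ _ _ _ h).
  move=> n; apply: measurable_funM; first by apply: measurable_indic; exact: measurable_offdiag.
  rewrite (_ : (fun p => _) = (fun q => F (K (grid_point n q.1) (grid_point n q.2))) \o idx n)//.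
  apply: measurable_fun_countable_partition => -[z w].
  rewrite (_ : _ @^-1` _ = (grid_index n @^-1` [set z]) `*` (grid_index n @^-1` [set w])).
    by apply: measurableX; exact: measurable_grid_index.
  by apply/seteqP; split => -[x y]; rewrite /idx /= => -[-> ->].
move=> [x y] _ /=; have [->|xy] := eqVneq x y.
  rewrite Kdiag F0 (_ : (fun n => _) = fun=> 0); first exact: cvg_cst.
  by apply/funext => n; rewrite /h indicE memNset ?mul0r// /offdiag /= eqxx.
apply/cvgrPdist_le => e e0; have [n0 hn0] := kernel_grid_cvg xy e0.
exists n0 => // n /= n0n; rewrite /h indicE mem_set ?mul1r//=.
by apply: le_trans (FL _ _) _; exact: hn0.
Qed.

Lemma measurable_kernel_Re : measurable_fun setT (fun p : Rd * Rd => complex.Re (K p.1 p.2)).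
Proof.
apply: measurable_kernel_part => // z w; apply: le_trans (cmod_Re _).
by case: z; case: w.
Qed.

Lemma measurable_kernel_Im : measurable_fun setT (fun p : Rd * Rd => complex.Im (K p.1 p.2)).
Proof.
apply: measurable_kernel_part => // z w; apply: le_trans (cmod_Im _).
by case: z; case: w.
Qed.

Lemma cmeasurable_kernel x : cmeasurable (K x).
Proof.
split.
  exact: (measurableT_comp measurable_kernel_Re (pair1_measurable x)).
exact: (measurableT_comp measurable_kernel_Im (pair1_measurable x)).
Qed.

Variables (a : Rd) (l : R).
Hypothesis l0 : 0 < l.

(** Bounded everywhere, not just almost everywhere, which makes every annular integral absolutely
    convergent; [bounded_version] supplies such a representative. *)
Definition nice (f : Rd -> C) :=
  [/\ cmeasurable f, exists M, forall x, cmod (f x) <= M &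
      forall x, ~ cube a l x -> f x = 0].

Lemma nice_sub f g : nice f -> cmeasurable g -> (exists M, forall x, cmod (g x) <= M) ->
  (forall x, f x = 0 -> g x = 0) -> nice g.
Proof.
by move=> [_ _ hl] mg bg fg; split => // x /hl; exact: fg.
Qed.

Lemma niceD f g : nice f -> nice g -> nice (fun y => f y + g y).
Proof.
move=> [mf [M hM] hf] [mg [N hN] hg]; split; first exact: cmeasurableD.
  by exists (M + N) => x; apply: le_trans (cmodD _ _) _; exact: lerD.
by move=> x qx; rewrite hf// hg// addr0.
Qed.

Lemma niceN f : nice f -> nice (fun y => - f y).
Proof.
move=> nf; have [mf [M hM] _] := nf; apply: (nice_sub nf).
- rewrite (_ : (fun y => _) = (fun y => (-1) * f y)); last by apply/funext => y; rewrite mulN1r.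
  by apply: cmeasurableM => //; exact: cmeasurable_cst.
- by exists M => x; rewrite cmodN.
- by move=> x ->; rewrite oppr0.
Qed.

Lemma nice_indic f (A : set Rd) : measurable A -> nice f -> nice (fun y => (\1_A y : C) * f y).
Proof.
move=> mA nf; have [mf [M hM] _] := nf; apply: (nice_sub nf).
- by apply: cmeasurableM => //; exact: cmeasurable_indic.
- by exists M => x; apply: le_trans (hM x); exact: cmod_indicM_le.
- by move=> x ->; rewrite mulr0.
Qed.

Lemma cintegrable_nice f A : measurable A -> nice f -> cintegrable A f.
Proof.
move=> mA [mf [M hM] hl]; apply: (@cintegrableS _ _ A setT) => //.
have M0 : 0 <= M by apply: le_trans (hM a); exact: cmod_ge0.
have mQ := @measurable_cube R d a l.
apply: cintegrable_lty => //.
apply: (@le_lt_trans _ _ (\int[leb]_(y in setT) (M * \1_(cube a l) y)%:E)%E).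
  apply: ge0_le_integral_real => //; first exact: cmeasurable_cmod.
    by apply: measurable_funM => //; exact: measurable_indic.
  move=> y _; rewrite cmod_ge0/= indicE; case: (boolP (y \in _)) => [_|].
    by rewrite mulr1.
  by rewrite notin_setE => /hl ->; rewrite cmod0 mulr0.
under eq_integral do rewrite EFinM.
rewrite ge0_integralZl//; last by apply/measurable_EFinP; exact: measurable_indic.
rewrite integral_indic// setIT.
by have /= -> := lebesgue_nd_cube a (ltW l0); rewrite -EFinM ltry.
Qed.

Lemma cintegrable_kernel f x r A : 0 < r -> nice f -> measurable A ->
  (forall y, A y -> r < dist x y) -> cintegrable A (fun y => K x y * f y).
Proof.
move=> r0 nf mA hA; have [cK0 _ Kb _] := stdK; have [mf _ _] := nf.
have mKf : cmeasurable (fun y => K x y * f y) by apply: cmeasurableM => //; exact: cmeasurable_kernel.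
pose g y := Complex (cK * (r ^+ d)^-1) 0 * f y.
have mg : cmeasurable g by apply: cmeasurableM => //; exact: cmeasurable_cst.
have [ir ii] : cintegrable A g by apply: cintegrableZ => //; exact: cintegrable_nice.
have : cintegrable A (fun y => (\1_A y : C) * (K x y * f y)).
  apply: (@cintegrable_le _ _ A _ g) => //.
    by apply: cmeasurableM => //; exact: cmeasurable_indic.
  move=> y; rewrite indicE /g; case: (boolP (y \in A)) => [|_]; last by rewrite mul0r cmod0 cmod_ge0.
  rewrite inE => /hA ry; have D0 : 0 < dist x y by exact: lt_trans ry.
  have xy : x != y by apply: contraTneq D0 => ->; rewrite distxx ltxx.
  rewrite mul1r !cmodM ler_wpM2r ?cmod_ge0// cmod_real ger0_norm; last first.
    by rewrite mulr_ge0// invr_ge0 exprn_ge0// ltW.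
  apply: le_trans (Kb x y xy) _; apply: ler_wpM2l => //.
  by rewrite lef_pV2 ?posrE ?exprn_gt0//; apply: lerXn2r; rewrite ?nnegrE ltW.
move=> [hr hi]; split; [move: hr|move: hi]; apply: eq_integrable => // y yA /=;
  by rewrite indicE yA mul1r.
Qed.

End kernel.

(** * The variation operator *)

Section var_theory.
Context {R : realType} {d : nat}.
Local Notation leb := (@lebesgue_nd R d).
Local Notation C := (complex R).
Local Notation Rd := (d.-tuple R).
Implicit Types (x y : Rd) (f g h : Rd -> C) (e : nat -> R).

Definition ann_op (K : Rd -> Rd -> C) f x r1 r2 : C := cint (annulus x r1 r2) (fun y => K x y * f y).

Definition zero_seq e := (forall i, e i.+1 < e i) /\ e @ \oo --> (0 : R).

Lemma zero_seq_gt0 e i : zero_seq e -> 0 < e i.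
Proof.
move=> [edec ecvg]; apply: le_lt_trans (edec i).
have edec' : nonincreasing_seq e by apply/nonincreasing_seqP => n; exact: ltW.
have := nonincreasing_cvgn_ge edec' (cvgP _ ecvg) i.+1.
by rewrite (cvg_lim _ ecvg).
Qed.

Lemma zero_seq_ex : exists e, zero_seq e.
Proof.
exists harmonic; split => [i|]; last exact: cvg_harmonic.
by rewrite /harmonic/= ltf_pV2 ?posrE ?ltr0n// ltr_nat.
Qed.

Lemma measurable_dist_gt x r : measurable [set y | r < dist x y].
Proof.
rewrite (_ : [set y | _] = dist x @^-1` `]r, +oo[%classic); last first.
  by apply/seteqP; split => y /=; rewrite in_itv/= andbT.
by rewrite -[X in measurable X]setTI; exact: measurable_distr.
Qed.

Variables (K : Rd -> Rd -> C) (om : R -> R) (W cK : R).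
Hypothesis omW : dini_bound om W.
Hypothesis stdK : std_kernel K om cK.
Variables (a : Rd) (l : R) (rho : R).
Hypothesis l0 : 0 < l.
Hypothesis rho2 : 2 < rho.
Let rho0 : 0 < rho. Proof. exact: lt_trans rho2. Qed.
Local Notation nice := (nice a l).

Lemma cintegrable_annulus f x r1 r2 : nice f -> 0 < r1 ->
  cintegrable (annulus x r1 r2) (fun y => K x y * f y).
Proof.
move=> nf r10; apply: (cintegrable_kernel omW stdK l0 r10 nf) => //.
  exact: measurable_annulus.
by move=> y /andP[].
Qed.

Lemma trunc_opB f x r1 r2 : nice f -> 0 < r1 -> r1 <= r2 ->
  trunc_op K r1 f x - trunc_op K r2 f x = ann_op K f x r1 r2.
Proof.
move=> nf r10 r12; rewrite /trunc_op /kint.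
have E : [set y | r1 < dist x y] = annulus x r1 r2 `|` [set y | r2 < dist x y].
  apply/seteqP; split => y /=.
    by move=> r1y; case: (leP (dist x y) r2) => h; [left; apply/andP|right].
  by move=> [/andP[]//|]; exact: le_lt_trans.
have m1 := measurable_annulus x r1 r2; have m2 := measurable_dist_gt x r2.
rewrite E cint_setU ?addrK//.
  by apply/seteqP; split => // y [/= /andP[_ h1] h2]; have := le_lt_trans h1 h2; rewrite ltxx.
by rewrite -E; apply: (cintegrable_kernel omW stdK l0 r10 nf) => //; exact: measurable_dist_gt.
Qed.

Definition jump f x e i : R := cmod (ann_op K f x (e i.+1) (e i)).

(** The supremum over sequences and the infinite sums reduce to finite [l^rho] sums of annular
    integrals, with a bound uniform in the sequence and in the number of jumps. Truncations become
    annular integrals by [trunc_opB]. *)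
Lemma var_op_leP f x B : nice f -> 0 <= B -> (var_op K rho f x <= B%:E)%E <->
  forall e N, zero_seq e -> lp_sum rho (index_enum 'I_N) (fun i => jump f x e i) <= B.
Proof.
move=> nf B0.
have step e : zero_seq e ->
    ((\sum_(i <oo) (cmod (trunc_op K (e i.+1) f x - trunc_op K (e i) f x) `^ rho)%:E) `^ rho^-1 <= B%:E)%E
    <-> forall N, lp_sum rho (index_enum 'I_N) (fun i => jump f x e i) <= B.
  move=> ze.
  rewrite (eq_eseriesr (g := fun i => (jump f x e i `^ rho)%:E)); last first.
    move=> i _; rewrite trunc_opB//; first exact: zero_seq_gt0.
    by apply/ltW; have [] := ze.
  have u0 i : (0 <= (jump f x e i `^ rho)%:E)%E by rewrite lee_fin powR_ge0.
  set S := (\sum_(i <oo) _)%E.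
  have S0 : (0 <= S)%E by exact: nneseries_ge0.
  have memp (z : \bar R) : (0 <= z)%E -> z \in `[0%E, +oo%E] by rewrite in_itv/= leey andbT.
  split => [h N|h].
    have hS : (S <= (B `^ rho)%:E)%E.
      have := gt0_ler_poweR (ltW rho0) (memp _ (poweR_ge0 _ _)) (memp B%:E B0) h.
      by rewrite -poweRrM mulVf ?gt_eqF// poweRe1.
    rewrite lp_sum_le// -lee_fin -sumEFin; apply: le_trans hS.
    by have := @nneseries_lim_ge R (fun i => (jump f x e i `^ rho)%:E) xpredT 0 N (fun i _ _ => u0 i); rewrite big_mkord.
  have hS : (S <= (B `^ rho)%:E)%E.
    apply: nneseries_le_bound => // n; rewrite sumEFin lee_fin.
    by have := h n; rewrite lp_sum_le.
  have ri : 0 <= rho^-1 by rewrite invr_ge0 ltW.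
  have := gt0_ler_poweR ri (memp _ S0) (memp (B `^ rho)%:E (powR_ge0 _ _)) hS.
  by rewrite poweR_EFin -powRrM mulfV ?gt_eqF// powRr1.
split => [h e N ze|h].
  apply: (step e ze).1; apply: le_trans h; apply: ereal_sup_ubound; by exists e.
by apply: ge_ereal_sup => _ [e ze <-]; apply/(step e ze) => N; exact: h.
Qed.

Lemma var_op_ge0 f x : (0 <= var_op K rho f x)%E.
Proof.
have [e ze] := zero_seq_ex.
by apply: le_trans (ereal_sup_ubound _); last exists e => //; exact: poweR_ge0.
Qed.

Lemma var_op_leD f g h x : nice f -> nice g -> nice h ->
  (forall r1 r2, 0 < r1 -> cmod (ann_op K f x r1 r2) <= cmod (ann_op K g x r1 r2) + cmod (ann_op K h x r1 r2)) ->
  (var_op K rho f x <= var_op K rho g x + var_op K rho h x)%E.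
Proof.
move=> nf ng nh le.
have := var_op_ge0 g x; case Eg : (var_op K rho g x) => [vg| |]// vg0; last first.
  by have := var_op_ge0 h x; case: (var_op K rho h x) => [vh| |]// _; rewrite leey.
have := var_op_ge0 h x; case Eh : (var_op K rho h x) => [vh| |]// vh0; last by rewrite leey.
rewrite lee_fin in vg0; rewrite lee_fin in vh0.
apply/var_op_leP => //; first exact: addr_ge0.
move=> e N ze; apply: (@le_trans _ _ (lp_sum rho (index_enum 'I_N) (fun i => jump g x e i + jump h x e i))).
  apply: le_lp_sum => // i; rewrite cmod_ge0/=; apply: le; exact: zero_seq_gt0.
apply: le_trans (minkowski_sum _ _ _ _) _.
- by apply: ltW; apply: lt_trans rho2; rewrite ltr1n.
- by move=> i; exact: cmod_ge0.
- by move=> i; exact: cmod_ge0.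
by apply: lerD; [apply: (var_op_leP x ng vg0).1|apply: (var_op_leP x nh vh0).1] => //;
  rewrite ?Eg ?Eh.
Qed.

Lemma var_op_le f g x : nice f -> nice g ->
  (forall r1 r2, 0 < r1 -> cmod (ann_op K f x r1 r2) <= cmod (ann_op K g x r1 r2)) ->
  (var_op K rho f x <= var_op K rho g x)%E.
Proof.
move=> nf ng le.
have := var_op_ge0 g x; case Eg : (var_op K rho g x) => [vg| |]// vg0; last by rewrite leey.
rewrite lee_fin in vg0; apply/var_op_leP => // e N ze.
apply: le_trans (_ : lp_sum rho (index_enum 'I_N) (fun i => jump g x e i) <= _).
  apply: le_lp_sum => // i; rewrite cmod_ge0/=; apply: le; exact: zero_seq_gt0.
by apply: (var_op_leP x ng vg0).1 => //; rewrite Eg.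
Qed.

Lemma cmeasurable_kernelM x f : nice f -> cmeasurable (fun y => K x y * f y).
Proof. by move=> [mf _ _]; apply: cmeasurableM => //; exact: (cmeasurable_kernel omW stdK). Qed.

Lemma ann_op_ae_eq f g x r1 r2 : nice f -> nice g -> negligible leb [set y | f y != g y] ->
  ann_op K f x r1 r2 = ann_op K g x r1 r2.
Proof.
move=> nf ng fg; apply: cint_ae_eq; [exact: measurable_annulus|exact: cmeasurable_kernelM..|].
apply: negligibleS fg => y /=; apply: contraNN => /eqP ->; exact: eqxx.
Qed.

Lemma ann_opD f g x r1 r2 : nice f -> nice g -> 0 < r1 ->
  ann_op K (fun y => f y + g y) x r1 r2 = ann_op K f x r1 r2 + ann_op K g x r1 r2.
Proof.
move=> nf ng r0; rewrite -cintD; [|exact: measurable_annulus|exact: cintegrable_annulus..].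
by apply: cint_eq => y _; rewrite mulrDr.
Qed.

Lemma ann_opN f x r1 r2 : nice f -> 0 < r1 ->
  ann_op K (fun y => - f y) x r1 r2 = - ann_op K f x r1 r2.
Proof.
move=> nf r0; rewrite -mulN1r -cintZ; [|exact: measurable_annulus|exact: cintegrable_annulus].
by apply: cint_eq => y _; rewrite mulN1r mulrN.
Qed.

Lemma var_opN f x : nice f -> var_op K rho (fun y => - f y) x = var_op K rho f x.
Proof.
move=> nf; have nN := niceN nf.
by apply/eqP; rewrite eq_le; apply/andP; split; apply: var_op_le => // r1 r2 r0;
  rewrite ann_opN// cmodN.
Qed.

(** Annular integrals ignore null sets, so an almost-everywhere decomposition gives an inequality at
    every point [x]. *)
Lemma var_opD f g h x : nice f -> nice g -> nice h -> negligible leb [set y | f y != g y + h y] ->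
  (var_op K rho f x <= var_op K rho g x + var_op K rho h x)%E.
Proof.
move=> nf ng nh fgh; apply: var_op_leD => // r1 r2 r0.
rewrite (@ann_op_ae_eq f (fun y => g y + h y))//; last exact: niceD.
by rewrite ann_opD//; exact: cmodD.
Qed.

Lemma var_op0 f x : nice f -> negligible leb [set y | f y != 0] -> var_op K rho f x = 0%E.
Proof.
move=> nf f0; apply/eqP; rewrite eq_le var_op_ge0 andbT.
apply/var_op_leP => // e N ze; rewrite lp_sum_le//.
rewrite powR0 ?gt_eqF// big1// => i _; rewrite /jump.
have n0 : nice (fun=> 0).
  by split => //; exists 0 => y; rewrite cmod0.
rewrite (@ann_op_ae_eq f (fun=> 0))// /ann_op (@cint_eq _ _ _ _ (fun=> 0)).
  by rewrite cint0 cmod0 powR0 ?gt_eqF.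
by move=> y _; rewrite mulr0.
Qed.
End var_theory.

(** * Continuity of annular integrals and measurability of the variation *)

Section var_measurable.
Context {R : realType} {d : nat}.
Local Notation leb := (@lebesgue_nd R d).
Local Notation C := (complex R).
Local Notation Rd := (d.-tuple R).
Implicit Types (x y : Rd) (f g h : Rd -> C) (e : nat -> R).

(** The sigma-algebra is the product one; a set open for [dist] belongs to it as the countable union
    of the grid cells that it contains. *)
Lemma dist_open_measurable (U : set Rd) :
  (forall x, U x -> exists2 r, 0 < r & forall x', dist x x' <= r -> U x') -> measurable U.
Proof.
move=> oU.
pose cell (p : nat * d.-tuple int) : set Rd := grid_index p.1 @^-1` [set p.2].
rewrite (_ : U = \bigcup_p (if `[< cell p `<=` U >] then cell p else set0)).
  apply: countable_bigcupT_measurable => // p; case: ifP => // _; exact: measurable_grid_index.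
apply/seteqP; split => x; last by move=> [p _]; case: asboolP => // h; exact: h.
move=> Ux; have [r r0 hr] := oU x Ux.
pose n := (Num.truncn (d%:R / (r / 2))).+1.
have dn : d%:R / 2 ^+ n <= r / 2.
  rewrite ler_pdivrMr ?exprn_gt0// mulrC -ler_pdivrMr ?divr_gt0//.
  apply: (@le_trans _ _ n%:R); first exact/ltW/truncnS_gt.
  by rewrite -natrX ler_nat; exact/ltnW/ltn_expl.
exists (n, grid_index n x) => //; rewrite asboolT//= => x' /= xx'.
apply: hr; apply: le_trans (dist_triangle (grid_point n (grid_index n x)) _ _) _.
have := dist_grid n x; have := dist_grid n x'; rewrite xx' [dist x' _]distC => h1 h2.
by rewrite (splitr r); apply: lerD; [exact: le_trans h2 dn|exact: le_trans h1 dn].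
Qed.

Lemma integral_cindic (A : set Rd) (c : R) : measurable A -> 0 <= c ->
  (\int[leb]_y (c * \1_A y)%:E = c%:E * leb A)%E.
Proof.
move=> mA c0; under eq_integral do rewrite EFinM.
rewrite ge0_integralZl//; last by apply/measurable_EFinP; exact: measurable_indic.
by rewrite integral_indic// setIT.
Qed.

Lemma integral_cindic3 (A1 A2 A3 : set Rd) (c1 c2 c3 : R) :
  measurable A1 -> measurable A2 -> measurable A3 -> 0 <= c1 -> 0 <= c2 -> 0 <= c3 ->
  (\int[leb]_y (c1 * \1_A1 y + c2 * \1_A2 y + c3 * \1_A3 y)%:E =
   c1%:E * leb A1 + c2%:E * leb A2 + c3%:E * leb A3)%E.
Proof.
move=> m1 m2 m3 h1 h2 h3.
have mc (A : set Rd) (c : R) : measurable A -> measurable_fun setT (fun y => (c * \1_A y)%:E).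
  by move=> mA; apply/measurable_EFinP; apply: measurable_funM => //; exact: measurable_indic.
have ge (A : set Rd) (c : R) y : 0 <= c -> (0 <= (c * \1_A y)%:E)%E by move=> c0; rewrite lee_fin mulr_ge0.
under eq_integral do rewrite !EFinD.
rewrite ge0_integralD//; last 4 first.
- by move=> y _; rewrite adde_ge0// ge.
- by apply: emeasurable_funD; exact: mc.
- by move=> y _; exact: ge.
- exact: mc.
rewrite ge0_integralD//; last 4 first.
- by move=> y _; exact: ge.
- exact: mc.
- by move=> y _; exact: ge.
- exact: mc.
by rewrite !integral_cindic.
Qed.

Lemma cmeasurableB f g : cmeasurable f -> cmeasurable g -> cmeasurable (fun y => f y - g y).
Proof.
move=> mf mg; rewrite (_ : (fun y => _) = (fun y => f y + (-1) * g y)).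
  by apply: cmeasurableD => //; apply: cmeasurableM => //; exact: cmeasurable_cst.
by apply/funext => y; rewrite mulN1r.
Qed.

Lemma cintegrable_mkcond (A : set Rd) f : measurable A -> cintegrable A f ->
  cintegrable setT (fun y => (\1_A y : C) * f y).
Proof.
move=> mA [hr hi]; split.
  rewrite (_ : _ \o _ = (EFin \o (fun y => complex.Re (f y))) \_ A); first exact: ((integrable_mkcond _ mA).1 hr).
  by apply/funext => y /=; rewrite (@indicM_patch _ _ A f (@complex.Re R))// !patchE; case: ifP.
rewrite (_ : _ \o _ = (EFin \o (fun y => complex.Im (f y))) \_ A); first exact: ((integrable_mkcond _ mA).1 hi).
by apply/funext => y /=; rewrite (@indicM_patch _ _ A f (@complex.Im R))// !patchE; case: ifP.
Qed.

Lemma lp_sum_cst_le (rho eta : R) N : 2 <= rho -> 0 <= eta ->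
  lp_sum rho (index_enum 'I_N) (fun=> eta) <= N%:R * eta.
Proof.
move=> rho2 eta0; apply: lp_sum_le_l2 => //; first exact: mulr_ge0.
rewrite sumr_const card_ord -[leLHS]mulr_natl exprMn ler_wpM2r ?sqr_ge0//.
by rewrite -natrX ler_nat; case: N => // N; rewrite expnS leq_pmulr// expn_gt0.
Qed.

Variables (K : Rd -> Rd -> C) (om : R -> R) (W cK : R).
Hypothesis omW : dini_bound om W.
Hypothesis stdK : std_kernel K om cK.
Variables (a : Rd) (l : R) (rho : R).
Hypothesis l0 : 0 < l.
Hypothesis rho2 : 2 < rho.
Local Notation nice := (nice a l).

(* The difference of the two annular integrals is at most the oscillation of the kernel over the
   cube plus the mass in shells of width [2 del] around the two radii. *)
Lemma ann_op_cont_bound f x x' r1 r2 (M e1 del : R) : nice f -> (forall y, cmod (f y) <= M) ->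
  0 < r1 -> r1 <= r2 -> 0 < del -> 2 * del <= r1 / 2 -> dist x x' <= del ->
  0 <= e1 -> om (del / r1) <= e1 ->
  cmod (ann_op K f x r1 r2 - ann_op K f x' r1 r2) <=
  2 * (cK * e1 * (r1 ^+ d)^-1 * M * l ^+ d +
       cK * (r1 ^+ d)^-1 * M * (4 ^+ d * d%:R * (2 * del) * (r1 ^+ d / r1 + r2 ^+ d / r2))).
Proof.
move=> nf hM r10 r12 del0 delr xx' e10 ome; have [cK0 _ Kb Kd] := stdK.
have [omh om0 _ _ _] := omW; have [mf _ fQ] := nf.
have M0 : 0 <= M by apply: le_trans (hM a); exact: cmod_ge0.
have r20 : 0 < r2 by exact: lt_le_trans r12.
pose A (z : Rd) := annulus z r1 r2.
have mA z : measurable (A z) by exact: measurable_annulus.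
pose F z y := (\1_(A z) y : C) * (K z y * f y).
have mF z : cmeasurable (F z).
  by apply: cmeasurableM; [exact: cmeasurable_indic|exact: (cmeasurable_kernelM omW stdK _ nf)].
have EF z : ann_op K f z r1 r2 = cint setT (F z) by rewrite /F cint_indic setTI.
have iF z : cintegrable setT (F z).
  by apply: cintegrable_mkcond => //; exact: (cintegrable_annulus omW stdK l0 z r2 nf r10).
rewrite !EF -cintB//; apply: cmod_cint_le => //; first exact: cmeasurableB.
pose S r := eshell x (r - 2 * del) (r + 2 * del).
have mS r : measurable (S r) by exact: measurable_eshell.
pose L := cK * (r1 ^+ d)^-1 * M.
have L0 : 0 <= L by rewrite !mulr_ge0// invr_ge0 exprn_ge0// ltW.
pose c1 := cK * e1 * (r1 ^+ d)^-1 * M.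
have c10 : 0 <= c1 by rewrite !mulr_ge0// invr_ge0 exprn_ge0// ltW.
have mQ := @measurable_cube R d a l.
apply: (@le_trans _ _ (\int[leb]_y (c1 * \1_(cube a l) y + L * \1_(S r1) y + L * \1_(S r2) y)%:E)%E); last first.
  rewrite integral_cindic3//.
  have -> : (c1 * l ^+ d + L * (4 ^+ d * d%:R * (2 * del) * (r1 ^+ d / r1 + r2 ^+ d / r2)))%:E =
     (c1%:E * (l ^+ d)%:E + L%:E * (4 ^+ d * d%:R * (2 * del) * r1 ^+ d / r1)%:E + L%:E * (4 ^+ d * d%:R * (2 * del) * r2 ^+ d / r2)%:E)%E.
    by rewrite -!EFinM -!EFinD; congr EFin; ring.
  have d20 : 0 < 2 * del by lra.
  apply: leeD; first apply: leeD.
  - by have /= -> := lebesgue_nd_cube a (ltW l0).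
  - by apply: lee_wpmul2l; [rewrite lee_fin|apply: lebesgue_eshell_le].
  - by apply: lee_wpmul2l; [rewrite lee_fin|apply: lebesgue_eshell_le => //; lra].
apply: ge0_le_integral_real => //.
- by apply: cmeasurable_cmod; exact: cmeasurableB.
- by apply: measurable_funD; [apply: measurable_funD|]; apply: measurable_funM => //; exact: measurable_indic.
move=> y _; rewrite cmod_ge0/=.
have invd (r : R) : r1 <= r -> (r ^+ d)^-1 <= (r1 ^+ d)^-1.
  move=> h; rewrite lef_pV2 ?posrE ?exprn_gt0//; last exact: lt_le_trans h.
  by apply: lerXn2r => //; rewrite nnegrE ltW//; exact: lt_le_trans h.
have Aneq z : A z y -> z != y.
  by move=> /andP[h _]; apply: contraTneq h => ->; rewrite distxx -leNgt ltW.
have KL z : A z y -> cmod (K z y * f y) <= L.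
  move=> Azy; rewrite cmodM; apply: ler_pM; rewrite ?cmod_ge0//.
  apply: le_trans (Kb _ _ (Aneq _ Azy)) _; apply: ler_wpM2l => //; apply: invd.
  by case/andP: Azy => /ltW.
have ge1 : 0 <= c1 * \1_(cube a l) y by rewrite mulr_ge0.
have ge2 r : 0 <= L * \1_(S r) y by rewrite mulr_ge0.
have Sin r : S r y -> L * \1_(S r) y = L by move=> h; rewrite indicE mem_set// mulr1.
have in1 z : A z y -> (\1_(A z) y : C) = 1 by move=> h; rewrite indicE mem_set.
have in0 z : ~ A z y -> (\1_(A z) y : C) = 0 by move=> h; rewrite indicE memNset.
have t1 : dist x y <= dist x' y + del.
  by apply: le_trans (dist_triangle x' _ _) _; rewrite addrC lerD2l.
have t2 : dist x' y <= dist x y + del.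
  by apply: le_trans (dist_triangle x _ _) _; rewrite addrC lerD2l distC.
have fin z : A z y -> S r1 y \/ S r2 y ->
    cmod (K z y * f y) <= c1 * \1_(cube a l) y + L * \1_(S r1) y + L * \1_(S r2) y.
  move=> Azy [h|h]; apply: le_trans (KL _ Azy) _; rewrite (Sin _ h).
    by rewrite addrAC lerDr addr_ge0.
  by rewrite lerDr addr_ge0.
(* If [y] is in both annuli, smoothness of the kernel applies. If it is in exactly one, it lies
   within [2 * del] of one of the two spheres, and the size of the kernel is enough. *)
rewrite /F; have [Ay|Ay] := pselect (A x y); have [Ay'|Ay'] := pselect (A x' y).
- rewrite !in1// !mul1r -mulrBl cmodM; rewrite -addrA; apply: le_trans (_ : _ <= c1 * \1_(cube a l) y) _; last first.
    by rewrite lerDl addr_ge0.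
  have [Qy|Qy] := pselect (cube a l y); last by rewrite fQ// cmod0 mulr0.
  rewrite indicE mem_set// mulr1; apply: ler_pM; rewrite ?cmod_ge0//.
  have /andP[Dr1 _] := Ay.
  have Dxy : dist x x' <= dist x y / 2 by lra.
  apply: le_trans (_ : _ <= cK * (om (dist x x' / dist x y) / dist x y ^+ d)) _.
    by apply: le_trans (Kd x x' y (Aneq _ Ay) Dxy); rewrite lerDl cmod_ge0.
  rewrite -mulrA; apply: ler_wpM2l => //; apply: ler_pM => //.
  + by rewrite invr_ge0 exprn_ge0// dist_ge0.
  + apply: le_trans ome; apply: omh; apply: ler_pM => //; rewrite ?dist_ge0// ?invr_ge0 ?dist_ge0//.
    by rewrite lef_pV2 ?posrE//; [exact: ltW|exact: lt_trans Dr1].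
  + by apply: invd; exact: ltW.
- rewrite in1// in0// mul1r mul0r subr0; apply: fin => //.
  move: Ay => /andP[h1 h2]; have [h3|h3] := leP (dist x' y) r1.
    by left; rewrite /S /eshell /=; apply/andP; split; lra.
  right; rewrite /S /eshell /=; have h4 : r2 < dist x' y.
    by rewrite ltNge; apply/negP => h4; apply: Ay'; apply/andP.
  by apply/andP; split; lra.
- rewrite in0// in1// mul1r mul0r sub0r cmodN; apply: fin => //.
  move: Ay' => /andP[h1 h2]; have [h3|h3] := leP (dist x y) r1.
    by left; rewrite /S /eshell /=; apply/andP; split; lra.
  right; rewrite /S /eshell /=; have h4 : r2 < dist x y.
    by rewrite ltNge; apply/negP => h4; apply: Ay; apply/andP.
  by apply/andP; split; lra.
- by rewrite !in0// !mul0r subr0 cmod0 !addr_ge0.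
Qed.

Lemma ann_op_cont f x r1 r2 : nice f -> 0 < r1 -> r1 <= r2 -> forall e : R, 0 < e ->
  exists2 del, 0 < del & forall x', dist x x' <= del ->
    cmod (ann_op K f x r1 r2 - ann_op K f x' r1 r2) <= e.
Proof.
move=> nf r10 r12 e e0; have [mf [M hM] _] := nf; have [cK0 _ _ _] := stdK.
have M0 : 0 <= M by apply: le_trans (hM a); exact: cmod_ge0.
have r20 : 0 < r2 by exact: lt_le_trans r12.
pose c1 := cK * (r1 ^+ d)^-1 * M * l ^+ d.
pose c2 := cK * (r1 ^+ d)^-1 * M * (4 ^+ d * d%:R * 2 * (r1 ^+ d / r1 + r2 ^+ d / r2)).
have c10 : 0 <= c1 by rewrite !mulr_ge0// ?invr_ge0 ?exprn_ge0// ltW.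
have c20 : 0 <= c2.
  by rewrite !mulr_ge0// ?invr_ge0 ?exprn_ge0// ?addr_ge0// ?divr_ge0// ?exprn_ge0// ltW.
have e10 : 0 < e / 4 / (c1 + 1) by rewrite !divr_gt0// ltr_wpDl.
have [t t0 ht] := dini_bound_small omW e10.
(* The three constraints make [om] small, ensure [2 * del <= r1 / 2], and make the shells thin. *)
pose del := Num.min (Num.min (t * r1) (r1 / 4)) (e / 4 / (c2 + 1)).
have del0 : 0 < del.
  by rewrite !lt_min mulr_gt0//= !divr_gt0// ltr_wpDl.
exists del => // x' xx'.
have /andP[/andP[d1 d2] d3] : (del <= t * r1) && (del <= r1 / 4) && (del <= e / 4 / (c2 + 1)).
  by rewrite /del !ge_min !lexx !orbT.
have ome : om (del / r1) <= e / 4 / (c1 + 1) by apply: ht; rewrite ler_pdivrMr.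
have delr : 2 * del <= r1 / 2 by lra.
apply: le_trans (ann_op_cont_bound nf hM r10 r12 del0 delr xx' (ltW e10) ome) _.
have -> : cK * (e / 4 / (c1 + 1)) * (r1 ^+ d)^-1 * M * l ^+ d = e / 4 * (c1 / (c1 + 1)).
  by rewrite /c1; ring.
have -> : cK * (r1 ^+ d)^-1 * M * (4 ^+ d * d%:R * (2 * del) * (r1 ^+ d / r1 + r2 ^+ d / r2)) = c2 * del.
  by rewrite /c2; ring.
have h1 : e / 4 * (c1 / (c1 + 1)) <= e / 4.
  by rewrite ler_piMr ?divr_ge0 ?(ltW e0)// ler_pdivrMr ?ltr_wpDl// mul1r lerDl.
have h2 : c2 * del <= e / 4.
  apply: (@le_trans _ _ (c2 * (e / 4 / (c2 + 1)))); first exact: ler_wpM2l.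
  by rewrite mulrA ler_pdivrMr ?ltr_wpDl// [leLHS]mulrC ler_wpM2l ?divr_ge0 ?(ltW e0)// lerDl.
lra.
Qed.

Lemma jump_cont f x (e : nat -> R) N : nice f -> zero_seq e -> forall eta, 0 < eta ->
  exists2 del, 0 < del & forall x' (i : 'I_N), dist x x' <= del ->
    jump K f x e i <= jump K f x' e i + eta.
Proof.
move=> nf ze eta eta0.
suff [del del0 hdel] : exists2 del, 0 < del & forall x' i, (i < N)%N -> dist x x' <= del ->
    jump K f x e i <= jump K f x' e i + eta.
  by exists del => // x' i; exact: hdel.
elim: N => [|N [del del0 IH]]; first by exists 1.
have [edec _] := ze.
have [t t0 ht] := ann_op_cont x nf (zero_seq_gt0 N.+1 ze) (ltW (edec N)) eta0.
exists (Num.min del t) => [|x' i]; first by rewrite lt_min del0.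
rewrite ltnS leq_eqVlt le_min => /orP[/eqP -> /andP[_ h]|iN /andP[h _]]; last exact: IH.
have := ht _ h; rewrite /jump => h'.
set u := ann_op _ _ x _ _ in h' *; set v := ann_op _ _ x' _ _ in h' *.
have -> : u = v + (u - v) by rewrite addrC subrK.
by apply: le_trans (cmodD _ _) _; rewrite lerD2l.
Qed.

(* [var_op] is a supremum of continuous functions, so its superlevel sets are open. *)
Lemma measurable_var_op f : nice f -> measurable_fun setT (var_op K rho f).
Proof.
move=> nf; apply: (measurability _ (ErealGenOInfty.measurableE R)) => // _ [_ [t ->] <-].
rewrite setTI (_ : _ @^-1` _ = [set x | (t%:E < var_op K rho f x)%E]); last first.
  by apply/seteqP; split => x /=; rewrite in_itv/= andbT.
have [t0|t0] := ltP t 0.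
  rewrite (_ : [set x | _] = setT)//; apply/seteqP; split => // x _ /=.
  by apply: lt_le_trans (var_op_ge0 K rho f x); rewrite lte_fin.
apply: dist_open_measurable => x /= tV.
have : exists e N, zero_seq e /\ t < lp_sum rho (index_enum 'I_N) (fun i => jump K f x e i).
  apply: contrapT => h; move: tV; rewrite ltNge => /negP; apply.
  apply/(var_op_leP omW stdK l0 rho2 x nf t0) => e N ze; rewrite leNgt; apply/negP => h'.
  by apply: h; exists e, N.
move=> [e [N [ze hN]]].
set S := lp_sum _ _ _ in hN.
(* Small enough that [N] changes by [eta] cost at most half of the gap [S - t]. *)
pose eta := (S - t) / 2 / (N%:R + 1).
have eta0 : 0 < eta by rewrite !divr_gt0// ?subr_gt0// ltr_wpDl.
have [del del0 hdel] := @jump_cont f x e N nf ze _ eta0.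
exists del; [exact: del0|move=> x' xx'].
rewrite ltNge; apply/negP => hV.
have := (var_op_leP omW stdK l0 rho2 x' nf t0).1 hV e N ze => h1.
have h2 : S <= lp_sum rho (index_enum 'I_N) (fun i => jump K f x' e i) + N%:R * eta.
  apply: (@le_trans _ _ (lp_sum rho (index_enum 'I_N) (fun i => jump K f x' e i + eta))).
    apply: le_lp_sum; first exact: lt_trans rho2.
    by move=> i; rewrite cmod_ge0/=; exact: hdel.
  apply: le_trans (minkowski_sum _ _ _ _) _.
  - by apply: ltW; apply: lt_trans rho2; rewrite ltr1n.
  - by move=> i; exact: cmod_ge0.
  - by move=> i; exact: ltW.
  by rewrite lerD2l; apply: lp_sum_cst_le; exact: ltW.
have h3 : N%:R * eta <= (S - t) / 2.
  rewrite /eta mulrA ler_pdivrMr ?ltr_wpDl// [leLHS]mulrC ler_wpM2l ?lerDl//.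
  by rewrite divr_ge0// subr_ge0 ltW.
lra.
Qed.

End var_measurable.

(** * Square-sum criteria and limits for the variation *)

Section var_limits.
Context {R : realType} {d : nat}.
Local Notation leb := (@lebesgue_nd R d).
Local Notation C := (complex R).
Local Notation Rd := (d.-tuple R).
Implicit Types (x y : Rd) (f g h : Rd -> C) (e : nat -> R).

Variables (K : Rd -> Rd -> C) (om : R -> R) (W cK : R).
Hypothesis omW : dini_bound om W.
Hypothesis stdK : std_kernel K om cK.
Variables (a : Rd) (l : R) (rho : R).
Hypothesis l0 : 0 < l.
Hypothesis rho2 : 2 < rho.
Local Notation nice := (nice a l).
Let rho0 : 0 < rho. Proof. exact: lt_trans rho2. Qed.
Let rho1 : 1 <= rho. Proof. by apply: ltW; apply: lt_trans rho2; rewrite ltr1n. Qed.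

(** The kernel is at most [cK * (r1 ^+ d)^-1] on the annulus. This makes the contribution of all but
    finitely many pieces negligible for fixed radii. *)
Lemma ann_op_small h x r1 r2 (A : set Rd) (B m : R) : nice h -> 0 < r1 ->
  (forall y, cmod (h y) <= B) -> (forall y, ~ A y -> h y = 0) -> measurable A ->
  (leb A <= m%:E)%E ->
  cmod (ann_op K h x r1 r2) <= 2 * (cK * (r1 ^+ d)^-1 * B * m).
Proof.
move=> nh r10 hB hA mA Am; have [cK0 _ Kb _] := stdK.
have B0 : 0 <= B by apply: le_trans (hB a); exact: cmod_ge0.
have mphi := cmeasurable_kernelM omW stdK x nh.
have L0 : 0 <= cK * (r1 ^+ d)^-1 * B by rewrite !mulr_ge0// invr_ge0 exprn_ge0// ltW.
have mann := measurable_annulus x r1 r2.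
apply: cmod_cint_le => //; rewrite EFinM.
apply: (@le_trans _ _ ((cK * (r1 ^+ d)^-1 * B)%:E * leb A)%E); last first.
  by apply: lee_wpmul2l.
rewrite -integral_cindic//.
have mi : measurable_fun [set: Rd] (fun y => cK / r1 ^+ d * B * \1_A y : R).
  by apply: measurable_funM => //; exact: measurable_indic.
have := @ge0_subset_integral_real _ _ _ leb (annulus x r1 r2) setT _ mann measurableT mi.
move=> /(_ _ _)/(le_trans _) ; apply => //; last by move=> y _; rewrite mulr_ge0.
apply: ge0_le_integral_real => //; first exact: cmeasurable_cmod.
move=> y /andP[ry _]; rewrite cmod_ge0/= indicE.
have [Ay|Ay] := pselect (A y); last by rewrite hA// mulr0 cmod0 memNset// mulr0.
rewrite mem_set// mulr1 cmodM; apply: ler_pM; rewrite ?cmod_ge0//.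
have xy : x != y by apply: contraTneq ry => ->; rewrite distxx -leNgt ltW.
apply: le_trans (Kb _ _ xy) _; apply: ler_wpM2l => //.
have D0 : 0 < dist x y by exact: lt_trans ry.
by rewrite lef_pV2 ?posrE ?exprn_gt0//; apply: lerXn2r; rewrite ?nnegrE ltW.
Qed.

(** Minkowski splits the jumps at [x'] into those at [x] and the differences; the latter are
    controlled by their square sum. *)
Lemma var_op_shift f x x' (B : R) : nice f -> 0 <= B ->
  (forall e N, zero_seq e ->
    \sum_(i < N) cmod (ann_op K f x (e i.+1) (e i) - ann_op K f x' (e i.+1) (e i)) ^+ 2 <= B ^+ 2) ->
  (var_op K rho f x' <= var_op K rho f x + B%:E)%E.
Proof.
move=> nf B0 hB.
have := var_op_ge0 K rho f x; case E : (var_op K rho f x) => [v| |]// v0; last by rewrite leey.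
rewrite lee_fin in v0; apply/(var_op_leP omW stdK l0 rho2 x' nf); first exact: addr_ge0.
move=> e N ze; pose D (i : 'I_N) := cmod (ann_op K f x (e i.+1) (e i) - ann_op K f x' (e i.+1) (e i)).
apply: (@le_trans _ _ (lp_sum rho (index_enum 'I_N) (fun i => jump K f x e i + D i))).
  apply: le_lp_sum => // i; rewrite cmod_ge0/= /jump /D.
  set u := ann_op _ _ x' _ _; set v' := ann_op _ _ x _ _.
  rewrite [X in cmod X <= _](_ : u = v' + (u - v')); last by rewrite addrC subrK.
  by apply: le_trans (cmodD _ _) _; rewrite lerD2l cmod_distrC.
apply: le_trans (minkowski_sum _ rho1 _ _) _.
- by move=> i; exact: cmod_ge0.
- by move=> i; exact: cmod_ge0.
apply: lerD.
  by apply: (var_op_leP omW stdK l0 rho2 x nf v0).1; rewrite ?E.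
apply: lp_sum_le_l2 => //; first exact: ltW.
  by move=> i; exact: cmod_ge0.
exact: hB.
Qed.

Lemma var_op_le_square f x (B : R) : nice f -> 0 <= B ->
  (forall e N, zero_seq e -> \sum_(i < N) cmod (ann_op K f x (e i.+1) (e i)) ^+ 2 <= B ^+ 2) ->
  (var_op K rho f x <= B%:E)%E.
Proof.
move=> nf B0 hB; apply/(var_op_leP omW stdK l0 rho2 x nf) => // e N ze.
apply: lp_sum_le_l2 => //; first exact: ltW.
  by move=> i; exact: cmod_ge0.
exact: hB.
Qed.

(** Lower semicontinuity: exceeding [B] takes finitely many jumps, and each of these converges. *)
Lemma var_op_lim f (f_ : nat -> Rd -> C) x (B : R) : nice f -> (forall n, nice (f_ n)) -> 0 <= B ->
  (forall r1 r2 (eta : R), 0 < r1 -> 0 < eta -> exists n0, forall n, (n0 <= n)%N ->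
     cmod (ann_op K f x r1 r2 - ann_op K (f_ n) x r1 r2) <= eta) ->
  (forall n, var_op K rho (f_ n) x <= B%:E)%E -> (var_op K rho f x <= B%:E)%E.
Proof.
move=> nf nf_ B0 lim hB; apply/(var_op_leP omW stdK l0 rho2 x nf) => // e N ze.
apply/ler_addgt0Pr => t t0.
pose eta := t / (N%:R + 1).
have eta0 : 0 < eta by rewrite !divr_gt0// ltr_wpDl.
have [n hn] : exists n0, forall n, (n0 <= n)%N -> forall i, (i < N)%N -> jump K f x e i <= jump K (f_ n) x e i + eta.
  elim: (N) => [|k [n0 IH]]; first by exists 0%N.
  have [n1 hn1] := lim (e k.+1) (e k) eta (zero_seq_gt0 _ ze) eta0.
  exists (maxn n0 n1) => n; rewrite geq_max => /andP[h0 h1] i; rewrite ltnS leq_eqVlt => /orP[/eqP ->|ik].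
    have := hn1 n h1; rewrite /jump; set u := ann_op _ _ _ _ _; set v := ann_op _ _ _ _ _ => h.
    have -> : u = v + (u - v) by rewrite addrC subrK.
    by apply: le_trans (cmodD _ _) _; rewrite lerD2l.
  exact: IH.
have h1 := (var_op_leP omW stdK l0 rho2 x (nf_ n) B0).1 (hB n) e N ze.
apply: (@le_trans _ _ (lp_sum rho (index_enum 'I_N) (fun i => jump K (f_ n) x e i + eta))).
  apply: le_lp_sum => // i; rewrite cmod_ge0/=; exact: hn.
apply: le_trans (minkowski_sum _ rho1 _ _) _.
- by move=> i; exact: cmod_ge0.
- by move=> i; exact: ltW.
apply: lerD => //; apply: le_trans (lp_sum_cst_le _ (ltW rho2) (ltW eta0)) _.
by rewrite /eta mulrA ler_pdivrMr ?ltr_wpDl// [leLHS]mulrC ler_wpM2l ?lerDl// ltW.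
Qed.

End var_limits.

(** * Distribution of the variation of a bounded function *)

Section var_weak.
Context {R : realType} {d : nat}.
Local Notation leb := (@lebesgue_nd R d).
Local Notation C := (complex R).
Local Notation Rd := (d.-tuple R).
Variables (K : Rd -> Rd -> C) (om : R -> R) (W cK rho : R).
Hypothesis omW : dini_bound om W.
Hypothesis stdK : std_kernel K om cK.
Hypothesis rho2 : 2 < rho.

(** Chebyshev. The constant [A2] is chosen from [del] before the cube and the function, so that it
    may enter the final constant. *)
Lemma var_op_weak (q : R) : 1 < q -> var_Lq_bounded K rho q -> forall del : R, 0 < del ->
  exists2 A2 : R, 0 < A2 & forall (a : Rd) (l : R), 0 < l -> forall (f : Rd -> C) (A : set Rd) (M : R),
    nice a l f -> measurable A -> 0 < M ->
    (forall y, cmod (f y) <= M) -> (forall y, ~ A y -> f y = 0) ->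
    (leb [set x | ((A2 * M)%:E < var_op K rho f x)%E] <= del%:E * leb A)%E.
Proof.
move=> q1 [c hc] del del0.
have q0 : 0 < q by exact: lt_trans q1.
(* The quotient is what Chebyshev requires; the absolute value replaces a constant of unknown sign,
   and the added 1 keeps [A2] positive. *)
pose A2 := `|c| / del `^ q^-1 + 1.
have dq0 : 0 < del `^ q^-1 by exact: powR_gt0.
have A20 : 0 < A2 by rewrite ltr_wpDl// divr_ge0// ltW.
exists A2 => // a l l0 f A M nf mA M0 fM fA; have [mf _ fQ] := nf.
set t := A2 * M; have t0 : 0 < t by rewrite mulr_gt0.
have tq0 : 0 < t `^ q by exact: powR_gt0.
have mV := measurable_var_op omW stdK l0 rho2 nf.
have mcf := cmeasurable_cmod mf.
have mfq : measurable_fun setT (fun x => cmod (f x) `^ q).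
  by apply: (measurableT_comp (@measurable_powR R q)).
(* Applied to the cube to place [f] in [L^q], and to [A] for the estimate itself. *)
have bnd (A' : set Rd) : measurable A' -> (forall y, ~ A' y -> f y = 0) ->
    (\int[leb]_x (cmod (f x) `^ q)%:E <= (M `^ q)%:E * leb A')%E.
  move=> mA' fA'; rewrite -integral_cindic ?powR_ge0//.
  apply: ge0_le_integral_real => //.
    by apply: measurable_funM => //; exact: measurable_indic.
  move=> y _; rewrite powR_ge0/= indicE; have [Ay|Ay] := pselect (A' y).
    rewrite mem_set// mulr1; apply: ge0_ler_powR; rewrite ?nnegrE ?cmod_ge0//; exact: ltW.
  by rewrite fA'// cmod0 memNset// mulr0 powR0// gt_eqF.
have lpf : Lp_fun q f.
  split => //; have mQ := @measurable_cube R d a l.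
  apply: le_lt_trans (bnd _ mQ fQ) _.
  by have /= -> := lebesgue_nd_cube a (ltW l0); rewrite -EFinM ltry.
have := hc f lpf; rewrite /Lpnorm.
set X := (\int[leb]_x (`|var_op K rho f x| `^ q))%E.
have -> : (\int[leb]_x `|(cmod (f x))%:E| `^ q = \int[leb]_x (cmod (f x) `^ q)%:E)%E.
  by apply: eq_integral => y _; rewrite gee0_abs ?lee_fin ?cmod_ge0.
set Y := (\int[leb]_x (cmod (f x) `^ q)%:E)%E => hXY.
have X0 : (0 <= X)%E by apply: integral_ge0 => y _; exact: poweR_ge0.
have Y0 : (0 <= Y)%E by apply: integral_ge0 => y _; rewrite lee_fin powR_ge0.
have memp (z : \bar R) : (0 <= z)%E -> z \in `[0%E, +oo%E] by rewrite in_itv/= leey andbT.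
have XY : (X <= (`|c| `^ q)%:E * Y)%E.
  have h : (X `^ q^-1 <= `|c|%:E * Y `^ q^-1)%E.
    by apply: le_trans hXY _; apply: lee_wpmul2r; rewrite ?poweR_ge0// lee_fin ler_norm.
  have h0 : (0 <= `|c|%:E * Y `^ q^-1)%E by rewrite mule_ge0 ?lee_fin// poweR_ge0.
  have := gt0_ler_poweR (ltW q0) (memp _ (poweR_ge0 _ _)) (memp _ h0) h.
  rewrite poweRM ?poweR_ge0 ?lee_fin// -!poweRrM mulVf ?gt_eqF// !poweRe1//.
pose S := [set x | (t%:E < var_op K rho f x)%E].
have mS : measurable S.
  by have := emeasurable_fun_o_infty measurableT mV t%:E; rewrite setTI.
have SX : ((t `^ q)%:E * leb S <= X)%E.
  rewrite -integral_cindic ?powR_ge0//; apply: ge0_le_integral => //.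
  - by move=> y _; rewrite lee_fin mulr_ge0// powR_ge0.
  - by apply/measurable_EFinP; apply: measurable_funM => //; exact: measurable_indic.
  - apply: (measurableT_comp (measurable_poweR q)).
    exact: (measurableT_comp (@abse_measurable R setT)).
  move=> y _; rewrite indicE; have [Sy|Sy] := pselect (S y); last first.
    by rewrite memNset// mulr0 poweR_ge0.
  rewrite mem_set// mulr1 -poweR_EFin.
  apply: gt0_ler_poweR; [exact: ltW|apply: memp; exact: ltW|apply: memp; exact: abse_ge0|].
  by rewrite gee0_abs ?var_op_ge0//; exact: ltW.
rewrite -/S.
have : ((t `^ q)%:E * leb S <= (t `^ q)%:E * (del%:E * leb A))%E.
  apply: le_trans SX _; apply: le_trans XY _.
  apply: (@le_trans _ _ ((`|c| `^ q)%:E * ((M `^ q)%:E * leb A))%E).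
    by apply: lee_wpmul2l; [rewrite lee_fin powR_ge0|exact: bnd].
  rewrite !muleA -!EFinM; apply: lee_wpmul2r => //; rewrite lee_fin.
  have -> : t `^ q = A2 `^ q * M `^ q by rewrite /t powRM// ltW.
  rewrite mulrAC; apply: ler_wpM2r; first exact: powR_ge0.
  have -> : del = (del `^ q^-1) `^ q by rewrite -powRrM mulVf ?gt_eqF// powRr1// ltW.
  rewrite -powRM; [|exact: ltW|exact: powR_ge0].
  apply: ge0_ler_powR; rewrite ?nnegrE ?(ltW q0)//.
    by rewrite mulr_ge0// ltW.
  by rewrite /A2 mulrDl mul1r divfK ?gt_eqF// lerDl ltW.
by rewrite lee_pmul2l// fin_numE.
Qed.
End var_weak.

(** * Sums over separated cubes *)

Section far_pieces.
Context {R : realType} {d : nat}.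
Local Notation leb := (@lebesgue_nd R d).
Local Notation C := (complex R).
Local Notation Rd := (d.-tuple R).
Implicit Types (x y : Rd) (f g h : Rd -> C) (e : nat -> R).

Lemma cint1_cube (c : Rd) (s : R) : 0 <= s ->
  cint (cube c s) (fun=> 1) = Complex (s ^+ d) 0 :> C.
Proof.
move=> s0; have mc := @measurable_cube R d c s; rewrite /cint; congr Complex.
  by rewrite /= integral_cst// mul1e; have /= -> := lebesgue_nd_cube c s0.
by rewrite /= integral_cst// mul0e.
Qed.

Hypothesis d0 : (0 < d)%N.
Variables (K : Rd -> Rd -> C) (om : R -> R) (W cK : R).
Hypothesis omW : dini_bound om W.
Hypothesis stdK : std_kernel K om cK.
Variables (a : Rd) (l : R).
Hypothesis l0 : 0 < l.
Local Notation nice := (nice a l).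
Variables (I : finType) (P : pred I) (c : I -> Rd) (s : I -> R).
Hypothesis s0 : forall j, P j -> 0 < s j.
Hypothesis disj : forall j j', P j -> P j' -> j != j' ->
  cube (c j) (s j) `&` cube (c j') (s j') = set0.

(* A dyadic cube of larger side [s] meeting the triple of a cube [Q] has its corner within [2 d s] of
   every point of [Q]; [1 + 2 d] excludes this. *)
Definition sep_ratio (n : nat) : R := 1 + 2 * n%:R.

Let kap := sep_ratio d.
Let d1 : 1 <= d%:R :> R. Proof. by rewrite ler1n. Qed.
Let kap2 : 2 <= kap. Proof. by rewrite /kap /sep_ratio; have := d1; lra. Qed.
Let kap0 : 0 < kap. Proof. exact: lt_le_trans kap2. Qed.

Definition square_bound (n : nat) (M H : R) : R :=
  12 * (4 * M) ^+ 2 * (2 ^+ n * (4 ^+ n * n%:R * (6 * n%:R)) * H + H ^+ 2).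

(** On the cube the kernel is at most [cK * (kap / D) ^+ d]. The factor 2 is slack here, so that the
    same constant serves for far cubes, where [cmod_cint_le] costs it. *)
Lemma kernel_piece_bound f x (M D : R) j : nice f -> 0 <= M -> P j -> 0 < D ->
  (\int[leb]_(y in cube (c j) (s j)) (cmod (f y))%:E <= (M * s j ^+ d)%:E)%E ->
  (forall y, cube (c j) (s j) y -> D <= kap * dist x y) ->
  (\int[leb]_(y in cube (c j) (s j)) (cmod (K x y * f y))%:E <=
    ((2 * (cK * kap ^+ d * M)) * (s j ^+ d * (D ^+ d)^-1))%:E)%E.
Proof.
move=> nf M0 Pj D0 fM sep; have [cK0 _ Kb _] := stdK; have [mf _ _] := nf.
have mc := @measurable_cube R d (c j) (s j).
have mcf := cmeasurable_cmod mf.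
pose L := cK * (kap ^+ d * (D ^+ d)^-1).
have kd0 : 0 <= kap ^+ d by rewrite exprn_ge0// ltW.
have Dd0 : 0 <= (D ^+ d)^-1 by rewrite invr_ge0 exprn_ge0// ltW.
have L0 : 0 <= L by rewrite !mulr_ge0.
apply: (@le_trans _ _ (\int[leb]_(y in cube (c j) (s j)) (L * cmod (f y))%:E)%E).
  apply: ge0_le_integral_real => //.
  - exact: cmeasurable_cmod (cmeasurable_kernelM omW stdK x nf).
  - exact: measurable_funM.
  move=> y cy; rewrite cmod_ge0/= cmodM; apply: ler_wpM2r; first exact: cmod_ge0.
  have Dy := sep y cy; have dy0 : 0 < dist x y by rewrite -(pmulr_rgt0 _ kap0); exact: lt_le_trans Dy.
  have xy : x != y by apply: contraTneq dy0 => ->; rewrite distxx ltxx.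
  apply: le_trans (Kb _ _ xy) _; apply: ler_wpM2l => //.
  rewrite -[leRHS]invrK invf_div -expr_div_n lef_pV2 ?posrE ?exprn_gt0 ?divr_gt0//.
  apply: lerXn2r; rewrite ?nnegrE ?dist_ge0//; first by rewrite divr_ge0// ltW.
  by rewrite ler_pdivrMr// mulrC.
under eq_integral do rewrite EFinM.
rewrite ge0_integralZl//; last 2 first.
- by apply/measurable_EFinP; exact: measurable_funTS.
- by move=> y _; rewrite lee_fin cmod_ge0.
apply: (@le_trans _ _ (L%:E * (M * s j ^+ d)%:E)%E); first by apply: lee_wpmul2l.
rewrite -EFinM lee_fin; have -> : 2 * (cK * kap ^+ d * M) * (s j ^+ d * (D ^+ d)^-1) = 2 * (L * (M * s j ^+ d)).
  by rewrite /L; ring.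
rewrite ler_peMl ?ler1n//; rewrite !mulr_ge0// exprn_ge0// ltW// s0//.
Qed.

Lemma far_half_dist x j y : P j -> far_ratio d * s j <= dist x (c j) -> cube (c j) (s j) y ->
  dist (c j) y <= dist x (c j) / 12 /\ dist x (c j) / 2 <= dist x y.
Proof.
move=> Pj far cy; have := cube_dist_le cy; have := dist_triangle y x (c j).
rewrite [dist y _]distC /far_ratio in far *; set t := d%:R * s j => h1 h2.
have D0 := dist_ge0 x (c j).
have E : 12 * d%:R * s j = 12 * t by rewrite /t mulrA.
by rewrite E in far; split; lra.
Qed.

Lemma sum_annulus_pieces f x r1 r2 : nice f -> 0 < r1 ->
  (forall y, (forall j, P j -> ~ cube (c j) (s j) y) -> f y = 0) ->
  ann_op K f x r1 r2 = \sum_(j | P j) cint (annulus x r1 r2 `&` cube (c j) (s j)) (fun y => K x y * f y).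
Proof.
move=> nf r10 fP; apply: cint_pieces => //.
- exact: measurable_annulus.
- by move=> j _; exact: measurable_cube.
- exact: (cmeasurable_kernelM omW stdK x nf).
- exact: (cintegrable_annulus omW stdK l0 x r2 nf r10).
- by move=> y _ h; rewrite fP// mulr0.
Qed.

(** As [f] has mean zero on each piece, the kernel at the corner may be subtracted; smoothness in
    the second variable then gives the gain for far pieces. *)
Lemma bad_part_bound f x (M : R) e N : nice f -> 0 <= M ->
  (forall y, (forall j, P j -> ~ cube (c j) (s j) y) -> f y = 0) ->
  (forall j, P j -> \int[leb]_(y in cube (c j) (s j)) (cmod (f y))%:E <= (M * s j ^+ d)%:E)%E ->
  (forall j, P j -> cint (cube (c j) (s j)) f = 0) ->
  (forall j, P j -> 0 < dist x (c j)) ->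
  (forall j y, P j -> cube (c j) (s j) y -> dist x (c j) <= kap * dist x y) ->
  zero_seq e ->
  \sum_(i < N) cmod (ann_op K f x (e i.+1) (e i)) ^+ 2 <=
  square_bound d (2 * (cK * kap ^+ d * M)) (tail_sum P c s x om).
Proof.
move=> nf M0 fP fM f0 D0 sep ze; have [cK0 _ Kb Kd] := stdK; have [mf _ _] := nf.
have [omh om0 _ _ _] := omW; have [edec _] := ze.
have mphi := cmeasurable_kernelM omW stdK x nf.
have m0 : @cmeasurable R d (fun=> 0) by exact: cmeasurable_cst.
set M' := 2 * _.
have kd0 : 0 <= kap ^+ d by rewrite exprn_ge0// ltW.
have M'0 : 0 <= M' by rewrite !mulr_ge0.
have xx j : P j -> dist x x <= d%:R * s j by move=> Pj; rewrite distxx mulr_ge0// ltW// s0.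
have b1 j : P j -> (\int[leb]_(y in cube (c j) (s j)) (cmod (K x y * f y))%:E <=
    (M' * (s j ^+ d * (dist x (c j) ^+ d)^-1))%:E)%E.
  by move=> Pj; apply: kernel_piece_bound => //; [exact: D0|exact: fM|move=> y; exact: sep].
have b2 j : P j -> (\int[leb]_(y in cube (c j) (s j)) (cmod (0 : C))%:E <=
    (M' * (s j ^+ d * (dist x (c j) ^+ d)^-1))%:E)%E.
  move=> Pj; rewrite cmod0 integral0_eq// lee_fin.
  by have /ltW sj := s0 Pj; rewrite !mulr_ge0 ?invr_ge0 ?exprn_ge0 ?dist_ge0// ltW.
have := @annulus_estimate R d d0 I P c s s0 disj x x D0 xx om W omW
  (fun y => K x y * f y) (fun=> 0) M' M'0 mphi m0 b1 b2 _ e N (fun i => ltW (edec i)).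
rewrite -/(square_bound _ _ _) => /(_ _)/(le_trans _); apply; last first.
  move=> j Pj far; have Dj := D0 j Pj; set D := dist x (c j) in far Dj *.
  have mc := @measurable_cube R d (c j) (s j).
  have if0 : cintegrable (cube (c j) (s j)) f by exact: (cintegrable_nice l0 mc nf).
  have if1 : cintegrable (cube (c j) (s j)) (fun y => K x y * f y).
    by apply: cintegrable_lty => //; apply: le_lt_trans (b1 j Pj) _; exact: ltry.
  have if2 : cintegrable (cube (c j) (s j)) (fun y => K x (c j) * f y) by exact: cintegrableZ.
  rewrite cint0 subr0.
  have -> : cint (cube (c j) (s j)) (fun y => K x y * f y) =
      cint (cube (c j) (s j)) (fun y => K x y * f y - K x (c j) * f y).
    by rewrite cintB// cintZ// f0// mulr0 subr0.
  have -> : M' * (s j ^+ d * (om (far_ratio d * s j / D) * (D ^+ d)^-1)) =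
      2 * (cK * (om (far_ratio d * s j / D) * (D ^+ d)^-1) * kap ^+ d * (M * s j ^+ d)).
    by rewrite /M'; ring.
  have mz : cmeasurable (fun y => K x (c j) * f y) by apply: cmeasurableM => //; exact: cmeasurable_cst.
  apply: cmod_cint_le => //; first exact: cmeasurableB.
  set L := cK * _ * _.
  have L0 : 0 <= L.
    by rewrite !mulr_ge0// ?invr_ge0 ?exprn_ge0 ?(ltW Dj)// ltW.
  rewrite EFinM; apply: (@le_trans _ _ (L%:E * \int[leb]_(y in cube (c j) (s j)) (cmod (f y))%:E)%E); last first.
    by apply: lee_wpmul2l; [rewrite lee_fin|exact: fM].
  have mcf := cmeasurable_cmod mf.
  rewrite -ge0_integralZl//; last 2 first.
  - by apply/measurable_EFinP; exact: measurable_funTS.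
  - by move=> y _; rewrite lee_fin cmod_ge0.
  under [leRHS]eq_integral do rewrite -EFinM.
  apply: ge0_le_integral_real => //.
  - by apply: cmeasurable_cmod; exact: cmeasurableB.
  - exact: measurable_funM.
  move=> y cy; rewrite cmod_ge0/= -mulrBl cmodM; apply: ler_wpM2r; first exact: cmod_ge0.
  have [h1 h2] := far_half_dist Pj far cy; rewrite -/D in h1 h2.
  have cx : c j != x by apply: contraTneq Dj => h; rewrite /D h distxx ltxx.
  have dc : dist (c j) y <= dist (c j) x / 2 by rewrite [dist _ x]distC -/D; lra.
  rewrite cmod_distrC; apply: le_trans (_ : _ <= cK * (om (dist (c j) y / D) / D ^+ d)) _.
    by have := Kd _ _ _ cx dc; rewrite [dist (c j) x]distC; apply: le_trans; rewrite lerDr cmod_ge0.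
  rewrite /L -[leLHS]mulr1; apply: ler_pM => //.
  - by rewrite !mulr_ge0// invr_ge0 exprn_ge0// ltW.
  - apply: ler_wpM2l => //; apply: ler_wpM2r; first by rewrite invr_ge0 exprn_ge0// ltW.
    apply: omh; apply: ler_wpM2r; first by rewrite invr_ge0 ltW.
    apply: le_trans (cube_dist_le cy) _; apply: ler_wpM2r; first exact/ltW/s0.
    by rewrite /far_ratio; have := d1; lra.
  - by rewrite exprn_ege1//; have := kap2; lra.
apply: ler_sum => i _; rewrite le_eqVlt; apply/orP; left; apply/eqP; congr (cmod _ ^+ 2).
rewrite (sum_annulus_pieces _ _ nf (zero_seq_gt0 _ ze) fP); apply: eq_bigr => j _.
by rewrite cint0 subr0.
Qed.

(** Here [f] has no cancellation. The gain for far cubes is the smoothness of the kernel in the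
    first variable, the displacement from [x] to [x'] being within the scale of every cube. *)
Lemma good_part_bound f x x' (M : R) e N : nice f -> 0 <= M ->
  (forall y, cmod (f y) <= M) ->
  (forall y, (forall j, P j -> ~ cube (c j) (s j) y) -> f y = 0) ->
  (forall j, P j -> 0 < dist x (c j)) ->
  (forall j, P j -> dist x x' <= d%:R * s j) ->
  (forall j y, P j -> cube (c j) (s j) y -> dist x (c j) <= kap * dist x y) ->
  (forall j y, P j -> cube (c j) (s j) y -> dist x (c j) <= kap * dist x' y) ->
  zero_seq e ->
  \sum_(i < N) cmod (ann_op K f x (e i.+1) (e i) - ann_op K f x' (e i.+1) (e i)) ^+ 2 <=
  square_bound d (2 * (cK * kap ^+ d * M)) (tail_sum P c s x om).
Proof.
move=> nf M0 fM fP D0 xx' sep sep' ze; have [cK0 _ Kb Kd] := stdK; have [mf _ _] := nf.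
have [omh om0 _ _ _] := omW; have [edec _] := ze.
have mphi := cmeasurable_kernelM omW stdK x nf.
have mphi' := cmeasurable_kernelM omW stdK x' nf.
have mcf := cmeasurable_cmod mf.
set M' := 2 * _.
have kd0 : 0 <= kap ^+ d by rewrite exprn_ge0// ltW.
have M'0 : 0 <= M' by rewrite !mulr_ge0.
have intf j : P j -> (\int[leb]_(y in cube (c j) (s j)) (cmod (f y))%:E <= (M * s j ^+ d)%:E)%E.
  move=> Pj; have mc := @measurable_cube R d (c j) (s j).
  apply: (@le_trans _ _ (M%:E * leb (cube (c j) (s j)))%E).
    by apply: ge0_integral_le_cst => // y _; rewrite cmod_ge0/=.
  by have /= -> := lebesgue_nd_cube (c j) (ltW (s0 Pj)).
have b1 j : P j -> (\int[leb]_(y in cube (c j) (s j)) (cmod (K x y * f y))%:E <=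
    (M' * (s j ^+ d * (dist x (c j) ^+ d)^-1))%:E)%E.
  by move=> Pj; apply: kernel_piece_bound => //; [exact: D0|exact: intf|move=> y; exact: sep].
have b2 j : P j -> (\int[leb]_(y in cube (c j) (s j)) (cmod (K x' y * f y))%:E <=
    (M' * (s j ^+ d * (dist x (c j) ^+ d)^-1))%:E)%E.
  by move=> Pj; apply: kernel_piece_bound => //; [exact: D0|exact: intf|move=> y; exact: sep'].
have := @annulus_estimate R d d0 I P c s s0 disj x x' D0 xx' om W omW
  (fun y => K x y * f y) (fun y => K x' y * f y) M' M'0 mphi mphi' b1 b2 _ e N (fun i => ltW (edec i)).
rewrite -/(square_bound _ _ _) => /(_ _)/(le_trans _); apply; last first.
  move=> j Pj far; have Dj := D0 j Pj; have xxj := xx' j Pj; set D := dist x (c j) in far Dj *.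
  have mc := @measurable_cube R d (c j) (s j).
  have if1 : cintegrable (cube (c j) (s j)) (fun y => K x y * f y).
    by apply: cintegrable_lty => //; apply: le_lt_trans (b1 j Pj) _; exact: ltry.
  have if2 : cintegrable (cube (c j) (s j)) (fun y => K x' y * f y).
    by apply: cintegrable_lty => //; apply: le_lt_trans (b2 j Pj) _; exact: ltry.
  rewrite -cintB//.
  have -> : M' * (s j ^+ d * (om (far_ratio d * s j / D) * (D ^+ d)^-1)) =
      2 * (cK * (om (far_ratio d * s j / D) * (kap ^+ d * (D ^+ d)^-1)) * (M * s j ^+ d)).
    by rewrite /M'; ring.
  apply: cmod_cint_le => //; first exact: cmeasurableB.
  set L := cK * _.
  have L0 : 0 <= L.
    by rewrite !mulr_ge0// ?invr_ge0 ?exprn_ge0 ?(ltW Dj)// ltW.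
  rewrite EFinM; apply: (@le_trans _ _ (L%:E * \int[leb]_(y in cube (c j) (s j)) (cmod (f y))%:E)%E); last first.
    by apply: lee_wpmul2l; [rewrite lee_fin|exact: intf].
  rewrite -ge0_integralZl//; last 2 first.
  - by apply/measurable_EFinP; exact: measurable_funTS.
  - by move=> y _; rewrite lee_fin cmod_ge0.
  under [leRHS]eq_integral do rewrite -EFinM.
  apply: ge0_le_integral_real => //.
  - by apply: cmeasurable_cmod; exact: cmeasurableB.
  - exact: measurable_funM.
  move=> y cy; rewrite cmod_ge0/= -mulrBl cmodM; apply: ler_wpM2r; first exact: cmod_ge0.
  have [h1 h2] := far_half_dist Pj far cy; rewrite -/D in h1 h2.
  have dy0 : 0 < dist x y by apply: lt_le_trans h2; rewrite divr_gt0.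
  have xy : x != y by apply: contraTneq dy0 => ->; rewrite distxx ltxx.
  have sj := s0 Pj.
  have E : far_ratio d * s j = 12 * (d%:R * s j) by rewrite /far_ratio mulrA.
  have dx : dist x x' <= dist x y / 2 by rewrite E in far; lra.
  apply: le_trans (_ : _ <= cK * (om (dist x x' / dist x y) / dist x y ^+ d)) _.
    by apply: le_trans (Kd _ _ _ xy dx); rewrite lerDl cmod_ge0.
  apply: ler_wpM2l => //; apply: ler_pM => //.
  - by rewrite invr_ge0 exprn_ge0// ltW.
  - apply: omh; rewrite ler_pdivrMr// mulrAC ler_pdivlMr//.
    rewrite E; apply: (@le_trans _ _ (d%:R * s j * (2 * dist x y))).
      by apply: ler_pM; rewrite ?dist_ge0 ?(ltW Dj)//; lra.
    have : 0 <= d%:R * s j * dist x y by rewrite !mulr_ge0// ltW.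
    by set u := d%:R * s j => h; lra.
  - rewrite -[leRHS]invrK invf_div -expr_div_n lef_pV2 ?posrE ?exprn_gt0 ?divr_gt0//.
    apply: lerXn2r; rewrite ?nnegrE ?dist_ge0//; first by rewrite divr_ge0// ltW.
    by rewrite ler_pdivrMr// mulrC; exact: sep.
apply: ler_sum => i _; rewrite le_eqVlt; apply/orP; left; apply/eqP; congr (cmod _ ^+ 2).
by rewrite !(sum_annulus_pieces _ _ nf (zero_seq_gt0 _ ze) fP) -sumrB.
Qed.

(* Integral comparison: on each cube the kernel [om (t / |x - y|) |x - y|^-d] dominates the
   corresponding term of the tail sum. *)
Lemma tail_sum_level_le x (t : R) : 0 < t -> (forall j, P j -> s j = t) ->
  (forall j y, P j -> cube (c j) (s j) y -> t <= dist x y) ->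
  tail_sum P c s x om <= 12 * d%:R * (1 + d%:R) ^+ d.+1 * (4 ^+ d * W).
Proof.
move=> t0 st far; have [omh om0 _ omn _] := omW.
pose k y : R := om (t / dist x y) * (dist x y ^+ d)^-1.
have mk : measurable_fun setT k by exact: (measurable_tail omW x t).
have k0 y : 0 <= k y by rewrite mulr_ge0// invr_ge0 exprn_ge0// dist_ge0.
(* For [y] in the cube, [|x - y|] is at most [1 + d] times the distance from [x] to the corner.
   Exchanging the two inside [om], together with removing [far_ratio], costs the integer
   [12 d (1 + d)]; in the power it costs [(1 + d) ^ d]. *)
pose A := 12 * d%:R * (1 + d%:R) ^+ d.+1 : R.
have A0 : 0 <= A by rewrite !mulr_ge0// exprn_ge0// addr_ge0.
pose T j := s j ^+ d * (om (far_ratio d * s j / dist x (c j)) * (dist x (c j) ^+ d)^-1).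
have mc j := @measurable_cube R d (c j) (s j).
have term j : P j -> ((T j)%:E <= A%:E * \int[leb]_(y in cube (c j) (s j)) (k y)%:E)%E.
  move=> Pj; have sj := s0 Pj.
  rewrite -ge0_integralZl//; last 2 first.
  - by apply/measurable_EFinP; exact: measurable_funTS.
  - by move=> y _; rewrite lee_fin.
  under eq_integral do rewrite -EFinM.
  pose B := om (far_ratio d * s j / dist x (c j)) * (dist x (c j) ^+ d)^-1.
  have B0 : 0 <= B by rewrite mulr_ge0// invr_ge0 exprn_ge0// dist_ge0.
  have -> : (T j)%:E = (B%:E * leb (cube (c j) (s j)))%E.
    by have /= -> := lebesgue_nd_cube (c j) (ltW sj); rewrite -EFinM mulrC.
  apply: ge0_cst_le_integral => //; first exact: measurable_funM.
  move=> y cy; have ty := far j y Pj cy; have dy0 : 0 < dist x y by exact: lt_le_trans ty.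
  have tc : t <= dist x (c j).
    apply: (far j (c j) Pj) => i; rewrite lexx/= ltrDl; exact: s0.
  have dc0 : 0 < dist x (c j) by exact: lt_le_trans tc.
  have yc : dist x y <= (1 + d%:R) * dist x (c j).
    rewrite mulrDl mul1r; apply: le_trans (dist_triangle (c j) _ _) _; rewrite lerD2l.
    by apply: le_trans (cube_dist_le cy) _; rewrite (st j Pj) ler_wpM2l.
  have d10 : 0 < 1 + d%:R :> R by rewrite ltr_wpDr.
  have -> : A * k y = (12 * d%:R * (1 + d%:R) * om (t / dist x y)) * ((1 + d%:R) ^+ d * (dist x y ^+ d)^-1).
    by rewrite /A /k exprSr; ring.
  apply: ler_pM => //; first by rewrite invr_ge0 exprn_ge0// ltW.
    have -> : 12 * d%:R * (1 + d%:R) = (12 * d * (1 + d))%:R :> R by rewrite !natrM natrD.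
    apply: le_trans (omn _ _ _); last by rewrite divr_ge0// ltW.
    apply: omh; rewrite (st j Pj) /far_ratio !natrM natrD.
    rewrite ler_pdivrMr//.
    have -> : 12%:R * d%:R * (1 + d%:R) * (t / dist x y) * dist x (c j) =
      12%:R * d%:R * t * ((1 + d%:R) * dist x (c j)) / dist x y by ring.
    rewrite ler_pdivlMr//.
    by apply: ler_wpM2l => //; rewrite !mulr_ge0// ltW.
  rewrite -[leRHS]invrK invf_div -expr_div_n lef_pV2 ?posrE ?exprn_gt0 ?divr_gt0//.
  apply: lerXn2r; rewrite ?nnegrE ?dist_ge0//; first by rewrite divr_ge0// ltW.
  by rewrite ler_pdivrMr// mulrC.
rewrite -lee_fin -sumEFin; apply: (@le_trans _ _ (\sum_(j | P j) A%:E * \int[leb]_(y in cube (c j) (s j)) (k y)%:E)%E).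
  by apply: lee_sum => j Pj; exact: term.
rewrite -ge0_sume_distrr; last by move=> j _; apply: integral_ge0 => y _; rewrite lee_fin.
rewrite -/A [leRHS]EFinM; apply: lee_wpmul2l; first by rewrite lee_fin.
apply: le_trans (tail_integral_le omW x t0).
have uniqF := index_enum_uniq I.
pose r := [seq j <- index_enum I | P j].
have tr : trivIset [set` r] (fun j => cube (c j) (s j)).
  apply/trivIsetP => i j /=; rewrite !mem_filter => /andP[Pi _] /andP[Pj _]; exact: disj.
have := @ge0_integral_bigsetU _ _ _ leb I (fun j => cube (c j) (s j)) (EFin \o k) r mc (filter_uniq _ uniqF) tr.
rewrite !big_filter => <-; last 2 first.
- by apply/measurable_EFinP; exact: measurable_funTS.
- by move=> y _; rewrite lee_fin.
apply: ge0_subset_integral_real => //.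
- by apply: bigsetU_measurable => j _; exact: mc.
- rewrite (_ : [set y | _] = dist x @^-1` `[t, +oo[%classic).
    by rewrite -[X in measurable X]setTI; exact: measurable_distr.
  by apply/seteqP; split => y /=; rewrite in_itv/= andbT.
by rewrite -bigcup_seq_cond => y [j /= /andP[_ Pj]]; exact: far.
Qed.

End far_pieces.

Section tail_term.
Context {R : realType} {d : nat}.
Local Notation leb := (@lebesgue_nd R d).
Local Notation Rd := (d.-tuple R).

(** What one piece contributes to the integral of [H] away from it: a multiple of its volume. Here
    the corner is fixed and the point varies; [12 * d%:R] leaves [om] by the clause on integer
    multiples. *)
Lemma tail_term_integral_le (om : R -> R) (W : R) (c : Rd) (t : R) : (0 < d)%N -> dini_bound om W -> 0 < t ->
  (\int[leb]_(x in [set x : Rd | (sep_ratio d * t <= dist x c)%R])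
     (t ^+ d * (om (far_ratio d * t / dist x c) * (dist x c ^+ d)^-1))%:E
   <= (t ^+ d * (12 * d%:R * (4 ^+ d * W)))%:E)%E.
Proof.
move=> d0 omW t0; have [omh om0 _ omn _] := omW.
have d1 : 1 <= d%:R :> R by rewrite ler1n.
have mA r : measurable [set y : Rd | r <= dist c y].
  rewrite (_ : [set y | _] = dist c @^-1` `[r, +oo[%classic).
    by rewrite -[X in measurable X]setTI; exact: measurable_distr.
  by apply/seteqP; split => y /=; rewrite in_itv/= andbT.
rewrite (_ : [set x | _] = [set y | sep_ratio d * t <= dist c y]); last first.
  by apply/seteqP; split => y /=; rewrite distC.
pose k y : R := om (t / dist c y) * (dist c y ^+ d)^-1.
have mk : measurable_fun setT k by exact: (measurable_tail omW c t).
have k0 y : 0 <= k y by rewrite mulr_ge0// invr_ge0 exprn_ge0// dist_ge0.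
have sub : [set y : Rd | sep_ratio d * t <= dist c y] `<=` [set y | t <= dist c y].
  move=> y /=; apply: le_trans; rewrite ler_peMl ?(ltW t0)// /sep_ratio; lra.
have A0 : 0 <= t ^+ d * (12 * d%:R) by rewrite !mulr_ge0// exprn_ge0// ltW.
apply: (@le_trans _ _ (\int[leb]_(y in [set y : Rd | (sep_ratio d * t <= dist c y)%R]) (t ^+ d * (12 * d%:R) * k y)%:E)%E).
  apply: ge0_le_integral_real => //.
  - apply: measurable_funM => //.
    rewrite (_ : (fun y => _) = (fun y => om ((far_ratio d * t) / dist c y) * (dist c y ^+ d)^-1)).
      exact: (measurable_tail omW c (far_ratio d * t)).
    by apply/funext => y; rewrite distC.
  - exact: measurable_funM.
  move=> y /sub ty; have dy0 : 0 < dist c y by exact: lt_le_trans ty.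
  rewrite [dist y c]distC mulr_ge0 ?exprn_ge0 ?(ltW t0)// ?mulr_ge0 ?invr_ge0 ?exprn_ge0 ?(ltW dy0)//=.
  rewrite -[leRHS]mulrA; apply: ler_wpM2l; first by rewrite exprn_ge0// ltW.
  rewrite /k mulrA; apply: ler_wpM2r; first by rewrite invr_ge0 exprn_ge0// ltW.
  have -> : 12 * d%:R = (12 * d)%:R :> R by rewrite natrM.
  apply: le_trans (omn _ _ _); last by rewrite divr_ge0// ltW.
  by apply: omh; rewrite /far_ratio natrM mulrA.
under eq_integral do rewrite EFinM.
rewrite ge0_integralZl//; last 2 first.
- by apply/measurable_EFinP; exact: measurable_funTS.
- by move=> y _; rewrite lee_fin.
rewrite (_ : t ^+ d * (12 * d%:R * (4 ^+ d * W)) = (t ^+ d * (12 * d%:R)) * (4 ^+ d * W)); last by ring.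
rewrite [leRHS]EFinM; apply: lee_wpmul2l; first by rewrite lee_fin.
by apply: le_trans (tail_integral_le omW c t0); exact: ge0_subset_integral_real.
Qed.
End tail_term.

(** * Countable families of dyadic cubes and their finite subfamilies *)

Section pieces.
Context {R : realType} {d : nat}.
Local Notation leb := (@lebesgue_nd R d).
Local Notation C := (complex R).
Local Notation Rd := (d.-tuple R).
Local Notation idx := (nat * d.-tuple nat)%type.
Implicit Types (x y : Rd) (p : idx) (J G : set idx).

(** Indices of dyadic cubes are numbered by [pickle], and the members of a family numbered below [n]
    form the finite subfamilies on which estimates are made. The default value occurs only at
    numbers that [in_fam] rejects. *)
Definition idx_at (j : nat) : idx := odflt (0%N, [tuple 0%N | _ < d]) (pickle_inv j).

Definition in_fam J (j : nat) : bool :=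
  if pickle_inv j is Some p then `[< J p >] else false.

Lemma in_famP J j : in_fam J j -> J (idx_at j) /\ pickle (idx_at j) = j.
Proof.
rewrite /in_fam /idx_at; have := pickle_invK (T := idx) j.
by case: (pickle_inv j) => [p|]//= pj /asboolP.
Qed.

Lemma in_fam_pickle J p : J p -> in_fam J (pickle p) /\ idx_at (pickle p) = p.
Proof. by move=> Jp; rewrite /in_fam /idx_at pickleK_inv; split => //; apply/asboolP. Qed.

Lemma in_fam_inj J (i j : nat) : in_fam J i -> in_fam J j -> idx_at i = idx_at j -> i = j.
Proof. by move=> /in_famP[_ hi] /in_famP[_ hj] h; rewrite -hi -hj h. Qed.

Lemma in_fam_sub J J' j : J `<=` J' -> in_fam J j -> in_fam J' j.
Proof.
by move=> JJ'; rewrite /in_fam; case: (pickle_inv j) => [p|]// /asboolP/JJ' ?; apply/asboolP.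
Qed.

Variables (a : Rd) (l : R).
Hypothesis l0 : 0 < l.
Local Notation cor p := (dyad_corner a l p).
Local Notation sid p := (dyad_side l p).

Lemma sum_pieces_le_esum G n :
  ((\sum_(j < n | in_fam G j) sid (idx_at j) ^+ d)%:E <= \esum_(p in G) (sid p ^+ d)%:E)%E.
Proof.
pose r := [seq idx_at (nat_of_ord j) | j <- [seq j <- index_enum 'I_n | in_fam G (nat_of_ord j)]].
apply: esum_ge; exists [set` r].
  split; first exact: finite_seq.
  by move=> p /= /mapP[j]; rewrite mem_filter => /andP[/in_famP[Gj _] _] ->.
have ur : uniq r.
  rewrite map_inj_in_uniq ?filter_uniq ?index_enum_uniq// => i j.
  rewrite !mem_filter => /andP[hi _] /andP[hj _] h; apply/val_inj.
  exact: in_fam_inj hi hj h.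
by rewrite -fsbig_seq// big_map big_filter -sumEFin.
Qed.

Definition tail_at (om : R -> R) G n x : R :=
  tail_sum (fun j : 'I_n => in_fam G j) (fun j => cor (idx_at j)) (fun j => sid (idx_at j)) x om.

Definition union J : set Rd := \bigcup_(p in J) dyad a l p.

Lemma measurable_union J : measurable (union J).
Proof. exact: measurable_dyad_bigcup. Qed.

Definition union_upto J n : set Rd := \bigcup_(j in [set j | (j < n)%N /\ in_fam J j]) dyad a l (idx_at j).

Lemma measurable_union_upto J n : measurable (union_upto J n).
Proof.
rewrite /union_upto bigcup_mkcond; apply: bigcupT_measurable => j.
by case: ifP => // _; exact: measurable_dyad.
Qed.

Lemma union_upto_up J n m : (n <= m)%N -> union_upto J n `<=` union_upto J m.
Proof. by move=> nm y [j [jn Jj] jy]; exists j => //; split => //; exact: leq_trans nm. Qed.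

Lemma union_uptoP J y : union J y -> exists n, union_upto J n y.
Proof.
move=> [p Jp py]; have [h1 h2] := in_fam_pickle Jp.
exists (pickle p).+1, (pickle p); rewrite ?h2//; split => //.
Qed.

Lemma union_rest_small J (eta : R) : J `<=` @dyadic_index d -> 0 < eta -> exists n0, forall n, (n0 <= n)%N ->
  (leb (union J `\` union_upto J n) <= eta%:E)%E.
Proof.
move=> dJ eta0; pose F n := union J `\` union_upto J n.
have mF n : measurable (F n) by apply: measurableD; [exact: measurable_union|exact: measurable_union_upto].
have E0 : \bigcap_n F n = set0.
  apply/seteqP; split => // y h; have [Uy _] := h 0%N I.
  by have [n hn] := union_uptoP Uy; have [_] := h n I.
have fin : (leb (F 0%N) < +oo)%E.
  apply: le_lt_trans (_ : leb (cube a l) < _)%E.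
    apply: le_measure; rewrite ?inE//; first exact: measurable_cube.
    by move=> y [[p Jp py] _]; exact: (dyad_sub_cube l0 (dJ _ Jp)).
  by have /= -> := lebesgue_nd_cube a (ltW l0); exact: ltry.
have cv : (leb \o F) @ \oo --> (0 : \bar R).
  rewrite -(@measure0 _ _ _ leb) -E0; apply: nonincreasing_cvg_mu => //.
    by rewrite E0.
  move=> n m nm; rewrite subsetEset => y [Uy h]; split => // h'; apply: h.
  exact: union_upto_up h'.
move/fine_cvgP : cv => [fcv /cvgrPdist_le/(_ _ eta0)].
move=> [n0 _ hn0]; move: fcv => [n1 _ hn1]; exists (maxn n0 n1) => n; rewrite geq_max => /andP[h0 h1].
have f := hn1 n h1; have := hn0 n h0; rewrite sub0r normrN => h.
rewrite -[leb _]/((leb \o F) n) -(fineK f) lee_fin; apply: le_trans h; exact: ler_norm.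
Qed.

End pieces.

(** * Triples of dyadic cubes *)

Section triple.
Context {R : realType} {d : nat}.
Local Notation Rd := (d.-tuple R).
Local Notation idx := (nat * d.-tuple nat)%type.
Implicit Types (x y : Rd) (p : idx).
Variables (a : Rd) (l : R).
Hypothesis l0 : 0 < l.
Local Notation cor p := (dyad_corner a l p).
Local Notation sid p := (dyad_side l p).

Definition triple p : set Rd := dil_cube 3 (cor p) (sid p).

Lemma measurable_triple p : measurable (triple p).
Proof. exact: measurable_cube. Qed.

Lemma triple_itv p y : triple p y <->
  forall i, tnth (cor p) i - sid p <= tnth y i < tnth (cor p) i + 2 * sid p.
Proof.
have E i : tnth (dil_corner 3 (cor p) (sid p)) i = tnth (cor p) i + sid p / 2 - 3 * sid p / 2.
  by rewrite [LHS]tnth_mktuple.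
by split => h i; have /andP[h1 h2] := h i; [move: h1 h2; rewrite E => h1 h2|rewrite E]; apply/andP; split; lra.
Qed.

Lemma lebesgue_triple p : lebesgue_nd (triple p) = (3 ^+ d * sid p ^+ d)%:E.
Proof. by rewrite /triple /dil_cube lebesgue_nd_cube ?exprMn// mulr_ge0// ltW// dyad_side_gt0. Qed.

Lemma triple_code p y : cube a l y -> (triple p y <->
  forall i, (tnth p.2 i <= (tnth (dyad_code a l p.1 y) i).+1)%N /\ (tnth (dyad_code a l p.1 y) i <= (tnth p.2 i).+1)%N).
Proof.
move=> Qy.
have k0 : 0 < 2 ^+ p.1 :> R by rewrite exprn_gt0.
have E i : (tnth (cor p) i - sid p <= tnth y i < tnth (cor p) i + 2 * sid p) =
   ((tnth p.2 i <= (tnth (dyad_code a l p.1 y) i).+1)%N && (tnth (dyad_code a l p.1 y) i <= (tnth p.2 i).+1)%N).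
  rewrite !tnth_mktuple /dyad_side; set j := tnth p.2 i; set k : R := 2 ^+ p.1 in k0 *.
  set u := k * ((tnth y i - tnth a i) / l).
  have /andP[q1 q2] := Qy i.
  have u0 : 0 <= u by rewrite mulr_ge0 ?(ltW k0)// divr_ge0 ?(ltW l0)// subr_ge0.
  have -> : tnth y i = tnth a i + u * l / k by rewrite /u; field; rewrite !gt_eqF.
  have -> : tnth a i + l * j%:R / k - l / k = tnth a i + (j%:R - 1) * l / k by field; rewrite !gt_eqF.
  have -> : tnth a i + l * j%:R / k + 2 * (l / k) = tnth a i + (j%:R + 2) * l / k by field; rewrite !gt_eqF.
  rewrite lerD2l ltrD2l ler_pM2r ?invr_gt0// ltr_pM2r ?invr_gt0// ler_pM2r// ltr_pM2r//.
  congr andb.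
    case: j => [|j]; first by rewrite leq0n sub0r; apply/idP; apply: le_trans u0; rewrite lerN10.
    by rewrite ltnS truncn_ge_nat// -natr1 addrK.
  by rewrite -[RHS]ltnS truncn_lt_nat// -[j.+2]addn2 natrD.
rewrite triple_itv; split => h i; have := h i; first by rewrite E => /andP.
by move=> /andP; rewrite -E.
Qed.

(** Inside the big cube, the triple consists of the cubes of the generation of [p] whose position
    differs from that of [p] by at most one in each coordinate. A dyadic cube of the same or a later
    generation lies in a single cube of that generation. *)
Lemma small_sub_triple p p' : dyadic_index p' -> (p.1 <= p'.1)%N ->
  dyad a l p' `&` triple p !=set0 -> dyad a l p' `<=` triple p.
Proof.
move=> dp' pp' [z [p'z Tz]] y p'y.
have Qz := dyad_sub_cube l0 dp' p'z; have Qy := dyad_sub_cube l0 dp' p'y.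
have cE : dyad_code a l p.1 y = dyad_code a l p.1 z.
  rewrite (dyad_code_div l0 pp' Qy) (dyad_code_div l0 pp' Qz).
  by rewrite (proj1 (dyad_codeP l0 p' Qy) p'y) (proj1 (dyad_codeP l0 p' Qz) p'z).
by apply/(triple_code p Qy); rewrite cE; exact/(triple_code p Qz).
Qed.

Lemma dist_dyad p x y : dyad a l p x -> dyad a l p y -> dist x y <= d%:R * sid p.
Proof.
move=> px py; apply: dist_le => i; have /andP[h1 h2] := px i; have /andP[h3 h4] := py i.
by rewrite ler_norml; apply/andP; split; lra.
Qed.

Lemma dist_triple p x y : dyad a l p x -> triple p y -> dist x y <= d%:R * (2 * sid p).
Proof.
move=> px /triple_itv py; apply: dist_le => i; have /andP[h1 h2] := px i; have /andP[h3 h4] := py i.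
by rewrite ler_norml; apply/andP; split; lra.
Qed.

Lemma dist_out_triple p x y : dyad a l p x -> ~ triple p y -> sid p <= dist x y.
Proof.
move=> px Ty; rewrite leNgt; apply/negP => h; apply: Ty; apply/triple_itv => i.
have /andP[h1 h2] := px i; have := le_lt_trans (coord_le_dist x y i) h.
by rewrite ltr_norml => /andP[h3 h4]; apply/andP; split; lra.
Qed.

End triple.

(** * Calderon-Zygmund decomposition *)

Section bad_function.
Context {R : realType} {d : nat}.
Local Notation leb := (@lebesgue_nd R d).
Local Notation C := (complex R).
Local Notation Rd := (d.-tuple R).
Local Notation idx := (nat * d.-tuple nat)%type.
Implicit Types (x y : Rd) (p : idx) (J G : set idx) (f g h : Rd -> C).

(** An upper bound for the square root of [square_bound], linear in [M] and increasing in [H]: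
    [A H + H ^ 2] is at most [(A + 1) ^ 2 (H + 1) ^ 2], and 12 at most [4 ^ 2]. *)
Definition root_bound (n : nat) (M H : R) : R :=
  4 * (4 * M) * (2 ^+ n * (4 ^+ n * n%:R * (6 * n%:R)) + 1) * (H + 1).

Lemma root_bound_ge0 n M H : 0 <= M -> 0 <= H -> 0 <= root_bound n M H.
Proof.
by move=> M0 H0; rewrite /root_bound; rewrite !mulr_ge0// addr_ge0// ?mulr_ge0// ?exprn_ge0// mulr_ge0.
Qed.

Lemma square_bound_le n (M H Hm : R) : 0 <= M -> 0 <= H -> H <= Hm ->
  square_bound n M H <= root_bound n M Hm ^+ 2.
Proof.
move=> M0 H0 HHm; rewrite /square_bound /root_bound.
set A := 2 ^+ n * _; have A0 : 0 <= A by rewrite /A !mulr_ge0// ?exprn_ge0// mulr_ge0.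
have Hm0 : 0 <= Hm by exact: le_trans HHm.
have -> : (4 * (4 * M) * (A + 1) * (Hm + 1)) ^+ 2 = 16 * (4 * M) ^+ 2 * ((A + 1) ^+ 2 * (Hm + 1) ^+ 2) by ring.
apply: ler_pM.
- by rewrite mulr_ge0// sqr_ge0.
- by rewrite addr_ge0 ?mulr_ge0 ?sqr_ge0.
- by apply: ler_wpM2r; [exact: sqr_ge0|rewrite ler_nat].
have h1 : A * H <= A * (Hm + 1) ^+ 2.
  apply: ler_wpM2l => //; apply: (le_trans HHm).
  by rewrite expr2; apply: (@le_trans _ _ (1 * (Hm + 1))); [lra|apply: ler_wpM2r; lra].
have h2 : H ^+ 2 <= (Hm + 1) ^+ 2 by apply: lerXn2r; rewrite ?nnegrE//; lra.
apply: (@le_trans _ _ ((A + 1) * (Hm + 1) ^+ 2)); first by rewrite mulrDl mul1r lerD.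
apply: ler_wpM2r; first exact: sqr_ge0.
by rewrite expr2 ler_peMl//; lra.
Qed.

Lemma root_boundZ n (k M H : R) : root_bound n (2 * (k * M)) H = root_bound n (2 * k) H * M.
Proof. by rewrite /root_bound; ring. Qed.

Lemma tail_sum_ge0 (I : finType) (P : pred I) (c : I -> Rd) (s : I -> R) x (om : R -> R) :
  (forall t, 0 <= om t) -> (forall j, P j -> 0 <= s j) -> 0 <= tail_sum P c s x om.
Proof.
move=> om0 s0; apply: sumr_ge0 => j Pj.
by rewrite mulr_ge0 ?exprn_ge0 ?s0// mulr_ge0// invr_ge0 exprn_ge0// dist_ge0.
Qed.

Hypothesis d0 : (0 < d)%N.
Variables (K : Rd -> Rd -> C) (om : R -> R) (W cK : R).
Hypothesis omW : dini_bound om W.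
Hypothesis stdK : std_kernel K om cK.
Variables (a : Rd) (l : R) (rho : R).
Hypothesis l0 : 0 < l.
Hypothesis rho2 : 2 < rho.
Local Notation nice := (nice a l).
Local Notation cor p := (dyad_corner a l p).
Local Notation sid p := (dyad_side l p).
Let kap := @sep_ratio R d.
Let cK0 : 0 <= cK. Proof. by have [] := stdK. Qed.
Let kd0 : 0 <= kap ^+ d.
Proof. by rewrite exprn_ge0// /kap /sep_ratio addr_ge0// mulr_ge0. Qed.

(** The estimate for finitely many pieces is applied to [b] restricted to those numbered below [n],
    with a bound uniform in [n]. The rest of [b] lives on a set of small measure, so its annular
    integrals tend to 0 for fixed radii. *)
Lemma bad_var_bound b J x (M Hm : R) : nice b -> 0 <= M -> 0 <= Hm -> disjoint_dyadic_family a l J ->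
  (forall y, ~ union a l J y -> b y = 0) ->
  (forall p, J p -> \int[leb]_(y in dyad a l p) (cmod (b y))%:E <= (M * sid p ^+ d)%:E)%E ->
  (forall p, J p -> cint (dyad a l p) b = 0) ->
  (forall p, J p -> 0 < dist x (cor p)) ->
  (forall p y, J p -> dyad a l p y -> dist x (cor p) <= kap * dist x y) ->
  (forall n, tail_at a l om J n x <= Hm) ->
  (var_op K rho b x <= (root_bound d (2 * (cK * kap ^+ d)) Hm * M)%:E)%E.
Proof.
move=> nb M0 Hm0 [dJ disJ] bJ bM b0 D0 sep tl; have [mb [Bd hBd] _] := nb.
have [_ om0 _ _ _] := omW.
pose f_ n y : C := (\1_(union_upto a l J n) y : C) * b y.
have mU n := measurable_union_upto a l J n.
have nf n : nice (f_ n) by exact: nice_indic.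
have k0 : 0 <= 2 * (cK * kap ^+ d * M) by rewrite !mulr_ge0.
rewrite -root_boundZ; apply: (var_op_lim omW stdK l0 rho2 nb nf); first exact: root_bound_ge0.
  move=> r1 r2 eta r10 eta0.
  have Bd0 : 0 <= Bd by apply: le_trans (hBd a); exact: cmod_ge0.
  pose L := 2 * (cK * (r1 ^+ d)^-1 * Bd).
  have L0 : 0 <= L by rewrite !mulr_ge0// invr_ge0 exprn_ge0// ltW.
  have e0 : 0 < eta / (L + 1) by rewrite divr_gt0// ltr_wpDl.
  have [n0 hn0] := union_rest_small a l0 dJ e0.
  exists n0 => n n0n; have nN := niceN (nf n).
  rewrite -(ann_opN omW stdK l0 x r2 (nf n) r10) -(ann_opD omW stdK l0 x r2 nb nN r10).
  have nD := niceD nb nN.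
  apply: le_trans (ann_op_small omW stdK x r2 (B := Bd) nD r10 _ _ _ (hn0 n n0n)) _.
  - move=> y; rewrite /f_ indicE; case: (y \in _); first by rewrite mul1r subrr cmod0.
    by rewrite mul0r subr0.
  - move=> y hy; rewrite /f_ indicE; have [Uy|Uy] := pselect (union_upto a l J n y).
      by rewrite mem_set// mul1r subrr.
    rewrite memNset// mul0r subr0; apply: bJ => h; apply: hy; by split.
  - by apply: measurableD => //; exact: measurable_union.
  have -> : 2 * (cK * (r1 ^+ d)^-1 * Bd * (eta / (L + 1))) = eta * (L / (L + 1)) by rewrite /L; ring.
  by rewrite ler_piMr ?(ltW eta0)// ler_pdivrMr ?ltr_wpDl// mul1r lerDl.
move=> n; apply: (var_op_le_square omW stdK l0 rho2 (nf n)); first exact: root_bound_ge0.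
move=> e N ze; pose P (j : 'I_n) := in_fam J j.
have s0 (j : 'I_n) : P j -> 0 < sid (@idx_at d j) by move=> _; exact: dyad_side_gt0.
have disj (i j : 'I_n) : P i -> P j -> i != j ->
    cube (cor (@idx_at d i)) (sid (@idx_at d i)) `&` cube (cor (@idx_at d j)) (sid (@idx_at d j)) = set0.
  move=> Pi Pj ij; have [Ji _] := in_famP Pi; have [Jj _] := in_famP Pj.
  apply: disJ => // h; move/eqP: ij; apply; apply/val_inj; exact: in_fam_inj Pi Pj h.
have in1 (j : 'I_n) y : P j -> dyad a l (@idx_at d j) y -> f_ n y = b y.
  by move=> Pj jy; rewrite /f_ indicE mem_set ?mul1r//; exists j => //; split.
have t0 : 0 <= tail_at a l om J n x.
  by apply: tail_sum_ge0 => // j _; exact/ltW/dyad_side_gt0.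
apply: le_trans (square_bound_le d k0 t0 (tl n)).
apply: (@bad_part_bound R d d0 K om W cK omW stdK a l l0 'I_n P (fun j => cor (@idx_at d j)) (fun j => sid (@idx_at d j)) s0 disj (f_ n) x M e N (nf n) M0) => //.
- move=> y hy; rewrite /f_ indicE memNset ?mul0r// => -[j [jn Jj] jy].
  exact: (hy (Ordinal jn)).
- move=> j Pj; have [Jj _] := in_famP Pj; apply: le_trans (bM _ Jj).
  rewrite le_eqVlt; apply/orP; left; apply/eqP; apply: eq_integral => y; rewrite inE => jy.
  by rewrite (in1 j).
- move=> j Pj; have [Jj _] := in_famP Pj; rewrite -[RHS](b0 _ Jj).
  by apply: cint_eq => y jy; exact: in1 jy.
- by move=> j /in_famP[Jj _]; exact: D0.
- by move=> j y /in_famP[Jj _]; exact: sep.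
Qed.

(** The value lies in a countable type, so the function of averages is measurable by
    [measurable_fun_countable_partition]. For a disjoint family the choice is forced. *)
Definition locate G y : option idx :=
  if pselect (exists p, G p /\ dyad a l p y) is left h then Some (sval (cid h)) else None.

Lemma locate_some G y p : disjoint_dyadic_family a l G -> G p -> dyad a l p y -> locate G y = Some p.
Proof.
move=> [_ disG] Gp py; rewrite /locate; case: pselect => [h|[]]; last by exists p.
case: (cid h) => p' /= [Gp' p'y]; congr Some; apply: contrapT => pp'.
by have /seteqP[h' _] := disG _ _ Gp' Gp pp'; exact: (h' y).
Qed.

Lemma locateP G y : if locate G y is Some p then G p /\ dyad a l p y else ~ union a l G y.
Proof.
rewrite /locate; case: pselect => [h|h]; first by case: (cid h).
by move=> [p Gp py]; apply: h; exists p.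
Qed.

Lemma measurable_locate G o : disjoint_dyadic_family a l G -> measurable (locate G @^-1` [set o]).
Proof.
move=> dG; case: o => [p|].
  have [Gp|Gp] := pselect (G p).
    rewrite (_ : _ @^-1` _ = dyad a l p); first exact: measurable_dyad.
    apply/seteqP; split => y /=; last exact: locate_some.
    by move=> h; have := locateP G y; rewrite h => -[].
  rewrite (_ : _ @^-1` _ = set0)//; apply/seteqP; split => y //= h.
  by have := locateP G y; rewrite h => -[].
rewrite (_ : _ @^-1` _ = ~` union a l G); first by apply: measurableC; exact: measurable_union.
apply/seteqP; split => y /=.
  by move=> h; have := locateP G y; rewrite h.
by have := locateP G y; case: (locate G y) => // p [Gp py] []; exists p.
Qed.

Lemma complexMr (u v : R) : Complex u 0 * Complex v 0 = Complex (v * u) 0 :> C.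
Proof. by apply/eqP; rewrite eq_complex /= !mulr0 !mul0r subr0 addr0 mulrC !eqxx. Qed.

Lemma cint_cst_dyad p (z : C) : cint (dyad a l p) (fun=> z) = z * Complex (sid p ^+ d) 0.
Proof.
have s0 := dyad_side_gt0 l0 p; rewrite -(@cint1_cube R d (cor p))//; last exact: ltW.
have mc := @measurable_cube R d (cor p) (sid p).
rewrite -cintZ//; first by apply: cint_eq => y _; rewrite mulr1.
apply: (@cintegrable_bounded _ _ _ _ (cmod 1)) => //.
by have /= -> := lebesgue_nd_cube (cor p) (ltW s0); exact: ltry.
Qed.

(** On a selected cube [g] is the average of [f]. In [M], the product [2 ^+ d * th] bounds the
    averages of [|f|] there, and the 2 is that of [cmod_cint_le]; [2 * M] covers [|f|] and the
    subtracted average together. *)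
Lemma cz_decomposition f (th : R) : nice f -> 0 < th ->
  (\int[leb]_(x in cube a l) (cmod (f x))%:E <= (th * l ^+ d)%:E)%E ->
  let M := 2 * (2 ^+ d * th) in
  exists G g b, [/\ disjoint_dyadic_family a l G,
    (\esum_(p in G) (sid p ^+ d)%:E <= th^-1%:E * \int[leb]_(x in cube a l) (cmod (f x))%:E)%E,
    [/\ nice g, nice b, (forall y, cmod (g y) <= M) & negligible leb [set y | f y != g y + b y]] &
    [/\ (forall y, ~ union a l G y -> b y = 0),
        (forall p, G p -> \int[leb]_(y in dyad a l p) (cmod (b y))%:E <= (2 * M * sid p ^+ d)%:E)%E &
        (forall p, G p -> cint (dyad a l p) b = 0)]].
Proof.
move=> nf th0 hf M; have [mf [Mf hMf] fQ] := nf.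
have mcf := cmeasurable_cmod mf.
have [G [dG sG iG nG]] := stopping_time l0 d0 th0 mcf (fun x => introT andP (conj (cmod_ge0 (f x)) (hMf x))) hf.
have [dGi disG] := dG.
have intG p : G p -> (\int[leb]_(x in dyad a l p) (cmod (f x))%:E <= (2 ^+ d * th * sid p ^+ d)%:E)%E.
  move=> Gp; apply: iG; first exact: dGi.
  move=> p' Gp' sub; apply: contrapT => pp'.
  have /seteqP[h _] := disG _ _ Gp' Gp pp'; apply: (h (cor p)); split; last exact: dyad_corner_in.
  by apply: sub; exact: dyad_corner_in.
pose av (o : option idx) : C := if o is Some p then Complex (sid p ^+ d)^-1 0 * cint (dyad a l p) f else 0.
have sd0 p : 0 < sid p ^+ d by rewrite exprn_gt0// dyad_side_gt0.
have M0 : 0 <= M by rewrite !mulr_ge0// ?exprn_ge0// ltW.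
have avM y : cmod (av (locate G y)) <= M.
  have := locateP G y; case: (locate G y) => [p [Gp _]|_]; last by rewrite cmod0.
  rewrite /av cmodM cmod_real ger0_norm ?invr_ge0 ?(ltW (sd0 p))//.
  rewrite mulrC ler_pdivrMr//; have -> : M * sid p ^+ d = 2 * (2 ^+ d * th * sid p ^+ d) by rewrite /M; ring.
  by apply: cmod_cint_le => //; [exact: measurable_dyad|exact: intG].
(* Off the selected cubes [|f| <= th] holds only almost everywhere. Dropping the other points keeps
   [g] bounded everywhere, and is why [f = g + b] fails on a null set. *)
pose A := ~` union a l G `&` [set y | cmod (f y) <= th].
have mU := measurable_union a l G.
have mA : measurable A.
  apply: measurableI; first exact: measurableC.
  rewrite (_ : [set y | _] = (fun y => cmod (f y)) @^-1` `]-oo, th]%classic).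
    by rewrite -[X in measurable X]setTI; exact: mcf.
  by apply/seteqP; split => y /=; rewrite in_itv.
have mav : cmeasurable (fun y => av (locate G y)).
  by split; [apply: (measurable_fun_countable_partition (fun o => complex.Re (av o)))|
    apply: (measurable_fun_countable_partition (fun o => complex.Im (av o)))] => o;
    exact: measurable_locate.
have avQ y : ~ cube a l y -> locate G y = None.
  move=> Qy; have := locateP G y; case: (locate G y) => // p [Gp py].
  by case: Qy; exact: (dyad_sub_cube l0 (dGi _ Gp)).
pose g y : C := av (locate G y) + (\1_A y : C) * f y.
pose b y : C := (\1_(union a l G) y : C) * (f y - av (locate G y)).
have gU y : union a l G y -> g y = av (locate G y).
  by move=> Uy; rewrite /g indicE memNset ?mul0r ?addr0// => -[].
have gN y : ~ union a l G y -> g y = (\1_A y : C) * f y.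
  move=> Uy; rewrite /g; have := locateP G y; case: (locate G y) => [p [Gp py]|_]; last by rewrite add0r.
  by case: Uy; exists p.
have bU y : union a l G y -> b y = f y - av (locate G y).
  by move=> Uy; rewrite /b indicE mem_set// mul1r.
have bN y : ~ union a l G y -> b y = 0 by move=> Uy; rewrite /b indicE memNset// mul0r.
have gM y : cmod (g y) <= M.
  have [Uy|Uy] := pselect (union a l G y); first by rewrite gU//; exact: avM.
  rewrite gN// indicE; have [Ay|Ay] := pselect (A y); last by rewrite memNset// mul0r cmod0.
  rewrite mem_set// mul1r; case: Ay => _ /= h; apply: (le_trans h).
  by rewrite /M mulrA ler_peMl ?(ltW th0)// -exprS exprn_ege1// ler1n.
exists G, g, b; split => //.
- split.
  + split.
    * by apply: cmeasurableD => //; apply: cmeasurableM => //; exact: cmeasurable_indic.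
    * by exists M.
    * by move=> y Qy; rewrite /g avQ// fQ// mulr0 addr0.
  + split.
    * by apply: cmeasurableM; [exact: cmeasurable_indic|exact: cmeasurableB].
    * exists (Mf + M) => y; apply: le_trans (cmod_indicM_le _ (fun y => f y - av (locate G y)) y) _.
      apply: le_trans (cmodD _ _) _; rewrite cmodN; apply: lerD => //; exact: avM.
    * by move=> y Qy; rewrite /b avQ// fQ// subr0 mulr0.
  + exact: gM.
  + apply: negligibleS nG => y /= /eqP hy.
    have Uy : ~ union a l G y by move=> Uy; apply: hy; rewrite gU// bU// addrC subrK.
    have thf : th < cmod (f y).
      rewrite ltNge; apply/negP => h; apply: hy; rewrite gN// bN// addr0 indicE mem_set ?mul1r//.
    split; last by split => // p Gp py; apply: Uy; exists p.
    apply: contrapT => /fQ h; move: thf; rewrite h cmod0 ltNge => /negP; apply; exact: ltW.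
- split => //.
  + move=> p Gp; have mD := measurable_dyad a l p.
    apply: (@le_trans _ _ (\int[leb]_(y in dyad a l p) (cmod (f y) + M)%:E)%E).
      apply: ge0_le_integral_real => //.
      * by apply: cmeasurable_cmod; apply: cmeasurableM; [exact: cmeasurable_indic|exact: cmeasurableB].
      * exact: measurable_funD.
      move=> y py; rewrite cmod_ge0/= bU; last by exists p.
      apply: le_trans (cmodD _ _) _; rewrite cmodN lerD2l; exact: avM.
    under eq_integral do rewrite EFinD.
    rewrite ge0_integralD//; last 2 first.
    * by move=> y _; rewrite lee_fin cmod_ge0.
    * by apply/measurable_EFinP; exact: measurable_funTS.
    rewrite integral_cst// -[X in (_ + M%:E * X)%E]/(leb (dyad a l p)).
    have /= -> := lebesgue_nd_dyad a l0 p.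
    apply: (@le_trans _ _ ((2 ^+ d * th * sid p ^+ d)%:E + (M * sid p ^+ d)%:E)%E).
      by apply: leeD; [exact: intG|rewrite EFinM].
    rewrite -EFinD lee_fin -mulrDl; apply: ler_wpM2r; first exact: ltW.
    have : 0 <= 2 ^+ d * th by rewrite mulr_ge0// ?exprn_ge0// ltW.
    by rewrite /M; set u := 2 ^+ d * th => u0; lra.
  + move=> p Gp; have mD := measurable_dyad a l p.
    have -> : cint (dyad a l p) b = cint (dyad a l p) (fun y => f y - av (Some p)).
      by apply: cint_eq => y py; rewrite bU ?(locate_some dG Gp py)//; exists p.
    have if1 : cintegrable (dyad a l p) f by exact: (cintegrable_nice l0 mD nf).
    rewrite cintB//; last first.
      apply: (@cintegrable_bounded _ _ _ _ (cmod (av (Some p)))) => //.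
      by have /= -> := lebesgue_nd_dyad a l0 p; exact: ltry.
    rewrite cint_cst_dyad /av -mulrA [_ * Complex (sid p ^+ d) 0]mulrC mulrA.
    by rewrite complexMr divff ?lt0r_neq0// mul1r subrr.
Qed.

End bad_function.

(** * Comparison inside a cube *)

Section local_bound.
Context {R : realType} {d : nat}.
Local Notation leb := (@lebesgue_nd R d).
Local Notation C := (complex R).
Local Notation Rd := (d.-tuple R).
Local Notation idx := (nat * d.-tuple nat)%type.
Implicit Types (x y : Rd) (p : idx) (J : set idx).

Hypothesis d0 : (0 < d)%N.
Variables (K : Rd -> Rd -> C) (om : R -> R) (W cK : R).
Hypothesis omW : dini_bound om W.
Hypothesis stdK : std_kernel K om cK.
Variables (a : Rd) (l : R) (rho : R).
Hypothesis l0 : 0 < l.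
Hypothesis rho2 : 2 < rho.
Local Notation nice := (nice a l).
Local Notation cor p := (dyad_corner a l p).
Local Notation sid p := (dyad_side l p).
Let kap := @sep_ratio R d.
Let cK0 : 0 <= cK. Proof. by have [] := stdK. Qed.
Let d1 : 1 <= d%:R :> R. Proof. by rewrite ler1n. Qed.
Let kd0 : 0 <= kap ^+ d.
Proof. by rewrite exprn_ge0// /kap /sep_ratio addr_ge0// mulr_ge0. Qed.

Lemma var_op_add (f g h : Rd -> C) x : nice f -> nice g -> nice h -> (forall y, f y = g y + h y) ->
  (var_op K rho f x <= var_op K rho g x + var_op K rho h x)%E.
Proof.
move=> nf ng nh fgh; apply: (var_opD omW stdK l0 rho2 x nf ng nh).
rewrite (_ : [set y | _] = set0); first exact: negligible_set0.
by apply/seteqP; split => // y /=; rewrite fgh eqxx.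
Qed.

Variables (f g b : Rd -> C) (G : set idx) (M A2 : R).
Hypotheses (nf : nice f) (ng : nice g) (nb : nice b).
Hypothesis M0 : 0 <= M.
Hypothesis gM : forall y, cmod (g y) <= M.
Hypothesis fgb : negligible leb [set y | f y != g y + b y].
Hypothesis dG : disjoint_dyadic_family a l G.
Hypothesis bG : forall y, ~ union a l G y -> b y = 0.
Hypothesis bM : forall p, G p -> (\int[leb]_(y in dyad a l p) (cmod (b y))%:E <= (2 * M * sid p ^+ d)%:E)%E.
Hypothesis b0 : forall p, G p -> cint (dyad a l p) b = 0.

(** Excludes the two ways in which a point can be exceptional for [b]; [bad_var_bound] then applies
    with [Hm = 1]. *)
Definition regular_point x := (forall p, G p -> kap * sid p <= dist x (cor p)) /\
  (forall n, tail_at a l om G n x <= 1).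

Let kap3 : 3 <= kap. Proof. by rewrite /kap /sep_ratio; have := d1; lra. Qed.

Lemma regular_sep x p y : regular_point x -> G p -> dyad a l p y ->
  [/\ 0 < dist x (cor p), dist x (cor p) - d%:R * sid p <= dist x y & dist x (cor p) <= kap * dist x y].
Proof.
move=> [reg _] Gp py; have s0 := dyad_side_gt0 l0 p; have D := reg p Gp.
have ds : 0 <= d%:R * sid p by rewrite mulr_ge0// ltW.
have D' : sid p + 2 * (d%:R * sid p) <= dist x (cor p).
  by move: D; rewrite /kap /sep_ratio mulrDl mul1r mulrA.
have h1 : dist x (cor p) - d%:R * sid p <= dist x y.
  have := dist_triangle y x (cor p); have := cube_dist_le py; rewrite [dist y _]distC.
  by set t := d%:R * _ => h2 h3; lra.
split => //; first lra.
apply: (@le_trans _ _ (3 * dist x y)); last by apply: ler_wpM2r => //; exact: dist_ge0.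
by set t := d%:R * _ in h1 D' ds; lra.
Qed.

(** The trailing 2 is that of the bound [2 * M] on the means of [|b|] over the pieces. *)
Definition bad_const (Hm : R) : R := root_bound d (2 * (cK * kap ^+ d)) Hm * 2.

Lemma var_op_regular x : regular_point x ->
  (var_op K rho f x <= var_op K rho g x + (bad_const 1 * M)%:E)%E.
Proof.
move=> reg; apply: le_trans (var_opD omW stdK l0 rho2 x nf ng nb fgb) _; apply: leeD => //.
rewrite /bad_const -mulrA; apply: (bad_var_bound d0 omW stdK l0 rho2 nb _ _ dG) => //.
- exact: mulr_ge0.
- by move=> p Gp; have [] := regular_sep reg Gp (dyad_corner_in a l0 p).
- by move=> p y Gp py; have [] := regular_sep reg Gp py.
- by case: reg.
Qed.

Variables (p : idx) (x0 x' : Rd).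
Hypothesis dp : dyadic_index p.
Hypotheses (px0 : dyad a l p x0) (px' : dyad a l p x').
Hypothesis reg0 : regular_point x0.
Hypothesis Vg : (var_op K rho g x0 <= (A2 * M)%:E)%E.
Hypothesis Vg3 : (var_op K rho (fun y => ((\1_(triple a l p) y : C) * g y)%R) x0 <= (A2 * M)%:E)%E.

Let s0 : 0 < sid p. Proof. exact: dyad_side_gt0. Qed.
Let T := triple a l p.
Let mT : measurable T. Proof. exact: measurable_triple. Qed.
Let out (h : Rd -> C) y : C := (\1_(~` T) y : C) * h y.
Let nout h : nice h -> nice (out h).
Proof. by move=> nh; apply: nice_indic => //; exact: measurableC. Qed.

Definition level_const : R := 12 * d%:R * (1 + d%:R) ^+ d.+1 * (4 ^+ d * W).

Let level_const_ge0 : 0 <= level_const.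
Proof.
have W0 := dini_bound_ge0 omW.
by rewrite /level_const !mulr_ge0// ?exprn_ge0// addr_ge0.
Qed.

(** Off the triple, [g] is [g - g 1_T], so the two bounds at [x0] give [2 A2 M] there. The move from
    [x0] to [x'] is paid for by the small oscillation of the kernel outside the triple. *)
Lemma good_out_bound : (var_op K rho (out g) x' <=
  (2 * A2 * M + root_bound d (2 * (cK * kap ^+ d)) level_const * M)%:E)%E.
Proof.
have nog := nout ng.
pose inner y : C := (\1_T y : C) * g y.
have ni : nice inner by exact: nice_indic.
have h1 : (var_op K rho (out g) x0 <= (2 * A2 * M)%:E)%E.
  apply: le_trans (var_op_add x0 nog ng (niceN ni) _) _.
    move=> y; rewrite /out /inner !indicE; have [Ty|Ty] := pselect (T y).
      by rewrite memNset ?(mem_set Ty) ?mul0r ?mul1r ?subrr// => /(_ Ty).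
    by rewrite mem_set ?(memNset Ty) ?mul0r ?mul1r ?subr0.
  rewrite (var_opN omW stdK l0 rho2 x0 ni).
  have -> : 2 * A2 * M = A2 * M + A2 * M by ring.
  by rewrite [leRHS]EFinD; apply: leeD; [exact: Vg|exact: Vg3].
rewrite EFinD; apply: le_trans (leeD h1 (lexx _)).
have k0 : 0 <= 2 * (cK * kap ^+ d * M) by rewrite !mulr_ge0.
rewrite -root_boundZ; apply: (var_op_shift omW stdK l0 rho2 nog); first exact: root_bound_ge0.
move=> e N ze.
pose I := (d.-tuple 'I_(2 ^ p.1))%type.
pose q (j : I) : idx := (p.1, [tuple (tnth j i : nat) | i < d]).
have dq j : dyadic_index (q j) by move=> i; rewrite tnth_mktuple.
(* The cubes of the generation of [p] that miss the triple tile the rest of the big cube. They all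
   have the side of [p], so [tail_sum_level_le] bounds their tail sum. *)
pose P : pred I := fun j => `[< dyad a l (q j) `&` T = set0 >].
have Pdist j y x : P j -> dyad a l p x -> dyad a l (q j) y -> sid p <= dist x y.
  move=> /asboolP Pj px qy; apply: (dist_out_triple px) => Ty.
  by have /seteqP[h _] := Pj; exact: (h y).
have disj j j' : P j -> P j' -> j != j' ->
    cube (cor (q j)) (sid (q j)) `&` cube (cor (q j')) (sid (q j')) = set0.
  move=> _ _ jj'; apply: contrapT => /eqP/set0P h; move/eqP: jj'; apply.
  have qq := dyad_index_inj l0 (dq j) (dq j') erefl h.
  apply: eq_from_tnth => i; apply: val_inj.
  by have := congr1 (fun t : idx => tnth t.2 i) qq; rewrite !tnth_mktuple.
have cq j : dyad a l (q j) (cor (q j)) by exact: dyad_corner_in.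
have xx : dist x0 x' <= d%:R * sid p by exact: dist_dyad px'.
have tl : tail_sum P (fun j => cor (q j)) (fun j => sid (q j)) x0 om <= level_const.
  apply: (@tail_sum_level_le R d om W omW I P (fun j => cor (q j)) (fun j => sid (q j)) (fun j _ => s0) disj x0 (sid p) s0) => //.
  by move=> j y Pj; exact: Pdist.
have tl0 : 0 <= tail_sum P (fun j => cor (q j)) (fun j => sid (q j)) x0 om.
  by apply: tail_sum_ge0 => [t|j _]; [have [_ + _ _ _] := omW; exact|exact: ltW].
apply: le_trans (square_bound_le d k0 tl0 tl).
apply: (@good_part_bound R d d0 K om W cK omW stdK a l l0 I P (fun j => cor (q j)) (fun j => sid (q j))
  (fun j _ => s0) disj (out g) x0 x' M e N nog M0) => //.
- by move=> y; apply: le_trans (gM y); exact: cmod_indicM_le.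
- move=> y hy; have [_ _ gQ] := ng.
  have [Qy|Qy] := pselect (cube a l y); last by rewrite /out gQ// mulr0.
  have [Ty|Ty] := pselect (T y).
    by rewrite /out indicE memNset ?mul0r// => /(_ Ty).
  pose j : I := [tuple Ordinal (dyadic_index_code l0 p.1 Qy i) | i < d].
  have qj : q j = (p.1, dyad_code a l p.1 y).
    by congr pair; apply: eq_from_tnth => i; rewrite !tnth_mktuple.
  have jy : dyad a l (q j) y by rewrite qj; apply/(dyad_codeP l0 _ Qy).
  exfalso; apply: (hy j) => //; apply/asboolP; apply: contrapT => /eqP/set0P h.
  by apply: Ty; apply: (small_sub_triple l0 (dq j) _ h jy).
- by move=> j Pj; apply: lt_le_trans (Pdist j _ _ Pj px0 (cq j)).
- move=> j y Pj jy; have h := Pdist j y _ Pj px0 jy; have hc := cube_dist_le jy.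
  have := dist_triangle y x0 (cor (q j)); rewrite [dist y _]distC => h2.
  have h3 : d%:R * sid p <= d%:R * dist x0 y by exact: ler_wpM2l.
  have h4 := dist_ge0 x0 y.
  apply: le_trans h2 _; rewrite /kap /sep_ratio mulrDl mul1r lerD2l; apply: le_trans hc _.
  by apply: le_trans h3 _; rewrite -mulrA ler_peMl ?ler1n// mulr_ge0.
- move=> j y Pj jy; have h := Pdist j y _ Pj px' jy; have hc := cube_dist_le jy.
  have := dist_triangle y x0 (cor (q j)); rewrite [dist y _]distC => h2.
  have h5 := dist_triangle x' x0 y.
  have h3 : d%:R * sid p <= d%:R * dist x' y by exact: ler_wpM2l.
  rewrite /kap /sep_ratio mulrDl mul1r -mulrA; move: hc h3 xx.
  by rewrite /dyad_side /=; set t := d%:R * (l / _); set u := d%:R * dist x' y => hc h3 xx; lra.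
Qed.

(** Each piece is inside the triple or disjoint from it, so cutting [b] off the triple keeps the
    means zero. The point [x'] may itself be exceptional; its tail sum is compared with that at
    [x0]. *)
Lemma bad_out_bound : (var_op K rho (out b) x' <= (bad_const ((1 + d%:R) ^+ d.+1) * M)%:E)%E.
Proof.
pose J := [set p' | G p' /\ dyad a l p' `&` T = set0].
have [dGi disG] := dG; have [om0 reg_tail] := (let: And5 _ h _ _ _ := omW in h, reg0.2).
have JG : J `<=` G by move=> p' [].
have dJ : disjoint_dyadic_family a l J.
  by split => [p' /JG/dGi//|p1 p2 /JG h1 /JG h2]; exact: disG.
(* a piece larger than [p] and meeting its triple would put [x0] too close to the corner of the piece *)
have inJ p' y : G p' -> dyad a l p' y -> ~ T y -> J p'.
  move=> Gp' p'y Ty; split => //; apply: contrapT => /eqP/set0P h.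
  have [le|lt] := leqP p.1 p'.1.
    by apply: Ty; exact: (small_sub_triple l0 (dGi _ Gp') le h p'y).
  have [z [p'z Tz]] := h.
  have s' : 2 * sid p <= sid p'.
    rewrite /dyad_side mulrCA ler_pM2l// ler_pdivrMr ?exprn_gt0// [leRHS]mulrC ler_pdivlMr ?exprn_gt0//.
    by rewrite -exprS ler_eXn2l ?ltr1n.
  have [D0 h1 _] := regular_sep reg0 Gp' p'z.
  have h2 := dist_triple px0 Tz.
  have := reg0.1 p' Gp'; rewrite /kap /sep_ratio mulrDl mul1r -mulrA.
  have sp0 := dyad_side_gt0 l0 p'.
  have h3 : d%:R * (2 * sid p) <= d%:R * sid p' by exact: ler_wpM2l.
  by move: h1 h2 h3; set t := d%:R * sid p'; set u := d%:R * _ => h1 h2 h3 h4; lra.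
have far p' y : J p' -> dyad a l p' y -> forall x, dyad a l p x -> sid p <= dist x y.
  move=> [_ /seteqP[h _]] py x px; apply: (dist_out_triple px) => Ty; exact: (h y).
have xx : dist x0 x' <= d%:R * sid p by exact: dist_dyad px'.
have sep p' y : J p' -> dyad a l p' y -> dist x' (cor p') <= (1 + d%:R) * dist x' y.
  move=> Jp' py; have fy := far p' y Jp' py x' px'.
  have tr := dist_triangle y x' (cor p'); have hc := cube_dist_le py; rewrite [dist y _]distC in tr.
  have sp0 := dyad_side_gt0 l0 p'.
  (* For a piece no larger than [p] this is its position outside the triple; for a larger one it
     follows from the regularity of [x0]. *)
  suff h : sid p' <= dist x' y.
    rewrite mulrDl mul1r; apply: le_trans tr _; rewrite lerD2l; apply: le_trans hc _.
    exact: ler_wpM2l.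
  have [le|lt] := leP (sid p') (sid p); first exact: le_trans fy.
  have [D0 h1 _] := regular_sep reg0 (JG _ Jp') py.
  have := reg0.1 p' (JG _ Jp'); rewrite /kap /sep_ratio mulrDl mul1r -mulrA.
  have tr2 := dist_triangle x' x0 y.
  have h3 : d%:R * sid p <= d%:R * sid p' by apply: ler_wpM2l => //; exact: ltW.
  by move: h1 h3 xx; set t := d%:R * sid p'; set u := d%:R * sid p => h1 h3 xx h4; lra.
(* The distance from [x0] to the corner is at most [1 + d] times that from [x']. In the tail sum
   this costs [(1 + d) ^ (d + 1)]: one factor through [om], and [d] of them through the power of the
   distance. *)
have comp p' : J p' -> dist x0 (cor p') <= (1 + d%:R) * dist x' (cor p') /\ 0 < dist x' (cor p').
  move=> Jp'; have fy := far p' _ Jp' (dyad_corner_in a l0 p') x' px'.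
  split; last exact: lt_le_trans fy.
  apply: le_trans (dist_triangle x' _ _) _; rewrite mulrDl mul1r addrC lerD2l.
  by apply: le_trans xx _; exact: ler_wpM2l.
have d10 : 0 < 1 + d%:R :> R by rewrite ltr_wpDr.
rewrite /bad_const -mulrA; apply: (bad_var_bound d0 omW stdK l0 rho2 (nout nb) _ _ dJ) => //.
- exact: mulr_ge0.
- move=> y hy; have [Ty|Ty] := pselect (T y).
    by rewrite /out indicE memNset ?mul0r// => /(_ Ty).
  rewrite /out bG ?mulr0// => -[p' Gp' p'y]; apply: hy; exists p' => //; exact: inJ p'y Ty.
- move=> p' Jp'; apply: le_trans (bM (JG _ Jp')); have [mb _ _] := nb.
  have [mo _ _] := nout nb.
  apply: ge0_le_integral_real; [exact: measurable_dyad|exact: cmeasurable_cmod|exact: cmeasurable_cmod|].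
  by move=> y _; rewrite cmod_ge0/=; exact: cmod_indicM_le.
- move=> p' Jp'; rewrite -[RHS](b0 (JG _ Jp')); apply: cint_eq => y p'y.
  rewrite /out indicE mem_set ?mul1r// => Ty.
  by case: Jp' => _ /seteqP[h _]; exact: (h y).
- by move=> p' /comp[].
- move=> p' y Jp' py; apply: le_trans (sep p' y Jp' py) _; apply: ler_wpM2r; first exact: dist_ge0.
  by rewrite /kap /sep_ratio; have := d1; lra.
move=> n; apply: (@le_trans _ _ ((1 + d%:R) ^+ d.+1 * tail_at a l om G n x0)); last first.
  by rewrite ler_piMr// ?exprn_ge0// ltW.
have [omh _ _ omn _] := omW.
rewrite /tail_at /tail_sum mulr_sumr big_mkcond [leRHS]big_mkcond; apply: ler_sum => j _.
have term0 q x : 0 <= sid q ^+ d * (om (far_ratio d * sid q / dist x (cor q)) * (dist x (cor q) ^+ d)^-1).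
  rewrite mulr_ge0 ?mulr_ge0 ?invr_ge0 ?exprn_ge0 ?dist_ge0//; exact/ltW/dyad_side_gt0.
case: ifP => hj; last by case: ifP => // _; rewrite mulr_ge0// exprn_ge0// ltW.
rewrite (in_fam_sub JG hj); have [Jj _] := in_famP hj; set q := idx_at j in Jj *.
have [cmp D'0] := comp q Jj; have sq := dyad_side_gt0 l0 q.
have D00 : 0 < dist x0 (cor q).
  by have [] := regular_sep reg0 (JG _ Jj) (dyad_corner_in a l0 q).
have inv : (dist x' (cor q))^-1 <= (1 + d%:R) * (dist x0 (cor q))^-1.
  by rewrite -[leLHS]div1r ler_pdivrMr// mulrAC ler_pdivlMr// mul1r.
rewrite [leRHS]mulrCA; apply: ler_wpM2l; first by rewrite exprn_ge0// ltW.
have -> : (1 + d%:R) ^+ d.+1 * (om (far_ratio d * sid q / dist x0 (cor q)) * (dist x0 (cor q) ^+ d)^-1) =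
  ((1 + d%:R) * om (far_ratio d * sid q / dist x0 (cor q))) * ((1 + d%:R) ^+ d * (dist x0 (cor q) ^+ d)^-1).
  by rewrite exprS; ring.
have far0 : 0 <= far_ratio d * sid q :> R by rewrite mulr_ge0 ?(ltW sq)// mulr_ge0.
apply: ler_pM => //; first by rewrite invr_ge0 exprn_ge0// ltW.
  have -> : 1 + d%:R = (1 + d)%:R :> R by rewrite natrD.
  apply: le_trans (omn _ _ _); last by rewrite divr_ge0// ltW.
  by apply: omh; rewrite natrD [leRHS]mulrCA; apply: ler_wpM2l.
by rewrite -!exprVn -exprMn; apply: lerXn2r; rewrite ?nnegrE ?invr_ge0 ?mulr_ge0 ?invr_ge0 ?dist_ge0// ltW.
Qed.

Definition local_const : R := 2 * A2 + root_bound d (2 * (cK * kap ^+ d)) level_const +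
  bad_const ((1 + d%:R) ^+ d.+1).

Lemma local_bound : (var_op K rho (out f) x' <= (local_const * M)%:E)%E.
Proof.
apply: le_trans (var_opD omW stdK l0 rho2 x' (nout nf) (nout ng) (nout nb) _) _.
  apply: negligibleS fgb => y /= /eqP h; apply/eqP => h'; apply: h.
  by rewrite /out h' mulrDr.
rewrite /local_const mulrDl EFinD; apply: leeD; last exact: bad_out_bound.
by rewrite mulrDl; exact: good_out_bound.
Qed.

End local_bound.

(** * Irregular points, and finiteness of the variation almost everywhere *)

Section exceptional.
Context {R : realType} {d : nat}.
Local Notation leb := (@lebesgue_nd R d).
Local Notation C := (complex R).
Local Notation Rd := (d.-tuple R).
Local Notation idx := (nat * d.-tuple nat)%type.
Implicit Types (x y : Rd) (p : idx).

Lemma measure_increasing_le (F : nat -> set Rd) (B : \bar R) : (forall n, measurable (F n)) ->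
  (forall n m, (n <= m)%N -> F n `<=` F m) -> (forall n, leb (F n) <= B)%E -> (leb (\bigcup_n F n) <= B)%E.
Proof.
move=> mF hF hB; have mU : measurable (\bigcup_n F n) by exact: bigcupT_measurable.
have cv : leb (F n) @[n --> \oo] --> leb (\bigcup_n F n).
  by apply: (nondecreasing_cvg_mu mF mU) => n m nm; rewrite subsetEset; exact: hF.
rewrite -(cvg_lim _ cv)//; apply: lime_le; first by apply/cvg_ex; eexists; exact: cv.
exact: nearW.
Qed.

Hypothesis d0 : (0 < d)%N.
Variables (om : R -> R) (W : R).
Hypothesis omW : dini_bound om W.
Variables (a : Rd) (l : R).
Hypothesis l0 : 0 < l.
Local Notation cor p := (dyad_corner a l p).
Local Notation sid p := (dyad_side l p).
Let kap := @sep_ratio R d.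

(** The first term counts balls of radius [kap * s] about the corners, each inside a cube of side
    [2 * kap * s]; the second is the constant of [tail_term_integral_le]. *)
Definition exceptional_const : R := (2 * kap) ^+ d + 12 * d%:R * (4 ^+ d * W).

Let kap0 : 0 <= kap. Proof. by rewrite /kap /sep_ratio addr_ge0// mulr_ge0. Qed.

(* Points near a piece are counted by volumes, points with a large tail sum by Chebyshev. *)
Lemma irregular_points (G : set idx) (S : R) : (\esum_(p in G) (sid p ^+ d)%:E <= S%:E)%E ->
  exists Z, [/\ measurable Z, (forall x, ~ Z x -> regular_point om a l G x) &
    (leb Z <= (exceptional_const * S)%:E)%E].
Proof.
move=> GS; have [omh om0 _ _ _] := omW; have W0 := dini_bound_ge0 omW.
have sumS n : \sum_(j < n | in_fam G j) sid (@idx_at d j) ^+ d <= S.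
  by rewrite -lee_fin; apply: le_trans GS; exact: sum_pieces_le_esum.
pose ball j := if in_fam G j then eball (cor (@idx_at d j)) (kap * sid (@idx_at d j)) else set0.
have mball j : measurable (ball j) by rewrite /ball; case: ifP => // _; exact: measurable_eball.
pose near := \bigcup_j ball j.
have mnear : measurable near by exact: bigcupT_measurable.
have near_le : (leb near <= ((2 * kap) ^+ d * S)%:E)%E.
  apply: le_trans (measure_sigma_subadditive leb mball mnear (@subset_refl _ _)) _.
  apply: nneseries_le_bound => // n.
  apply: (@le_trans _ _ (\sum_(j < n | in_fam G j) ((2 * kap) ^+ d * sid (@idx_at d j) ^+ d))%:E).
    rewrite -sumEFin [leRHS]big_mkcond; apply: lee_sum => j _; rewrite /ball; case: ifP => [_|_].
      rewrite -exprMn -mulrA; apply: lebesgue_eball_le.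
      by rewrite mulr_ge0// ltW// dyad_side_gt0.
    by rewrite measure0.
  by rewrite lee_fin -mulr_sumr; apply: ler_wpM2l => //; rewrite exprn_ge0// mulr_ge0.
pose A j := [set x : Rd | kap * sid (@idx_at d j) <= dist x (cor (@idx_at d j))].
have mA j : measurable (A j).
  rewrite (_ : A j = dist (cor (@idx_at d j)) @^-1` `[kap * sid (@idx_at d j), +oo[%classic).
    by rewrite -[X in measurable X]setTI; exact: measurable_distr.
  by apply/seteqP; split => y /=; rewrite /A /= in_itv/= andbT distC.
pose t j x : R := sid (@idx_at d j) ^+ d *
  (om (far_ratio d * sid (@idx_at d j) / dist x (cor (@idx_at d j))) * (dist x (cor (@idx_at d j)) ^+ d)^-1).
have s0 j : 0 <= sid (@idx_at d j) by exact/ltW/dyad_side_gt0.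
have t0 j x : 0 <= t j x by rewrite mulr_ge0 ?exprn_ge0// mulr_ge0// invr_ge0 exprn_ge0// dist_ge0.
have mt j : measurable_fun setT (t j).
  apply: measurable_funM => //.
  rewrite (_ : (fun y => _) = (fun y => om ((far_ratio d * sid (@idx_at d j)) / dist (cor (@idx_at d j)) y) *
      (dist (cor (@idx_at d j)) y ^+ d)^-1)); first exact: (measurable_tail omW _ (far_ratio d * sid (@idx_at d j))).
  by apply/funext => y; rewrite distC.
(* Each term is cut to the complement of the ball about its corner, where its integral is
   controlled. At points outside [near] the cut changes nothing. *)
pose u j x : R := if in_fam G j then \1_(A j) x * t j x else 0.
have u0 j x : 0 <= u j x by rewrite /u; case: ifP => // _; rewrite mulr_ge0.
have mu_ j : measurable_fun setT (u j).
  by rewrite /u; case: in_fam => //; apply: measurable_funM => //; exact: measurable_indic.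
pose H n x : R := \sum_(j < n) u j x.
have mH n : measurable_fun setT (H n) by apply: measurable_sum => j; exact: mu_.
have H0 n x : 0 <= H n x by apply: sumr_ge0.
have intH n : (\int[leb]_x (H n x)%:E <= (12 * d%:R * (4 ^+ d * W) * S)%:E)%E.
  rewrite /H; under eq_integral do rewrite -sumEFin.
  rewrite ge0_integral_sum//; first last.
  - by move=> j x _; rewrite lee_fin.
  - by move=> j; apply/measurable_EFinP; exact: mu_.
  apply: (@le_trans _ _ (\sum_(j < n | in_fam G j) (sid (@idx_at d j) ^+ d * (12 * d%:R * (4 ^+ d * W))))%:E).
    rewrite -sumEFin [leRHS]big_mkcond; apply: lee_sum => j _; rewrite /u; case: ifP => [_|_]; last first.
      by rewrite integral0_eq.
    rewrite (_ : (\int[leb]_x _ = \int[leb]_(x in A j) (t j x)%:E)%E); last first.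
      rewrite [RHS]integral_mkcond; apply: eq_integral => x _; rewrite patchE indicE.
      by case: ifP => _; rewrite ?mul1r ?mul0r.
    by apply: tail_term_integral_le => //; exact: dyad_side_gt0.
  rewrite lee_fin -mulr_suml mulrC; apply: ler_wpM2l => //.
  by rewrite !mulr_ge0// exprn_ge0.
pose heavy n := [set x | 1 < H n x].
have mheavy n : measurable (heavy n).
  rewrite (_ : heavy n = H n @^-1` `]1, +oo[%classic).
    by rewrite -[X in measurable X]setTI; exact: mH.
  by apply/seteqP; split => y /=; rewrite in_itv/= andbT.
have heavy_le : (leb (\bigcup_n heavy n) <= (12 * d%:R * (4 ^+ d * W) * S)%:E)%E.
  apply: measure_increasing_le => //.
    move=> n m nm x; rewrite /heavy /= => /lt_le_trans; apply.
    rewrite /H (big_ord_widen m (fun j => u j x) nm) big_mkcond; apply: ler_sum => j _.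
    by case: ifP.
  move=> n; apply: le_trans (intH n); rewrite -[leLHS]mul1e.
  apply: (@le_trans _ _ (\int[leb]_(x in heavy n) (H n x)%:E)%E).
    by apply: ge0_cst_le_integral => // x /ltW.
  exact: ge0_subset_integral_real.
exists (near `|` \bigcup_n heavy n); split.
- by apply: measurableU => //; exact: bigcupT_measurable.
- move=> x hx; have far p : G p -> kap * sid p <= dist x (cor p).
    move=> Gp; rewrite leNgt; apply/negP => h; apply: hx; left.
    have [h1 h2] := in_fam_pickle Gp.
    by exists (pickle p) => //; rewrite /ball h1 h2 /eball /= distC.
  split => // n; rewrite leNgt; apply/negP => h; apply: hx; right; exists n => //.
  apply: lt_le_trans h _; rewrite /tail_at /tail_sum /H big_mkcond; apply: ler_sum => j _.
  rewrite /u; case: ifP => // hj; have [Gj _] := in_famP hj.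
  by rewrite indicE mem_set ?mul1r//; exact: far.
- apply: le_trans (measureU2 _ _ _) _ => //; first exact: bigcupT_measurable.
  by rewrite /exceptional_const mulrDl EFinD; apply: leeD.
Qed.

Variables (K : Rd -> Rd -> C) (cK rho q : R).
Hypothesis stdK : std_kernel K om cK.
Hypothesis rho2 : 2 < rho.
Hypothesis q1 : 1 < q.
Hypothesis Vq : var_Lq_bounded K rho q.
Local Notation nice := (nice a l).

Lemma measurable_var_op_gt f (t : R) : nice f -> measurable [set x | (t%:E < var_op K rho f x)%E].
Proof.
move=> nf; have mV := measurable_var_op omW stdK l0 rho2 nf.
by have := emeasurable_fun_o_infty measurableT mV t%:E; rewrite setTI.
Qed.

(** The difference in the conclusion is taken in the extended reals, so [V f] has to be finite.
    Chebyshev with [del] arbitrarily small shows that the set where it is infinite is null. *)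
Lemma var_op_fin_ae f : nice f -> negligible leb [set x | var_op K rho f x = +oo%E].
Proof.
move=> nf; have [_ [M hM] fQ] := nf; have mQ := @measurable_cube R d a l.
pose S := \bigcap_n [set x | (n%:R%:E < var_op K rho f x)%E].
have mS : measurable S by apply: bigcapT_measurable => n; exact: measurable_var_op_gt.
exists S; split => //; last by move=> x /= Vx n _ /=; rewrite Vx ltry.
apply/eqP; rewrite eq_le measure_ge0 andbT; apply/lee_addgt0Pr => e e0; rewrite add0e.
have M0 : 0 <= M by apply: le_trans (hM a); exact: cmod_ge0.
have ld0 : 0 < l ^+ d by rewrite exprn_gt0.
have e'0 : 0 < e / l ^+ d by rewrite divr_gt0.
have [A2 A20 hA] := var_op_weak omW stdK rho2 q1 Vq e'0.
have M10 : 0 < M + 1 by rewrite ltr_wpDl.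
have M1 y : cmod (f y) <= M + 1 by apply: le_trans (hM y) _; rewrite lerDl.
have := hA a l l0 f (cube a l) (M + 1) nf mQ M10 M1 fQ.
have /= -> := lebesgue_nd_cube a (ltW l0); rewrite -EFinM divfK ?gt_eqF//; apply: le_trans.
apply: le_measure; rewrite ?inE//; first exact: measurable_var_op_gt.
move=> x Sx /=; apply: le_lt_trans (Sx (Num.truncn (A2 * (M + 1))).+1 I).
by rewrite lee_fin ltW// truncnS_gt.
Qed.

End exceptional.

(** * The sparse step *)

Section main_step.
Context {R : realType} {d : nat}.
Local Notation leb := (@lebesgue_nd R d).
Local Notation C := (complex R).
Local Notation Rd := (d.-tuple R).
Local Notation idx := (nat * d.-tuple nat)%type.
Implicit Types (x y : Rd) (p : idx) (a : Rd) (l : R).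

Lemma esum_single (A : set idx) (p : idx) (t : idx -> \bar R) : A p -> (0 <= t p)%E ->
  (forall p', A p' -> p' <> p -> t p' = 0%E) -> (\esum_(i in A) t i = t p)%E.
Proof.
move=> Ap tp0 h; rewrite -(esum_set1 tp0).
have -> : [set p] = A `&` [set p] by apply/seteqP; split => [_ ->//|_ [_ ->]].
rewrite esum_mkcondr; apply: eq_esum => i Ai; case: ifPn => // /negP ip.
by apply: h => // ip'; apply: ip; rewrite inE.
Qed.

Lemma abse_diff_le (u v w : \bar R) (B : R) : (0 <= u)%E -> u != +oo%E -> (0 <= v)%E -> (w <= B%:E)%E ->
  (u <= v + w)%E -> (v <= u + w)%E -> (`|u - v| <= B%:E)%E.
Proof.
case: u => [u| |]// _ _; case: v => [v| |]//; case: w => [w| |]//=.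
by rewrite !lee_fin => _ wB uv vu; rewrite ler_norml; apply/andP; split; lra.
Qed.

Lemma cube_sub_dil3 a l : 0 < l -> cube a l `<=` dil_cube 3 a l.
Proof.
by move=> l0 y Qy i; rewrite tnth_mktuple; have /andP[h1 h2] := Qy i; apply/andP; split; lra.
Qed.

(** A cube of [F] containing [p] lies in some cube of [Fb]; by disjointness that cube is [p]. This
    is what makes the third clause of [stopping_time] available on covering families. *)
Lemma dyad_in_cover a l (F Fb : set idx) p : (0 < d)%N -> 0 < l -> disjoint_dyadic_family a l F ->
  disjoint_dyadic_family a l Fb -> covers a l Fb F -> Fb p ->
  forall p', F p' -> dyad a l p `<=` dyad a l p' -> p' = p.
Proof.
move=> d0 l0 [dF _] [dFb disFb] cov Fbp p' Fp' sub.
have [p'' Fbp'' sub'] := cov _ Fp'.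
have pp'' : p'' = p.
  apply: contrapT => h; have /seteqP[h' _] := disFb _ _ Fbp'' Fbp h.
  have c := dyad_corner_in a l0 p; apply: (h' (dyad_corner a l p)); split => //.
  exact/sub'/sub.
rewrite pp'' in sub'.
have le1 := dyad_subset_index l0 (dFb _ Fbp) (dF _ Fp') d0 sub.
have le2 := dyad_subset_index l0 (dF _ Fp') (dFb _ Fbp) d0 sub'.
apply: (dyad_index_inj l0 (dF _ Fp') (dFb _ Fbp)).
  by apply/eqP; rewrite eqn_leq le1 le2.
by exists (dyad_corner a l p'); split; [|apply: sub']; exact: dyad_corner_in.
Qed.

Hypothesis d0 : (0 < d)%N.
Variables (K : Rd -> Rd -> C) (om : R -> R) (W cK rho q : R).
Hypothesis omW : dini_bound om W.
Hypothesis stdK : std_kernel K om cK.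
Hypothesis rho2 : 2 < rho.
Hypothesis q1 : 1 < q.
Hypothesis Vq : var_Lq_bounded K rho q.

Let cK0 : 0 <= cK. Proof. by have [] := stdK. Qed.
Let W0 : 0 <= W. Proof. exact: dini_bound_ge0 omW. Qed.
Let kap0 : 0 <= @sep_ratio R d. Proof. by rewrite /sep_ratio addr_ge0// mulr_ge0. Qed.

Lemma bad_const_ge0 (H : R) : 0 <= H -> 0 <= @bad_const R d cK H.
Proof. by move=> H0; rewrite mulr_ge0// root_bound_ge0// !mulr_ge0// exprn_ge0. Qed.

Lemma local_const_ge0 (A2 : R) : 0 <= A2 -> 0 <= @local_const R d W cK A2.
Proof.
move=> A20; have d10 : 0 <= 1 + d%:R :> R by rewrite addr_ge0.
rewrite /local_const !addr_ge0//; first exact: mulr_ge0.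
  rewrite root_bound_ge0//; first by rewrite !mulr_ge0// exprn_ge0.
  by rewrite /level_const !mulr_ge0// exprn_ge0.
by apply: bad_const_ge0; exact: exprn_ge0.
Qed.

Lemma exceptional_const_ge0 : 0 <= @exceptional_const R d W.
Proof. by rewrite /exceptional_const addr_ge0// ?exprn_ge0 ?mulr_ge0// exprn_ge0. Qed.

Lemma local_average_small (E B D : set Rd) (v : R) : measurable E -> measurable B -> measurable D ->
  0 < v -> leb D = v%:E -> (leb (E `&` D) <= (v / 2)%:E)%E -> (leb B <= (v / 4)%:E)%E ->
  exists x, [/\ D x, ~ E x & ~ B x].
Proof.
move=> mE mB mD v0 Dv hE hB; apply: contrapT => h.
have sub : D `<=` (E `&` D) `|` B.
  move=> x Dx; apply: contrapT => /not_orP[h1 h2]; apply: h; exists x; split => // Ex.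
  by apply: h1.
have mED : measurable (E `&` D) by exact: measurableI.
have : (v%:E <= (v / 2)%:E + (v / 4)%:E)%E.
  rewrite -Dv; apply: (@le_trans _ _ (leb ((E `&` D) `|` B))).
    by apply: le_measure; rewrite ?inE//; exact: measurableU.
  by apply: le_trans (measureU2 _ mED mB) _; exact: leeD.
by rewrite -EFinD lee_fin => h'; lra.
Qed.

Lemma sparse_step_trivial a l f : 0 < l -> nice a l f ->
  (\int[leb]_(x in cube a l) (cmod (f x))%:E = 0)%E ->
  forall x F, var_op K rho f x = 0%E /\ localized_sum K rho f a l F x = 0%E.
Proof.
move=> l0 nf If0 x F; have [mf _ fQ] := nf; have mcf := cmeasurable_cmod mf.
have mQ := @measurable_cube R d a l.
have f0 : negligible leb [set y | f y != 0].
  have /(ae_eq_integral_abs _ mQ) : (\int[leb]_(x in cube a l) `|(cmod (f x))%:E| = 0)%E.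
    by rewrite -[RHS]If0; apply: eq_integral => y _; rewrite gee0_abs// lee_fin cmod_ge0.
  have mE : measurable_fun (cube a l) (fun x => (cmod (f x))%:E).
    by apply/measurable_EFinP; exact: measurable_funTS.
  move=> /(_ mE) h; apply: negligibleS h => y /= fy h; move/eqP: fy; apply.
  have [Qy|/fQ//] := pselect (cube a l y).
  have [h'] := h Qy; apply/eqP; rewrite eq_complex /=.
  have := cmod_Re (f y); have := cmod_Im (f y); rewrite h' !normr_le0 => /eqP -> /eqP ->.
  by rewrite eqxx.
split; first exact: (var_op0 omW stdK l0 rho2 x nf f0).
apply: esum1 => p _.
have np := nice_indic (measurable_triple a l p) nf.
rewrite (var_op0 omW stdK l0 rho2 x np) ?mul0e//.
by apply: negligibleS f0 => y /=; apply: contraNN => /eqP ->; rewrite mulr0.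
Qed.

Lemma cube_avg_ge0 (f : Rd -> C) a l : 0 <= l -> (0 <= cube_avg f a l)%E.
Proof.
move=> l0; rewrite mule_ge0//; last by rewrite lee_fin invr_ge0 exprn_ge0.
by apply: integral_ge0 => y _; rewrite lee_fin cmod_ge0.
Qed.

Theorem sparse_step_std (eps : R) : 0 < eps < 1 -> exists C0 : R, 0 < C0 /\
  forall a l, 0 < l -> forall f, nice a l f -> exists F : set idx,
    [/\ disjoint_dyadic_family a l F,
        (\esum_(p in F) ((dyad_side l p ^+ d)%:E) <= (eps * l ^+ d)%:E)%E &
        forall Fb : set idx, disjoint_dyadic_family a l Fb -> covers a l Fb F ->
          ae_in (cube a l) (fun x =>
            (`|var_op K rho f x - localized_sum K rho f a l Fb x|
               <= C0%:E * cube_avg f (dil_corner 3 a l) (3 * l))%E)].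
Proof.
move=> /andP[eps0 eps1].
(* A cube in no larger selected cube then has [E] in proportion at most [2 ^+ d * th1], which is one
   half. *)
pose th1 : R := (2 ^+ d.+1)^-1.
have th10 : 0 < th1 by rewrite invr_gt0 exprn_gt0.
(* Once [E] has proportion at most [delta] in the big cube, the selected cubes have total proportion
   at most [delta / th1 = eps]. *)
pose delta := eps * th1.
have delta0 : 0 < delta by rewrite mulr_gt0.
(* The first bound makes the set where [V g] is large half of the allowance for [E]; the second
   makes the set where [V (g 1_{3Q})] is large at most a quarter of [Q], as [3Q] has volume
   [3 ^ d |Q|]. *)
pose del := Num.min (delta / 2) ((4 * 3 ^+ d)^-1).
have del0 : 0 < del by rewrite lt_min divr_gt0//= invr_gt0 mulr_gt0// exprn_gt0.
have del1 : del <= delta / 2 by rewrite /del ge_min lexx.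
have del2 : del <= (4 * 3 ^+ d)^-1 by rewrite /del ge_min lexx orbT.
have [A2 A20 weak] := var_op_weak omW stdK rho2 q1 Vq del0.
pose S0 := @exceptional_const R d W.
have S00 : 0 <= S0 by exact: exceptional_const_ge0.
(* The pieces have total proportion at most [1 / A1], so the irregular points have proportion at
   most [S0 / A1 <= delta / 2]. The 1 keeps the stopping height above the average of [|f|]. *)
pose A1 := 1 + S0 / (delta / 2).
have A11 : 1 <= A1 by rewrite lerDl divr_ge0// ltW// divr_gt0.
have A10 : 0 < A1 by exact: lt_le_trans A11.
(* The first summand serves inside the cubes of the covering family, the second outside them. *)
pose C1 := @local_const R d W cK A2 + (A2 + @bad_const R d cK 1).
have lc0 : 0 <= @local_const R d W cK A2 by apply: local_const_ge0; exact: ltW.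
have bc0 : 0 <= A2 + @bad_const R d cK 1 by rewrite addr_ge0 ?(ltW A20)// bad_const_ge0.
have C10 : 0 <= C1 by exact: addr_ge0.
(* [M] is [2 * 2 ^ d * A1] times the average over the cube, which is at most [3 ^ d] times that over
   the triple cube. *)
pose C2 := C1 * (2 * (2 ^+ d * A1)) * 3 ^+ d.
have C20 : 0 <= C2 by rewrite !mulr_ge0// ?exprn_ge0// ltW.
exists (C2 + 1); split; first by rewrite ltr_wpDl.
move=> a l l0 f nf; have [mf [Mf hMf] fQ] := nf.
have mcf := cmeasurable_cmod mf.
have mQ := @measurable_cube R d a l.
have ld0 : 0 < l ^+ d by rewrite exprn_gt0.
have lebQ : leb (cube a l) = (l ^+ d)%:E by have /= -> := lebesgue_nd_cube a (ltW l0).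
set I0 := (\int[leb]_(x in cube a l) (cmod (f x))%:E)%E.
have I00 : (0 <= I0)%E by apply: integral_ge0 => y _; rewrite lee_fin cmod_ge0.
have I0fin : (I0 < +oo)%E.
  apply: (@le_lt_trans _ _ (Mf%:E * leb (cube a l))%E); last by rewrite lebQ -EFinM ltry.
  by apply: ge0_integral_le_cst => // y _; rewrite cmod_ge0/=.
have l30 : 0 <= 3 * l by rewrite mulr_ge0// ltW.
(* A zero average would make the stopping height zero. In that case [f] vanishes almost everywhere
   and the empty family works. *)
have [I0z|I0nz] := eqVneq I0 0%E.
  exists set0; split; first by split => // p p' [].
    by rewrite esum_set0 lee_fin mulr_ge0// ltW.
  move=> Fb _ _; rewrite /ae_in (_ : [set x | _] = set0); first exact: negligible_set0.
  apply/seteqP; split => // x [_ hx]; apply: hx.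
  have [-> ->] := sparse_step_trivial l0 nf I0z x Fb.
  by rewrite sube0 abse0 mule_ge0 ?lee_fin ?addr_ge0// cube_avg_ge0.
have [i0 I0E] : exists i0 : R, I0 = i0%:E.
  by exists (fine I0); rewrite fineK// ge0_fin_numE.
have i00 : 0 < i0 by rewrite -lte_fin -I0E lt0e I0nz.
pose lam := i0 / l ^+ d.
have lam0 : 0 < lam by rewrite divr_gt0.
pose th := A1 * lam.
have th0 : 0 < th by rewrite mulr_gt0.
have hth : (I0 <= (th * l ^+ d)%:E)%E.
  by rewrite I0E lee_fin /th /lam mulrA divfK ?gt_eqF// ler_peMl// ltW.
pose M := 2 * (2 ^+ d * th).
have [G [g [b [dG sG [ng nb gM fgb] [bG bM b0]]]]] := cz_decomposition d0 l0 nf th0 hth.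
have M0 : 0 < M by apply: mulr_gt0 => //; apply: mulr_gt0 => //; exact: exprn_gt0.
have sG' : (\esum_(p in G) (dyad_side l p ^+ d)%:E <= (l ^+ d / A1)%:E)%E.
  apply: (le_trans sG); rewrite -/I0 I0E -EFinM lee_fin le_eqVlt; apply/orP; left; apply/eqP.
  by rewrite /th /lam; field; rewrite !gt_eqF.
have [Z [mZ regZ lebZ]] := irregular_points d0 omW a l0 sG'.
pose E := Z `|` [set x | ((A2 * M)%:E < var_op K rho g x)%E].
have mVg := measurable_var_op_gt omW l0 stdK rho2 (A2 * M) ng.
have mE : measurable E by exact: measurableU.
have lebE : (leb (E `&` cube a l) <= (delta * l ^+ d)%:E)%E.
  apply: (@le_trans _ _ (leb E)).
    by apply: le_measure; rewrite ?inE//; exact: measurableI.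
  apply: le_trans (measureU2 _ mZ mVg) _.
  have h1 : S0 * (l ^+ d / A1) <= delta / 2 * l ^+ d.
    rewrite mulrCA [leRHS]mulrC; apply: ler_wpM2l; first exact: ltW.
    rewrite ler_pdivrMr// /A1 mulrDr mulr1 mulrCA divff ?gt_eqF ?divr_gt0// mulr1 lerDr.
    by rewrite ltW// divr_gt0.
  have h2 : (leb [set x | ((A2 * M)%:E < var_op K rho g x)%E] <= (delta / 2 * l ^+ d)%:E)%E.
    have [_ _ gQ] := ng.
    apply: le_trans (weak a l l0 g (cube a l) M ng mQ M0 gM gQ) _.
    by rewrite lebQ -EFinM lee_fin; apply: ler_wpM2r => //; exact: ltW.
  rewrite (splitr delta) mulrDl EFinD; apply: leeD => //; apply: (le_trans lebZ).
  by rewrite lee_fin.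
have intE D : measurable D -> (\int[leb]_(x in D) (\1_E x : R)%:E = leb (E `&` D))%E.
  by move=> mD; rewrite integral_indic.
have mhE : measurable_fun setT (\1_E : Rd -> R) by exact: measurable_indic.
have hE01 x : 0 <= (\1_E x : R) <= 1 by rewrite indicE; case: (x \in E); rewrite ?lexx ?ler01.
have hEQ : (\int[leb]_(x in cube a l) (\1_E x : R)%:E <= (th1 * l ^+ d)%:E)%E.
  rewrite intE//; apply: (le_trans lebE); rewrite lee_fin; apply: ler_wpM2r; first exact: ltW.
  by rewrite /delta ler_piMl ?(ltW th10)// ltW.
have [F [dF sF iF nF]] := stopping_time l0 d0 th10 mhE hE01 hEQ.
exists F; split => //.
  apply: (le_trans sF); rewrite intE//.
  apply: (@le_trans _ _ (th1^-1%:E * (delta * l ^+ d)%:E)%E).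
    by apply: lee_wpmul2l => //; rewrite lee_fin invr_ge0 ltW.
  rewrite -EFinM lee_fin le_eqVlt; apply/orP; left; apply/eqP.
  by rewrite /delta; field; rewrite gt_eqF.
move=> Fb dFb cov.
have avg : (( C1 * M)%:E <= (C2 + 1)%:E * cube_avg f (dil_corner 3 a l) (3 * l))%E.
  have h : ((i0 * ((3 * l) ^+ d)^-1)%:E <= cube_avg f (dil_corner 3 a l) (3 * l))%E.
    rewrite /cube_avg EFinM -I0E; apply: lee_wpmul2r; first by rewrite lee_fin invr_ge0 exprn_ge0.
    apply: ge0_subset_integral_real => //.
    - exact: measurable_cube.
    - by move=> y _; exact: cmod_ge0.
    exact: cube_sub_dil3.
  apply: (@le_trans _ _ ((C2 + 1)%:E * (i0 * ((3 * l) ^+ d)^-1)%:E)%E); last first.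
    by apply: lee_wpmul2l => //; rewrite lee_fin addr_ge0.
  rewrite -EFinM lee_fin.
  have -> : C1 * M = C2 * (i0 * ((3 * l) ^+ d)^-1).
    rewrite /C2 /M /th /lam exprMn; field.
    by rewrite !gt_eqF ?exprn_gt0.
  by apply: ler_wpM2r; [rewrite mulr_ge0 ?(ltW i00)// invr_ge0 exprn_ge0|rewrite lerDl].
have nV := var_op_fin_ae omW l0 stdK rho2 q1 Vq nf.
(* Two null sets are discarded: where [V f] is infinite, and where a point outside [F] has the
   indicator of [E] above [th1]. *)
apply: negligibleS (negligibleU nV nF) => x [Qx hx].
apply: contrapT => /not_orP[/eqP Vfin hF]; apply: hx; apply: le_trans avg.
have V0 h y : (0 <= var_op K rho h y)%E by exact: var_op_ge0.
have [[p [Fbp px]]|hp] := pselect (exists p, Fb p /\ dyad a l p x).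
  have [dFbi disFb] := dFb.
  pose inn y : C := (\1_(triple a l p) y : C) * f y.
  pose out y : C := (\1_(~` triple a l p) y : C) * f y.
  have mT := measurable_triple a l p.
  have ni : nice a l inn by exact: nice_indic.
  have no : nice a l out by apply: nice_indic => //; exact: measurableC.
  have split_f y : f y = inn y + out y.
    rewrite /inn /out !indicE; have [Ty|Ty] := pselect (triple a l p y).
      by rewrite (mem_set Ty) memNset ?mul0r ?mul1r ?addr0// => /(_ Ty).
    by rewrite (memNset Ty) mem_set ?mul0r ?mul1r ?add0r.
  have -> : localized_sum K rho f a l Fb x = var_op K rho inn x.
    rewrite /localized_sum (esum_single Fbp).
    - by rewrite indicE mem_set// mule1.
    - by rewrite mule_ge0// lee_fin.
    move=> p' Fbp' pp'; rewrite indicE memNset ?mule0// => p'x.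
    by have /seteqP[h _] := disFb _ _ Fbp' Fbp pp'; exact: (h x).
  pose v := dyad_side l p ^+ d.
  have v0 : 0 < v by rewrite exprn_gt0// dyad_side_gt0.
  have mD := measurable_dyad a l p.
  have Dv : leb (dyad a l p) = v%:E by have /= -> := lebesgue_nd_dyad a l0 p.
  pose ginn y : C := (\1_(triple a l p) y : C) * g y.
  have ngi : nice a l ginn by exact: nice_indic.
  have mB := measurable_var_op_gt omW l0 stdK rho2 (A2 * M) ngi.
  have hED : (leb (E `&` dyad a l p) <= (v / 2)%:E)%E.
    rewrite -intE//; apply: le_trans (iF p (dFbi _ Fbp) _) _.
      exact: (dyad_in_cover d0 l0 dF dFb cov Fbp).
    rewrite -/v lee_fin le_eqVlt; apply/orP; left; apply/eqP.
    by rewrite /th1 exprS; field; rewrite gt_eqF// exprn_gt0.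
  have hB : (leb [set x | ((A2 * M)%:E < var_op K rho ginn x)%E] <= (v / 4)%:E)%E.
    have giM y : cmod (ginn y) <= M by apply: le_trans (gM y); exact: cmod_indicM_le.
    have giT y : ~ triple a l p y -> ginn y = 0.
      by move=> Ty; rewrite /ginn indicE memNset// mul0r.
    apply: le_trans (weak a l l0 ginn _ M ngi mT M0 giM giT) _.
    rewrite lebesgue_triple// -EFinM lee_fin -/v mulrA mulrC; apply: ler_wpM2l; first exact: ltW.
    apply: (@le_trans _ _ ((4 * 3 ^+ d)^-1 * 3 ^+ d)); first by apply: ler_wpM2r => //; rewrite exprn_ge0.
    by rewrite invfM mulrC mulrA mulrAC divff ?gt_eqF ?exprn_gt0// mul1r.
  have [x0 [px0 Ex0 Bx0]] := local_average_small mE mB mD v0 Dv hED hB.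
  have /not_orP[Zx0 Vx0] := Ex0.
  have regx0 := regZ x0 Zx0.
  have Vg : (var_op K rho g x0 <= (A2 * M)%:E)%E by rewrite leNgt; apply/negP; exact: Vx0.
  have Vg3 : (var_op K rho ginn x0 <= (A2 * M)%:E)%E by rewrite leNgt; apply/negP; exact: Bx0.
  have ob : (var_op K rho out x <= (@local_const R d W cK A2 * M)%:E)%E.
    exact: (local_bound d0 omW stdK l0 rho2 nf ng nb (ltW M0) gM fgb dG bG bM b0 px0 px regx0 Vg Vg3).
  (* Subadditivity is used in both directions, for [f = inn + out] and for [inn = f - out]. *)
  apply: (@abse_diff_le _ _ (var_op K rho out x)) => //.
  - apply: (le_trans ob); rewrite lee_fin; apply: ler_wpM2r; first exact: ltW.
    by rewrite /C1 lerDl.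
  - exact: (var_op_add omW stdK l0 rho2 x nf ni no).
  rewrite -(var_opN omW stdK l0 rho2 x no).
  apply: (var_op_add omW stdK l0 rho2 x ni nf (niceN no)) => y.
  by rewrite split_f addrK.
have -> : localized_sum K rho f a l Fb x = 0%E.
  apply: esum1 => p Fbp; rewrite indicE memNset ?mule0// => px.
  by apply: hp; exists p.
rewrite sube0 gee0_abs//.
(* A point outside all cubes of [Fb] is outside all cubes of [F], since [Fb] covers [F]. There the
   indicator of [E] is at most [th1 < 1], hence zero. *)
have Ex : ~ E x.
  move=> Ex; apply: hF; split => //; split.
    move=> p Fp px; have [p' Fbp' sub] := cov _ Fp.
    by apply: hp; exists p'; split => //; exact: sub.
  by rewrite indicE mem_set// /th1 invf_lt1 ?exprn_gt0// exprn_egt1// ltr1n.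
have /not_orP[Zx Vx] := Ex.
apply: le_trans (var_op_regular d0 omW stdK l0 rho2 nf ng nb (ltW M0) fgb dG bG bM b0 (regZ x Zx)) _.
apply: (@le_trans _ _ ((A2 * M)%:E + (@bad_const R d cK 1 * M)%:E)%E).
  by apply: leeD => //; rewrite leNgt; apply/negP; exact: Vx.
rewrite -EFinD lee_fin -mulrDl; apply: ler_wpM2r; first exact: ltW.
by rewrite /C1 lerDr.
Qed.

End main_step.

(** * Reduction to a kernel vanishing on the diagonal and a function bounded everywhere *)

Section reduction.
Context {R : realType} {d : nat}.
Local Notation leb := (@lebesgue_nd R d).
Local Notation C := (complex R).
Local Notation Rd := (d.-tuple R).

(** Only positive radii occur, as a sequence strictly decreasing to 0 has positive terms. *)
Lemma var_op_congr (K K' : Rd -> Rd -> C) (rho : R) (f f' : Rd -> C) x :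
  (forall r, 0 < r -> trunc_op K r f x = trunc_op K' r f' x) -> var_op K rho f x = var_op K' rho f' x.
Proof.
move=> h; have E e : zero_seq e ->
    ((\sum_(i <oo) (cmod (trunc_op K (e i.+1) f x - trunc_op K (e i) f x) `^ rho)%:E) `^ rho^-1)%E =
    ((\sum_(i <oo) (cmod (trunc_op K' (e i.+1) f' x - trunc_op K' (e i) f' x) `^ rho)%:E) `^ rho^-1)%E.
  move=> ze; pose S (u : nat -> \bar R) := ((\sum_(i <oo) u i) `^ rho^-1)%E.
  have uv : (fun i => (cmod (trunc_op K (e i.+1) f x - trunc_op K (e i) f x) `^ rho)%:E) =
            (fun i => (cmod (trunc_op K' (e i.+1) f' x - trunc_op K' (e i) f' x) `^ rho)%:E).
    by apply/funext => i; rewrite (h _ (zero_seq_gt0 i.+1 ze)) (h _ (zero_seq_gt0 i ze)).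
  exact: (congr1 S uv).
exact: (congr1 (@ereal_sup R) (eq_imagel E)).
Qed.

Definition offdiag_kernel (K : Rd -> Rd -> C) x y : C := if x == y then 0 else K x y.

Lemma trunc_op_offdiag (K : Rd -> Rd -> C) r f x : 0 < r ->
  trunc_op K r f x = trunc_op (offdiag_kernel K) r f x.
Proof.
move=> r0; apply: cint_eq => y /= ry; rewrite /offdiag_kernel ifN//.
by apply: contraTneq ry => ->; rewrite distxx -leNgt ltW.
Qed.

Lemma std_kernel_offdiag (K : Rd -> Rd -> C) (omega om : R -> R) :
  CZ_kernel K omega -> (forall t, 0 <= t -> 0 <= omega t) -> (forall t, 0 <= t -> omega t <= om t) ->
  exists cK, std_kernel (offdiag_kernel K) om cK.
Proof.
move=> [c [Kb Kd]] omega0 le; exists `|c|.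
have iD (x y : Rd) : 0 <= (dist x y ^+ d)^-1 by rewrite invr_ge0 exprn_ge0// dist_ge0.
split => //.
- by move=> x; rewrite /offdiag_kernel eqxx.
- move=> x y xy; rewrite /offdiag_kernel ifN//; apply: le_trans (Kb x y xy) _.
  by apply: ler_wpM2r => //; exact: ler_norm.
move=> x x' y xy h; have D0 := dist_gt0 xy.
have x'y : x' != y by apply: contraTneq h => ->; rewrite -ltNge ltr_pdivrMr// ltr_pMr// ltr1n.
have nyx : (y == x) = false by rewrite eq_sym (negbTE xy).
have nyx' : (y == x') = false by rewrite eq_sym (negbTE x'y).
rewrite /offdiag_kernel (negbTE xy) (negbTE x'y) nyx nyx'.
apply: le_trans (Kd x x' y xy h) _.
have t0 : 0 <= dist x x' / dist x y by rewrite divr_ge0// dist_ge0.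
rewrite -mulrA; apply: le_trans (_ : _ <= `|c| * (omega (dist x x' / dist x y) * (dist x y ^+ d)^-1)) _.
  by apply: ler_wpM2r; [rewrite mulr_ge0// omega0|exact: ler_norm].
by apply: ler_wpM2l => //; apply: ler_wpM2r => //; exact: le.
Qed.

Lemma var_op_offdiag (K : Rd -> Rd -> C) (om : R -> R) (W cK rho : R) (f f' : Rd -> C) x :
  dini_bound om W -> std_kernel (offdiag_kernel K) om cK -> cmeasurable f -> cmeasurable f' ->
  negligible leb [set y | f y != f' y] ->
  var_op K rho f x = var_op (offdiag_kernel K) rho f' x.
Proof.
move=> omW stdK mf mf' ff'; apply: var_op_congr => r r0; rewrite trunc_op_offdiag//.
have mK := cmeasurable_kernel omW stdK x.
apply: cint_ae_eq; [exact: measurable_dist_gt|exact: cmeasurableM|exact: cmeasurableM|].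
by apply: negligibleS ff' => y /=; apply: contraNN => /eqP ->.
Qed.

(** Setting [f] to zero where it exceeds its essential bound changes it on a null set only. The
    pointwise inequality lets the average of [f'] be replaced by that of [f] in the conclusion. *)
Lemma bounded_version (f : Rd -> C) (a : Rd) (l : R) : Linfty_fun f -> (forall x, ~ cube a l x -> f x = 0) ->
  exists f', [/\ nice a l f', negligible leb [set y | f y != f' y] & forall y, cmod (f' y) <= cmod (f y)].
Proof.
move=> [mf [M nM]] fQ; have mcf := cmeasurable_cmod mf.
pose A := [set y | cmod (f y) <= M].
have mA : measurable A.
  rewrite (_ : A = (fun y => cmod (f y)) @^-1` `]-oo, M]%classic).
    by rewrite -[X in measurable X]setTI; exact: mcf.
  by apply/seteqP; split => y /=; rewrite /A in_itv.
exists (fun y => (\1_A y : C) * f y); split; first split.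
- by apply: cmeasurableM => //; exact: cmeasurable_indic.
- exists `|M| => y; rewrite indicE; have [Ay|Ay] := pselect (A y).
    by rewrite mem_set// mul1r; apply: le_trans Ay _; exact: ler_norm.
  by rewrite memNset// mul0r cmod0.
- by move=> y /fQ ->; rewrite mulr0.
- apply: negligibleS nM => y /= /eqP h; rewrite ltNge; apply/negP => Ay; apply: h.
  by rewrite indicE mem_set// mul1r.
- by move=> y; exact: cmod_indicM_le.
Qed.

End reduction.

Theorem mainTheorem1 (R : realType) (d : nat)
    (K : d.-tuple R -> d.-tuple R -> complex.complex R) (omega : R -> R)
    (T : (d.-tuple R -> complex.complex R) -> d.-tuple R -> complex.complex R) (rho q : R) :
  (0 < d)%N ->
  dini_modulus omega ->
  CZ_kernel K omega ->
  CZ_operator T K ->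
  2 < rho ->
  1 < q ->
  var_Lq_bounded K rho q ->
  forall eps : R, 0 < eps < 1 ->
  exists C : R, 0 < C /\
  forall (a : d.-tuple R) (l : R), 0 < l ->
  forall f : d.-tuple R -> complex.complex R, Linfty_fun f ->
    (forall x, ~ cube a l x -> f x = 0) ->
  exists F : set (nat * d.-tuple nat),
    [/\ disjoint_dyadic_family a l F,
        (\esum_(p in F) ((dyad_side l p ^+ d)%:E) <= (eps * l ^+ d)%:E)%E,
        ae_in (cube a l) (fun x =>
          (`|var_op K rho f x - localized_sum K rho f a l F x|
             <= C%:E * cube_avg f (dil_corner 3 a l) (3 * l))%E) &
        forall Fb : set (nat * d.-tuple nat),
          disjoint_dyadic_family a l Fb -> covers a l Fb F ->
          ae_in (cube a l) (fun x =>
            (`|var_op K rho f x - localized_sum K rho f a l Fb x|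
               <= C%:E * cube_avg f (dil_corner 3 a l) (3 * l))%E)].

Proof.
move=> d0 hdini Kcz _ rho2 q1 Vq eps heps.
have [om [W [omW le]]] := dini_boundP hdini.
have [_ omega0 _ _ _] := hdini.
have [cK stdK] := std_kernel_offdiag Kcz omega0 le.
pose K' := offdiag_kernel K.
have Vq' : var_Lq_bounded K' rho q.
  have [c hc] := Vq; exists c => f lf; have [mf _] := lf.
  rewrite (_ : var_op K' rho f = var_op K rho f); first exact: hc.
  apply/funext => x; symmetry; apply: (var_op_offdiag rho x omW stdK mf mf).
  rewrite (_ : [set y | _] = set0); first exact: negligible_set0.
  by apply/seteqP; split => // y /=; rewrite eqxx.
have [C0 [C00 main]] := sparse_step_std d0 omW stdK rho2 q1 Vq' heps.
exists C0; split => // a l l0 f Lf fQ.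
have [f' [nf' ff' f'le]] := bounded_version Lf fQ.
have [mf' _ _] := nf'; have [mf _] := Lf.
have [F [dF sF hF]] := main a l l0 f' nf'.
have VE x : var_op K rho f x = var_op K' rho f' x by exact: (var_op_offdiag rho x omW stdK mf mf' ff').
have LE Fb x : localized_sum K rho f a l Fb x = localized_sum K' rho f' a l Fb x.
  apply: eq_esum => p _; pose Tr := dil_cube 3 (dyad_corner a l p) (dyad_side l p).
  have mI : @cmeasurable R d (fun y => \1_Tr y : complex R).
    by apply: cmeasurable_indic; exact: measurable_cube.
  have nT : negligible (@lebesgue_nd R d)
      [set y | (\1_Tr y : complex R) * f y != (\1_Tr y : complex R) * f' y].
    by apply: negligibleS ff' => y /=; apply: contraNN => /eqP ->.
  by rewrite -/Tr (var_op_offdiag rho x omW stdK (cmeasurableM mI mf) (cmeasurableM mI mf') nT).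
have avg : (C0%:E * cube_avg f' (dil_corner 3 a l) (3 * l) <= C0%:E * cube_avg f (dil_corner 3 a l) (3 * l))%E.
  apply: lee_wpmul2l; first by rewrite lee_fin ltW.
  apply: lee_wpmul2r; first by rewrite lee_fin invr_ge0 exprn_ge0// mulr_ge0// ltW.
  apply: ge0_le_integral_real; [exact: measurable_cube|exact: cmeasurable_cmod|exact: cmeasurable_cmod|].
  by move=> y _; rewrite cmod_ge0/=.
have key Fb : disjoint_dyadic_family a l Fb -> covers a l Fb F ->
    ae_in (cube a l) (fun x => (`|var_op K rho f x - localized_sum K rho f a l Fb x|
       <= C0%:E * cube_avg f (dil_corner 3 a l) (3 * l))%E).
  move=> dFb cov; apply: negligibleS (hF Fb dFb cov) => x [Qx hx]; split => // h; apply: hx.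
  by rewrite VE LE; apply: le_trans h avg.
(* The statement for [F] is the case [Fb = F], a family being covered by itself. *)
exists F; split => //; apply: key => // p Fp; by exists p.
Qed.
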